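(* Let $n\ge 1$ be an integer and let $\Omega\subseteq\mathbf{R}^n$ be a bounded domain. Let $0<\Gamma_1\le\Gamma_2\le\Gamma_3\le\cdots$ be the eigenvalues of the clamped plate problem on $\Omega$, repeated according to multiplicity, and put $\alpha=\frac{V(\Omega)}{(2\pi)^n}$. Then there is a constant $A_1>0$ depending only on $n$ and $\Omega$ such that for every integer $m$ with $1\le m\le n$, $$\sum_{i=1}^k\Gamma_i\ \ge\ \frac{n}{n+4}\,\omega_n^{-\frac4n}\alpha^{-\frac4n}k^{1+\frac4n}+A_1k^{1+\frac3n}-O\!\left(k^{\frac{n-m+4}{n}}\right),$$ that is, there is a constant $C\ge0$ depending only on $n$, $m$ and $\Omega$ such that for every integer $k\ge1$ the left-hand side is at least the sum of the first two terms on the right minus $C\,k^{\frac{n-m+4}{n}}$.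
   Context: $V(\Omega)$ denotes the volume (Lebesgue measure) of $\Omega$ and $\omega_n$ the volume of the unit ball in $\mathbf{R}^n$. The clamped plate problem is $\Delta^2u=\Gamma u$ in $\Omega$, $u=\frac{\partial u}{\partial\nu}=0$ on $\partial\Omega$, where $\Delta$ is the Laplacian and $\nu$ is the outward unit normal to $\partial\Omega$ (understood in the usual weak sense, with $u\in H^2_0(\Omega)$). Its spectrum is real and discrete, $0<\Gamma_1\le\Gamma_2\le\Gamma_3\le\cdots\to\infty$, each eigenvalue repeated according to its (finite) multiplicity. *)

(* Defs.v *)
From HB Require Import structures.
From mathcomp Require Import all_boot all_order all_algebra.
From mathcomp Require Import all_classical all_reals all_analysis.
From mathcomp Require Import measurable_realfun.

Set Implicit Arguments.
Unset Strict Implicit.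
Unset Printing Implicit Defensive.

Import Order.TTheory GRing.Theory Num.Theory.
Import numFieldNormedType.Exports.

Local Open Scope classical_set_scope.
Local Open Scope ring_scope.

(* Euclidean space R^n is 'rV[R]_n. Its library norm is the sup norm, which
   induces the usual topology, hence the usual notions of open, bounded,
   connected and compact set. *)

(* Borel sigma-algebra *)
HB.instance Definition _ (R : realType) (m n : nat) :=
  @isMeasurable.Build default_measure_display 'M[R]_(m, n)
    <<s [set A : set 'M[R]_(m, n) | open A] >>
    (@sigma_algebra0 _ setT _) (@sigma_algebraC _ _)
    (@sigma_algebra_bigcup _ setT _).

Section lebesgue_rV.
Context {R : realType}.

Definition cons_rV n (p : R * 'rV[R]_n) : 'rV[R]_n.+1 :=
  row_mx (p.1)%:M p.2 : 'rV[R]_(1 + n).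

(* n-dimensional Lebesgue measure, as the iterated product of the
   one-dimensional one *)
Fixpoint lebesgue_rV (n : nat) : set 'rV[R]_n -> \bar R :=
  if n is n'.+1 then
    pushforward (@lebesgue_measure R \x @lebesgue_rV n')%E (@cons_rV n')
  else \d_(0 : 'rV[R]_0).

Lemma open_measurable_rV n (A : set 'rV[R]_n) : open A -> measurable A.
Proof. by move=> oA; exact: sub_sigma_algebra. Qed.

Lemma cons_rV0 n (p : R * 'rV[R]_n) : cons_rV p 0 ord0 = p.1.
Proof.
rewrite /cons_rV (_ : ord0 = lshift n (ord0 : 'I_1)); last exact: val_inj.
by rewrite (@row_mxEl _ _ 1) mxE eqxx mulr1n.
Qed.

Lemma cons_rVS n (p : R * 'rV[R]_n) j : cons_rV p 0 (lift ord0 j) = p.2 0 j.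
Proof.
rewrite /cons_rV (_ : lift ord0 j = rshift 1 j); last exact: val_inj.
by rewrite (@row_mxEr _ _ 1).
Qed.

Let rat_point n (c : rat * 'rV[rat]_n) : R * 'rV[R]_n :=
  (ratr c.1, map_mx ratr c.2).

Let rat_box n (c : (rat * 'rV[rat]_n) * nat) : set (R * 'rV[R]_n) :=
  ball (rat_point c.1).1 c.2.+1%:R^-1 `*` ball (rat_point c.1).2 c.2.+1%:R^-1.

Let rat_box_measurable n c : measurable (@rat_box n c).
Proof.
apply: measurableX; first by apply: open_measurable; exact: ball_open.
by apply: open_measurable_rV; exact: ball_open.
Qed.

Let rat_approx n (p : R * 'rV[R]_n) (e : R) : 0 < e ->
  exists c : rat * 'rV[rat]_n, ball (rat_point c).1 e p.1 /\
    ball (rat_point c).2 e p.2.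
Proof.
move=> e0.
have H (x : R) : exists q : rat, `|ratr q - x| < e.
  have : ball x e `&` range (@ratr R) !=set0.
    apply: dense_rat; last exact: ball_open.
    by exists x; exact: ballxx.
  move=> [t [xt [q _ qt]]]; exists q; rewrite qt.
  by move: xt; rewrite /ball /= distrC.
have [f fP] := choice H.
exists (f p.1, map_mx f p.2); split => /=.
  exact: fP.
by split=> // i j; rewrite !mxE; exact: fP.
Qed.

Lemma open_measurable_prod_rV n (U : set (R * 'rV[R]_n)) :
  open U -> measurable U.
Proof.
move=> oU.
rewrite (_ : U = \bigcup_(c in [set c | @rat_box n c `<=` U]) rat_box c).
  rewrite bigcup_mkcond; apply: countable_bigcupT_measurable => [|c].
    exact: countableP.
  by case: ifP => _ //; exact: rat_box_measurable.
apply/seteqP; split => [p Up|p [c /= + cp]]; last exact.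
move: oU; rewrite openE => /(_ _ Up); rewrite /interior /= => -[[A B] /=].
rewrite -!nbhs_ballE => -[[a /= a0 aA] [b /= b0 bB]] ABU.
pose e := Num.min a b.
have e0 : 0 < e by rewrite lt_min a0 b0.
pose N := Num.truncn (2 / e).
have Ne : N.+1%:R^-1 + N.+1%:R^-1 <= e.
  have := truncn_lt_nat N.+1 (divr_ge0 (ler0n R 2) (ltW e0)).
  rewrite ltnSn ltr_pdivrMr // => /esym h.
  rewrite -mulr2n -[leLHS]mulr_natl ler_pdivrMr// mulrC; exact: ltW.
have N0 : 0 < N.+1%:R^-1 :> R by rewrite invr_gt0.
have [c [cp1 cp2]] := rat_approx p N0.
exists (c, N) => // q [q1 q2]; apply: ABU; split => /=.
  apply: aA; apply: (@le_ball _ _ p.1 e); first by rewrite ge_min lexx.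
  apply: (le_ball Ne); exact: ball_triangle (ball_sym cp1) q1.
apply: bB; apply: (@le_ball _ _ p.2 e); first by rewrite ge_min lexx orbT.
apply: (le_ball Ne); exact: ball_triangle (ball_sym cp2) q2.
Qed.

Lemma continuous_cons_rV n : continuous (@cons_rV n).
Proof.
move=> p; apply/cvg_ballP => e e0.
exists (ball p.1 e, ball p.2 e); first by split; exact: nbhsx_ballx.
move=> q [/= q1 [_ q2]]; split=> // i j; rewrite (ord1 i).
have [k ->|->] := unliftP ord0 j; first by rewrite !cons_rVS; exact: q2.
by rewrite !cons_rV0.
Qed.

Lemma measurable_cons_rV n : measurable_fun setT (@cons_rV n).
Proof.
apply: (@measurability _ _ _ _ _ _ [set A : set 'rV[R]_n.+1 | open A]) => //.
move=> _ [A oA <-]; rewrite setTI; apply: open_measurable_prod_rV.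
by apply: open_comp => // p _; exact: continuous_cons_rV.
Qed.

Lemma measurable_coord_rV n (i : 'I_n) :
  measurable_fun setT (fun v : 'rV[R]_n => v 0 i).
Proof.
apply: (measurability _ (RGenOpens.measurableE R)) => _ [_ [a [b ->]] <-].
rewrite setTI; apply: open_measurable_rV.
apply: open_comp; last exact: interval_open.
by move=> v _; exact: coord_continuous.
Qed.

Definition box n (A : 'I_n -> set R) : set 'rV[R]_n :=
  [set v | forall i, A i (v 0 i)].

Lemma measurable_box n (A : 'I_n -> set R) :
  (forall i, measurable (A i)) -> measurable (box A).
Proof.
move=> mA.
rewrite (_ : box A = \bigcap_(i in setT) (fun v : 'rV[R]_n => v 0 i) @^-1` A i).
  apply: fin_bigcap_measurable => [|i _]; first exact: finite_finset.
  by rewrite -[X in measurable X]setTI; exact: measurable_coord_rV.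
by apply/seteqP; split => v /= H i; [move=> _|]; exact: H.
Qed.

Let lebesgue_rV_step n (m : {sigma_finite_measure set 'rV[R]_n -> \bar R}) :
  (forall A, (forall i, measurable (A i)) ->
    m (box A) = \prod_(i < n) lebesgue_measure (A i))%E ->
  forall A, (forall i, measurable (A i)) ->
  (pushforward (@lebesgue_measure R \x m) (@cons_rV n) (box A) =
   \prod_(i < n.+1) lebesgue_measure (A i))%E.
Proof.
move=> mE A mA; rewrite big_ord_recl -mE // /pushforward.
rewrite -product_measure1E; [|exact: mA|by apply: measurable_box => i; exact: mA].
congr (_ _); apply/seteqP; split => [[x v] /= H|[x v] [/= Hx Hv] i].
  split=> [|i] /=; first by have := H ord0; rewrite cons_rV0.
  by have := H (lift ord0 i); rewrite cons_rVS.
by have [k ->|->] := unliftP ord0 i; rewrite ?cons_rVS ?cons_rV0//; exact: Hv.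
Qed.

Let sigma_finite_box n (m : {measure set 'rV[R]_n -> \bar R}) :
  (forall A, (forall i, measurable (A i)) ->
    m (box A) = \prod_(i < n) lebesgue_measure (A i))%E ->
  sigma_finite setT m.
Proof.
move=> mE.
exists (fun k => box (fun=> `[- k%:R, k%:R]%classic)).
  apply/seteqP; split => // v _.
  exists (Num.truncn `|v|).+1 => // i /=.
  rewrite in_itv /= -ler_norml; apply: (@le_trans _ _ `|v|).
    by rewrite /Num.norm /= mx_normrE; exact: (le_bigmax _ (fun p => `|v p.1 p.2|) (0, i)).
  apply: ltW; have := truncn_lt_nat (Num.truncn `|v|).+1 (normr_ge0 v).
  by rewrite ltnSn => /esym.
move=> k; split; first by apply: measurable_box => i; exact: measurable_itv.
rewrite mE; last by move=> i; exact: measurable_itv.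
suff /andP[] : (0 <= \prod_(i < n)
  lebesgue_measure `[(- k%:R : R)%R, (k%:R)%R]%classic < +oo)%E by [].
apply: (big_ind (fun x : \bar R => (0 <= x < +oo)%E)).
- by rewrite ltry lee_fin ler01.
- move=> x y /andP[x0 xoo] /andP[y0 yoo]; rewrite mule_ge0//=.
  by rewrite lte_mul_pinfty// ge0_fin_numE.
- move=> i _; rewrite measure_ge0/= lebesgue_measure_itv/=.
  by case: ifP => _; rewrite ?ltry// -EFinD ltry.
Qed.

Let lebesgue_rV_spec n :
  exists2 m : {sigma_finite_measure set 'rV[R]_n -> \bar R}, @lebesgue_rV n = m &
  forall A, (forall i, measurable (A i)) ->
    (m (box A) = \prod_(i < n) lebesgue_measure (A i))%E.
Proof.
elim: n => [|n [m IH mE]].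
  exists [the {sigma_finite_measure set _ -> \bar R} of \d_(0 : 'rV[R]_0)] => //.
  by move=> A mA; rewrite big_ord0 /= diracE mem_set// => -[].
have mf : measurable_fun
    (setT : set (measurableTypeR R * 'rV[R]_n)%type) (@cons_rV n).
  exact: measurable_cons_rV.
pose m1 : {measure set (measurableTypeR R * 'rV[R]_n)%type -> \bar R} :=
   (@lebesgue_measure R \x m)%E.
unshelve epose (m0 :=
  pushforward m1 (@cons_rV n) : {measure set 'rV[R]_n.+1 -> \bar R}).
  exact: mf.
have m0E : forall A, (forall i, measurable (A i)) ->
    (m0 (box A) = \prod_(i < n.+1) lebesgue_measure (A i))%E.
  exact: lebesgue_rV_step.
pose m0_fin := Measure_isSigmaFinite.Build _ _ _ m0 (sigma_finite_box m0E).
pose m2 := HB.pack_for {sigma_finite_measure set 'rV[R]_n.+1 -> \bar R}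
  (Measure.sort m0) m0_fin.
by exists m2 => //; rewrite /= IH.
Qed.

Let lebesgue_rV_set0 n : @lebesgue_rV n set0 = 0%E.
Proof. by have [m -> _] := lebesgue_rV_spec n; exact: measure0. Qed.

Let lebesgue_rV_ge0 n A : (0 <= @lebesgue_rV n A)%E.
Proof. by have [m -> _] := lebesgue_rV_spec n; exact: measure_ge0. Qed.

Let lebesgue_rV_semi_sigma_additive n : semi_sigma_additive (@lebesgue_rV n).
Proof.
by have [m -> _] := lebesgue_rV_spec n; exact: measure_semi_sigma_additive.
Qed.

HB.instance Definition _ n := isMeasure.Build _ _ _ (@lebesgue_rV n)
  (@lebesgue_rV_set0 n) (@lebesgue_rV_ge0 n)
  (@lebesgue_rV_semi_sigma_additive n).

Lemma lebesgue_rV_box n (A : 'I_n -> set R) : (forall i, measurable (A i)) ->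
  (lebesgue_rV (box A) = \prod_(i < n) lebesgue_measure (A i))%E.
Proof. by have [m -> mE] := lebesgue_rV_spec n; exact: mE. Qed.

HB.instance Definition _ n := Measure_isSigmaFinite.Build _ _ _
  (@lebesgue_rV n) (sigma_finite_box (@lebesgue_rV_box n)).

End lebesgue_rV.

Section clamped_plate.
Context {R : realType} {n : nat}.
Implicit Types (Omega : set 'rV[R]_n) (f g u v w phi : 'rV[R]_n -> R).

Local Notation mu := (@lebesgue_rV R n).

Definition domain Omega :=
  [/\ open Omega, connected Omega & Omega !=set0].

Definition unit_ball : set 'rV[R]_n :=
  [set x | \sum_(i < n) x 0 i ^+ 2 < 1].

Definition partial (i : 'I_n) f : 'rV[R]_n -> R :=
  fun x => 'D_(delta_mx 0 i) f x.

(* partials [:: i1; ...; ir] f = d/dx_i1 (... (d/dx_ir f)) *)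
Definition partials (s : seq 'I_n) f := foldr partial f s.

Definition laplacian f : 'rV[R]_n -> R :=
  fun x => \sum_(i < n) partials [:: i; i] f x.

Definition smooth f := forall s : seq 'I_n,
  continuous (partials s f) /\
  forall i x, derivable (partials s f) x (delta_mx 0 i).

Definition test_function Omega phi :=
  [/\ smooth phi, compact (closure [set x | phi x != 0]) &
      closure [set x | phi x != 0] `<=` Omega].

(* Elements of L^2(Omega) and H^2_0(Omega) are represented by functions on the
   whole space, whose values outside Omega are irrelevant; functions are
   identified when they agree almost everywhere in Omega. *)
Definition L2 Omega f :=
  measurable_fun Omega f /\
  (\int[mu]_(x in Omega) ((f x) ^+ 2)%:E < +oo)%E.

Definition weak_partials Omega (s : seq 'I_n) u g :=
  L2 Omega g /\
  forall phi, test_function Omega phi ->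
    \int[mu]_(x in Omega) (u x * partials s phi x) =
    (-1) ^+ size s * \int[mu]_(x in Omega) (g x * phi x).

Definition weak_laplacian Omega u w :=
  L2 Omega w /\
  forall phi, test_function Omega phi ->
    \int[mu]_(x in Omega) (u x * laplacian phi x) =
    \int[mu]_(x in Omega) (w x * phi x).

Definition H2 Omega u :=
  L2 Omega u /\
  forall s : seq 'I_n, (size s <= 2)%N -> exists g, weak_partials Omega s u g.

(* closure of the test functions in H^2(Omega) *)
Definition H20 Omega u :=
  H2 Omega u /\
  exists phi : nat -> 'rV[R]_n -> R,
    (forall k, test_function Omega (phi k)) /\
    forall s g, (size s <= 2)%N -> weak_partials Omega s u g ->
      (\int[mu]_(x in Omega) ((partials s (phi k) x - g x) ^+ 2)%:E)%E
        @[k --> \oo] --> 0%E.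

(* weak solutions of  Delta^2 u = lambda u,  u = du/dnu = 0 on the boundary *)
Definition clamped_solution Omega (lambda : R) u :=
  H20 Omega u /\
  forall v Lu Lv, H20 Omega v ->
    weak_laplacian Omega u Lu -> weak_laplacian Omega v Lv ->
    \int[mu]_(x in Omega) (Lu x * Lv x) =
    lambda * \int[mu]_(x in Omega) (u x * v x).

(* the space of weak solutions has dimension d (d = 0 when lambda is not an
   eigenvalue) *)
Definition clamped_multiplicity Omega (lambda : R) (d : nat) :=
  exists e : 'I_d -> 'rV[R]_n -> R,
    [/\ forall i, clamped_solution Omega lambda (e i),
        forall c : 'I_d -> R,
          {ae mu, forall x, Omega x -> \sum_(i < d) c i * e i x = 0} ->
          forall i, c i = 0 &
        forall u, clamped_solution Omega lambda u ->
          exists c : 'I_d -> R,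
            {ae mu, forall x, Omega x -> u x = \sum_(i < d) c i * e i x}].

(* Gamma lists the eigenvalues in nondecreasing order, each one repeated
   according to its multiplicity; indices start at 0, so that Gamma i is the
   eigenvalue usually written with index i + 1. *)
Definition clamped_spectrum Omega (Gamma : nat -> R) :=
  [/\ forall i, 0 < Gamma i,
      {homo Gamma : i j / (i <= j)%N >-> i <= j} &
      forall lambda, exists d : nat,
        clamped_multiplicity Omega lambda d /\
        ([set i | Gamma i = lambda] #= `I_d)%card].

End clamped_plate.

(* Main.v *)
From HB Require Import structures.
From mathcomp Require Import all_boot all_order all_algebra.
From mathcomp Require Import all_classical all_reals all_analysis.
From mathcomp Require Import measurable_realfun ring lra.
Require Import Defs.

(** The proof compares the eigenvalue sum with a fourth moment in frequency
space, and gains a second term because an indicator function is not smooth.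

The Fourier transform is kept real: [cosF f] and [sinF f] are the cosine and
sine integrals of [f], and [powF f], the sum of their squares, is the square
modulus of the transform.  Write [mu] for Lebesgue measure and [V] for the
volume of [Omega].  Let [v_1, ..., v_k] be an orthonormal basis of the span of
the first [k] eigenfunctions, extended by zero outside [Omega], and let [S], the
[density], be the sum of the [powF v_j].  Three facts hold.
- [0 <= S <= V]: this is Bessel's inequality for the orthonormal system and for
  the plane wave of frequency [xi] cut off by [Omega] ([density_le]).
- The integral of [S] is [(2 pi)^n k], by Plancherel ([Rintegral_density]).
- The integral of [|xi|^4 S] is at most [(2 pi)^n] times the sum of the first
  [k] eigenvalues, since [-|xi|^2] times the transform of [v_j] is the transform
  of its Laplacian, and the sum of the squared norms of these Laplacians is the
  trace of a Gram matrix ([spectral_system], [density_moment]).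
Under the first two constraints the fourth moment is least when [S] is [V]
times the indicator of the ball of radius [r] with
[V omega_n r^n = (2 pi)^n k], and this minimum is the Weyl term.

The second term measures how far [S] must stay from that minimiser.  Let [D] be
the integral of [V - S] over [|xi| < r/2] plus the integral of [S] over
[|xi_1| >= 2 r].  Both kinds of displaced mass cost at least a fixed multiple of
[r^4] per unit ([improved_bathtub]), so a lower bound for [D] is needed.  If [S]
were nearly [V] at a low frequency [xi], then the wave of frequency [xi] cut off
by [Omega] would nearly lie in the span of the [v_j]; its transform is the
transform of the indicator of [Omega] translated by [xi], so the high frequency
part of the indicator would show up in [S].  That part is not small: moving
[Omega] by a small [h] changes its indicator by at least a constant times [h] in squared
[L^2] norm, because enough such moves carry [Omega] off itself ([jump_ge]), and
hence a power of order at least [1/r] lies in [|xi_1| >= 5 r/2]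
([high_frequency_tail]).  Averaging over [|xi| < r/2] gives
[D >= c r^(n-1)] for [r] bounded below ([spectral_defect]), so the gain
[r^4 D], divided by [(2 pi)^n], is at least a constant times [k^(1 + 3/n)].
No error term is left over: the estimate holds with [C = 0].

Bessel's inequality for the Fourier transform and Plancherel's identity are
obtained by damping the transform with [exp (- e (|xi_1| + ... + |xi_n|))].  The
damped power of [f] is a correlation of [f] with the Poisson kernel, an
approximate identity as [e] tends to 0. *)

Set Implicit Arguments.
Unset Strict Implicit.
Unset Printing Implicit Defensive.

Import Order.TTheory GRing.Theory Num.Theory.
Import numFieldNormedType.Exports.

Local Open Scope classical_set_scope.
Local Open Scope ring_scope.

(** * Real integrals, square integrability and Fubini *)

Section real_integrals.
Context d (T : measurableType d) (R : realType).
Variable mu : {measure set T -> \bar R}.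
Implicit Types f g : T -> R.

(** Composing with [EFin] once and for all keeps the whole development in real
    valued functions; extended reals appear only where finiteness is proved. *)
Definition integ f := mu.-integrable setT (EFin \o f).

Lemma integ_measurable f : integ f -> measurable_fun setT f.
Proof. by move=> /measurable_int/measurable_EFinP. Qed.

Lemma measurable_EFin f : measurable_fun setT f ->
  measurable_fun setT (fun x => (f x)%:E).
Proof. by move=> mf; apply/measurable_EFinP. Qed.

Lemma EFin_Rintegral f : integ f -> (\int[mu]_x f x)%:E = (\int[mu]_x (f x)%:E)%E.
Proof. by move=> If; rewrite fineK//; exact: integrable_fin_num. Qed.

Lemma le_integ f g : measurable_fun setT f -> (forall x, `|f x| <= g x) ->
  integ g -> integ f.
Proof.
move=> mf fg ig; apply: le_integrable ig => //; first exact/measurable_EFinP.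
by move=> x _ /=; rewrite lee_fin (le_trans (fg x))// ler_norm.
Qed.

Lemma integD f g : integ f -> integ g -> integ (fun x => f x + g x).
Proof. by move=> If Ig; exact: integrableD If Ig. Qed.

Lemma integB f g : integ f -> integ g -> integ (fun x => f x - g x).
Proof. by move=> If Ig; exact: integrableB If Ig. Qed.

Lemma integZ a f : integ f -> integ (fun x => a * f x).
Proof. by move=> If; exact: integrableZl If. Qed.

Lemma integ0 : integ (fun=> 0).
Proof. exact: integrable0. Qed.

Lemma integ_sum (I : Type) (s : seq I) (h : I -> T -> R) :
  (forall i, integ (h i)) -> integ (fun x => \sum_(i <- s) h i x).
Proof.
move=> Ih; elim: s => [|i s IH].
  by under eq_fun do rewrite big_nil; exact: integ0.
by under eq_fun do rewrite big_cons; exact: integD.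
Qed.

Lemma Rintegral_sum (I : Type) (s : seq I) (h : I -> T -> R) :
  (forall i, integ (h i)) ->
  \int[mu]_x (\sum_(i <- s) h i x) = \sum_(i <- s) \int[mu]_x h i x.
Proof.
move=> Ih; elim: s => [|i s IH].
  under eq_Rintegral do rewrite big_nil.
  by rewrite big_nil Rintegral_cst// mul0r.
under eq_Rintegral do rewrite big_cons.
by rewrite big_cons RintegralD ?IH//; [exact: Ih|exact: integ_sum].
Qed.

Lemma integ_norm f : integ f -> integ (fun x => `|f x|).
Proof. exact: integrable_norm. Qed.

Lemma ge0_integ f : measurable_fun setT f -> (forall x, 0 <= f x) ->
  (\int[mu]_x (f x)%:E < +oo)%E -> integ f.
Proof.
move=> mf f0 foo; apply/integrableP; split; first exact/measurable_EFinP.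
by under eq_integral do rewrite /= ger0_norm//.
Qed.

Lemma integ_lty f : integ f -> (\int[mu]_x (f x)%:E < +oo)%E.
Proof. exact: integrable_lty. Qed.

(** Measurability is a separate conjunct because that of [f ^+ 2] says
    nothing about the sign of [f]. *)
Definition sqinteg f :=
  measurable_fun setT f /\ integ (fun x => f x ^+ 2).

(** From [|a b| <= a^2 + b^2]. *)
Lemma sqinteg_mul f g : sqinteg f -> sqinteg g -> integ (fun x => f x * g x).
Proof.
move=> [mf f2] [mg g2]; apply: (@le_integ _ (fun x => f x ^+ 2 + g x ^+ 2)).
- exact: measurable_funM.
- move=> x; rewrite normrM -(real_normK (num_real (f x))) -(real_normK (num_real (g x))).
  have := normr_ge0 (f x); have := normr_ge0 (g x); nra.
- exact: integD.
Qed.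

Lemma sqintegZ a f : sqinteg f -> sqinteg (fun x => a * f x).
Proof.
move=> [mf f2]; split; first exact: measurable_funM.
by under eq_fun do rewrite exprMn; exact: integZ.
Qed.

Lemma sqintegD f g : sqinteg f -> sqinteg g -> sqinteg (fun x => f x + g x).
Proof.
move=> Lf Lg; have [[mf f2] [mg g2]] := (Lf, Lg); split.
  exact: measurable_funD.
rewrite (_ : (fun _ => _) = (fun x => f x ^+ 2 + 2 * (f x * g x) + g x ^+ 2)).
  by apply: integD => //; apply: integD => //; apply: integZ; exact: sqinteg_mul.
by apply/funext => x; ring.
Qed.

Lemma sqintegB f g : sqinteg f -> sqinteg g -> sqinteg (fun x => f x - g x).
Proof.
move=> Lf Lg; rewrite (_ : (fun _ => _) = (fun x => f x + -1 * g x)).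
  by apply: sqintegD => //; exact: sqintegZ.
by apply/funext => x; ring.
Qed.

Lemma sqinteg0 : sqinteg (fun=> 0).
Proof.
by split; [exact: measurable_cst|under eq_fun do rewrite expr0n; exact: integ0].
Qed.

Lemma sqinteg_sum (I : Type) (s : seq I) (h : I -> T -> R) :
  (forall i, sqinteg (h i)) -> sqinteg (fun x => \sum_(i <- s) h i x).
Proof.
move=> Ih; elim: s => [|i s IH].
  by under eq_fun do rewrite big_nil; exact: sqinteg0.
by under eq_fun do rewrite big_cons; exact: sqintegD.
Qed.

Lemma sqinteg_mulb f g : sqinteg f -> measurable_fun setT g ->
  (forall x, `|g x| <= 1) -> sqinteg (fun x => f x * g x).
Proof.
move=> [mf f2] mg g1; split; first exact: measurable_funM.
apply: le_integ f2; first by apply: measurable_funX; exact: measurable_funM.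
move=> x; rewrite ger0_norm ?sqr_ge0// exprMn ler_piMr ?sqr_ge0//.
by rewrite -real_normK ?num_real// expr_le1.
Qed.

Lemma integ_mulb f g : integ f -> measurable_fun setT g ->
  (forall x, `|g x| <= 1) -> integ (fun x => f x * g x).
Proof.
move=> If mg g1; apply: (@le_integ _ (fun x => `|f x|)).
- by apply: measurable_funM => //; exact: integ_measurable.
- by move=> x; rewrite normrM ler_piMr.
- exact: integ_norm.
Qed.

Lemma integ_mul_bounded f g (M : R) :
  integ f -> measurable_fun setT g -> (forall x, `|g x| <= M) ->
  integ (fun x => f x * g x).
Proof.
move=> If mg gM; apply: (@le_integ _ (fun x => M * `|f x|)).
- by apply: measurable_funM => //; exact: integ_measurable If.
- by move=> x; rewrite normrM mulrC ler_wpM2r.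
- by apply: integZ; exact: integ_norm.
Qed.

(** The quadratic form [s^2 A - 2 s t B + t^2 C], the integral of
    [(s f - t g)^2], is nonnegative; it is evaluated at [(s, t) = (C, B)], or at
    [(A + 1, B)] when [C = 0]. *)
Lemma cauchy_schwarz f g : sqinteg f -> sqinteg g ->
  (\int[mu]_x (f x * g x)) ^+ 2 <= \int[mu]_x (f x ^+ 2) * \int[mu]_x (g x ^+ 2).
Proof.
move=> Lf Lg; have [_ f2] := Lf; have [_ g2] := Lg.
have fg := sqinteg_mul Lf Lg.
set A := \int[mu]_x (f x ^+ 2); set B := \int[mu]_x (f x * g x).
set C := \int[mu]_x (g x ^+ 2).
have H (t s : R) : 0 <= s ^+ 2 * A - 2 * s * t * B + t ^+ 2 * C.
  rewrite -(@RintegralZl _ _ _ mu _ _ (s ^+ 2) measurableT f2).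
  rewrite -(@RintegralZl _ _ _ mu _ _ (2 * s * t) measurableT fg).
  rewrite -(@RintegralZl _ _ _ mu _ _ (t ^+ 2) measurableT g2).
  have J1 := integZ (s ^+ 2) f2; have J2 := integZ (2 * s * t) fg; have J3 := integZ (t ^+ 2) g2.
  rewrite -(@RintegralB _ _ _ mu _ _ _ measurableT J1 J2).
  rewrite -(@RintegralD _ _ _ mu _ _ _ measurableT (integB J1 J2) J3).
  apply: Rintegral_ge0 => x _.
  by rewrite (_ : _ + _ = (s * f x - t * g x) ^+ 2) ?sqr_ge0//; ring.
have C0 : 0 <= C by apply: Rintegral_ge0 => x _; exact: sqr_ge0.
have [C0'|C1] := eqVneq C 0.
  have A0 : 0 <= A by apply: Rintegral_ge0 => x _; exact: sqr_ge0.
  have := H (A + 1) B; rewrite C0' (_ : _ + _ = - (B ^+ 2 * (A + 2))); last by ring.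
  by rewrite oppr_ge0 pmulr_lle0 ?mulr0// ltr_wpDl.
have Cp : 0 < C by rewrite lt_neqAle eq_sym C1.
have := H B C; clear H; rewrite (_ : _ + _ = C * (A * C - B ^+ 2)); last by ring.
by rewrite pmulr_rge0// subr_ge0.
Qed.

Lemma Rintegral_dominated_cvg (f_ : nat -> T -> R) f g :
  (forall k, measurable_fun setT (f_ k)) -> measurable_fun setT f ->
  (forall x, f_ ^~ x @ \oo --> f x) -> integ g ->
  (forall k x, `|f_ k x| <= g x) ->
  integ f /\ (fun k => \int[mu]_x f_ k x) @ \oo --> \int[mu]_x f x.
Proof.
move=> mf_ mf ff ig fg.
have mE h : measurable_fun setT h -> measurable_fun setT (EFin \o h : T -> \bar R).
  by move/measurable_EFinP.
have [|||||If _ C] := @dominated_convergence _ _ _ mu setT measurableT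
  (fun k => EFin \o f_ k) (EFin \o f) (EFin \o g).
- by move=> k; exact: mE.
- exact: mE.
- by apply: aeW => x _; apply/fine_cvgP; split; [exact: nearW|exact: ff].
- exact: ig.
- by apply: aeW => x k _; rewrite lee_fin.
split=> //; apply: fine_cvg; rewrite EFin_Rintegral//; exact: C.
Qed.

End real_integrals.

Section real_fubini.
Context d1 d2 (T1 : measurableType d1) (T2 : measurableType d2) (R : realType).
Variables (m1 : {sigma_finite_measure set T1 -> \bar R})
          (m2 : {sigma_finite_measure set T2 -> \bar R}).

Lemma integ_prod (F : T1 * T2 -> R) : measurable_fun setT F ->
  (\int[m1]_x \int[m2]_y `|F (x, y)|%:E < +oo)%E ->
  integ (m1 \x m2)%E F.
Proof.
by move=> mF Foo; apply/(integrable12ltyP m1 m2) => //; exact/measurable_EFinP.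
Qed.

Lemma integ_prod_swapped (F : T1 * T2 -> R) : measurable_fun setT F ->
  (\int[m2]_y \int[m1]_x `|F (x, y)|%:E < +oo)%E ->
  integ (m1 \x m2)%E F.
Proof.
by move=> mF Foo; apply/(integrable21ltyP m1 m2) => //; exact/measurable_EFinP.
Qed.

(** Fubini for a real integrand all of whose sections are integrable:
    then the inner integrals are finite everywhere, not just almost everywhere,
    and the real iterated integrals are the extended ones. *)
Lemma Rintegral_swap (F : T1 -> T2 -> R) :
  integ (m1 \x m2)%E (fun z => F z.1 z.2) ->
  (forall x, integ m2 (F x)) -> (forall y, integ m1 (F ^~ y)) ->
  integ m1 (fun x => \int[m2]_y F x y) /\
  \int[m1]_x \int[m2]_y F x y = \int[m2]_y \int[m1]_x F x y.
Proof.
move=> IF I2 I1.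
have E1 x : (\int[m2]_y F x y)%:E = (\int[m2]_y (F x y)%:E)%E by exact: EFin_Rintegral.
have E2 y : (\int[m1]_x F x y)%:E = (\int[m1]_x (F x y)%:E)%E by exact: (EFin_Rintegral (I1 y)).
split.
- rewrite /integ (_ : _ \o _ = fubini_F m2 (EFin \o (fun z => F z.1 z.2))).
    exact: integrable_fubini_F IF.
  by apply/funext => x /=; rewrite E1.
- rewrite /Rintegral; congr fine.
  under eq_integral do rewrite E1.
  under [RHS]eq_integral do rewrite E2.
  exact: (Fubini IF).
Qed.

End real_fubini.

Section bounded_kernel.
Context d1 d2 (T1 : measurableType d1) (T2 : measurableType d2) (R : realType).
Variables (m1 : {sigma_finite_measure set T1 -> \bar R})
          (m2 : {sigma_finite_measure set T2 -> \bar R}).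

Lemma measurable_fst_comp (w : T1 -> R) : measurable_fun setT w ->
  measurable_fun setT (fun z : T1 * T2 => w z.1).
Proof. by move=> mw; apply: measurableT_comp mw _; exact: measurable_fst. Qed.

Lemma measurable_snd_comp (w : T2 -> R) : measurable_fun setT w ->
  measurable_fun setT (fun z : T1 * T2 => w z.2).
Proof. by move=> mw; apply: measurableT_comp mw _; exact: measurable_snd. Qed.

(** The integrand is dominated by [M |w x| |f y|].  All the exchanges of
    integrals against bounded oscillating factors below are of this form. *)
Lemma integ_kernel (w : T1 -> R) (f : T2 -> R) (h : T1 -> T2 -> R) (M : R) :
  0 <= M -> integ m1 w -> integ m2 f ->
  measurable_fun setT (fun z : T1 * T2 => h z.1 z.2) ->
  (forall x y, `|h x y| <= M) ->
  [/\ integ (m1 \x m2)%E (fun z => w z.1 * h z.1 z.2 * f z.2),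
      forall x, integ m2 (fun y => w x * h x y * f y) &
      forall y, integ m1 (fun x => w x * h x y * f y)].
Proof.
move=> M0 Iw If mh hM.
have mw := integ_measurable Iw; have mf := integ_measurable If.
have bnd x y : `|w x * h x y * f y| <= M * `|w x| * `|f y|.
  by rewrite !normrM ler_wpM2r// mulrC ler_wpM2r.
have Inw : integ m1 (fun x => `|w x|) by exact: integ_norm.
have Inf : integ m2 (fun x => `|f x|) by exact: integ_norm.
have mF : measurable_fun setT (fun z : T1 * T2 => w z.1 * h z.1 z.2 * f z.2).
  apply: measurable_funM; last exact: measurable_snd_comp.
  by apply: measurable_funM => //; exact: measurable_fst_comp.
split.
- apply: (@le_integ _ _ _ _ _ (fun z => M * `|w z.1| * `|f z.2|)) => //.
  apply: integ_prod.
    apply: measurable_funM; last exact: measurable_snd_comp (integ_measurable Inf).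
    apply: measurable_funM => //.
    exact: measurable_fst_comp (integ_measurable Inw).
  under eq_integral => x _.
    under eq_integral do rewrite /= ger0_norm ?mulr_ge0//.
    rewrite -EFin_Rintegral; last by under eq_fun do rewrite -mulrA; apply: integZ; exact: integZ.
    rewrite RintegralZl//.
    over.
  rewrite /= -EFin_Rintegral ?ltry//.
  by under eq_fun do rewrite mulrC mulrCA; apply: integZ; apply: integZ.
- move=> x; apply: (@le_integ _ _ _ _ _ (fun y => M * `|w x| * `|f y|)) => //.
    exact: (measurableT_comp mF (pair1_measurable x)).
  exact: integZ.
- move=> y; apply: (@le_integ _ _ _ _ _ (fun x => M * `|w x| * `|f y|)) => //.
    exact: (measurableT_comp mF (pair2_measurable y)).
  by under eq_fun do rewrite mulrAC; apply: integZ.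
Qed.

Lemma Rintegral_swap_kernel (w : T1 -> R) (f : T2 -> R) (h : T1 -> T2 -> R) (M : R) :
  0 <= M -> integ m1 w -> integ m2 f ->
  measurable_fun setT (fun z : T1 * T2 => h z.1 z.2) ->
  (forall x y, `|h x y| <= M) ->
  integ m1 (fun x => \int[m2]_y (w x * h x y * f y)) /\
  \int[m1]_x \int[m2]_y (w x * h x y * f y) = \int[m2]_y \int[m1]_x (w x * h x y * f y).
Proof.
move=> M0 Iw If mh hM; have [IF I2 I1] := integ_kernel M0 Iw If mh hM.
exact: (@Rintegral_swap _ _ _ _ _ m1 m2 (fun x y => w x * h x y * f y)).
Qed.

End bounded_kernel.

(** * Affine changes of variables *)

Section affine_line.
Context {R : realType}.
Local Notation leb := (@lebesgue_measure R).
Implicit Types r b : R.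

Lemma measurable_affine r b :
  measurable_fun setT ((fun x => r * x + b) : measurableTypeR R -> measurableTypeR R).
Proof.
apply: measurable_funD => //; exact: mulrl_measurable.
Qed.

(** Both sides are measures in [A] that agree on half-open intervals. *)
Lemma lebesgue_measure_affine r b (A : set R) : 0 < r -> measurable A ->
  (leb A = r%:E * leb ((fun x => r * x + b)%R @^-1` A))%E.
Proof.
move=> r0 mA.
unshelve epose (m0 :=
  pushforward leb ((fun x => r * x + b)%R : measurableTypeR R -> measurableTypeR R)
  : {measure set (measurableTypeR R) -> \bar R}).
  exact: measurable_affine.
rewrite (@lebesgue_measure_unique R (mscale (NngNum (ltW r0)) m0)) //.
move=> _ [[a c] _ <-] /=.
rewrite /mscale /= /m0 /pushforward/=.
rewrite [X in (_ * leb X)%E](_ : _ = `](a - b) / r, (c - b) / r]%classic); last first.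
  apply/seteqP; split=> x /=; rewrite !in_itv /= ltr_pdivrMr// ler_pdivlMr//;
    by rewrite ltrBlDr lerBrDr mulrC.
rewrite !lebesgue_measure_itv/= !lte_fin ltr_pM2r ?invr_gt0// ltrD2r.
case: ifPn => _; last by rewrite mule0.
rewrite -!EFinD -EFinM; congr EFin; field; exact: lt0r_neq0.
Qed.

Lemma ge0_integral_affine r b (f : R -> \bar R) : 0 < r ->
  measurable_fun setT f -> (forall x, (0 <= f x)%E) ->
  (\int[leb]_x f x = r%:E * \int[leb]_x f (r * x + b)%R)%E.
Proof.
move=> r0 mf f0.
unshelve epose (m0 :=
  pushforward leb ((fun x => r * x + b)%R : measurableTypeR R -> measurableTypeR R)
  : {measure set (measurableTypeR R) -> \bar R}).
  exact: measurable_affine.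
rewrite (@eq_measure_integral _ _ _ _ (mscale (NngNum (ltW r0)) m0)); last first.
  by move=> A mA _; exact: lebesgue_measure_affine.
rewrite ge0_integral_mscale //=; congr (_ * _)%E.
by rewrite /m0 ge0_integral_pushforward//; exact: measurable_affine.
Qed.

End affine_line.

Section rV_integration.
Context {R : realType}.
Local Notation leb := (@lebesgue_measure R).
Local Notation mu n := (@lebesgue_rV R n).

(** The measure in dimension [n.+1] is the image of a product measure, so
    Tonelli integrates out the first coordinate.  Facts in dimension [n] are
    proved from this by induction. *)
Lemma ge0_integral_cons n (f : 'rV[R]_n.+1 -> \bar R) :
  measurable_fun setT f -> (forall x, (0 <= f x)%E) ->
  (\int[mu n.+1]_x f x = \int[leb]_a \int[mu n]_v f (cons_rV (a, v)))%E.
Proof.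
move=> mf f0.
unshelve epose (m0 := pushforward (leb \x mu n)%E
   ((@cons_rV R n) : (measurableTypeR R * 'rV[R]_n)%type -> 'rV[R]_n.+1)
   : {measure set 'rV[R]_n.+1 -> \bar R}).
  exact: measurable_cons_rV.
rewrite (@eq_measure_integral _ _ _ _ m0); last by [].
rewrite /m0 ge0_integral_pushforward//=; last exact: measurable_cons_rV.
rewrite preimage_setT fubini_tonelli1//.
apply: measurableT_comp => //; exact: measurable_cons_rV.
Qed.

Lemma rV0_eq0 (x : 'rV[R]_0) : x = 0.
Proof. by apply/matrixP => i []. Qed.

Lemma integral_rV0 (f : 'rV[R]_0 -> \bar R) :
  (\int[mu 0]_x f x)%E = f (0 : 'rV[R]_0).
Proof.
have -> : f = cst (f (0 : 'rV[R]_0)) by apply/funext => x; rewrite (rV0_eq0 x).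
rewrite -[LHS]/(\int[\d_(0%R : 'rV[R]_0)]_x f (0%R : 'rV[R]_0))%E integral_cst//.
by rewrite [X in (_ * X)%E](_ : _ = 1%E) ?mule1//; exact: diracT.
Qed.

Lemma measurable_rVP d (T : measurableType d) n (g : T -> 'rV[R]_n) :
  (forall i, measurable_fun setT (fun t => g t 0 i)) -> measurable_fun setT g.
Proof.
elim: n g => [|n IH] g mg.
  by rewrite (_ : g = cst 0)//; apply/funext => t; exact: rV0_eq0.
rewrite (_ : g = (@cons_rV R n) \o
    (fun t => (g t 0 ord0, \row_i g t 0 (lift ord0 i)))); last first.
  apply/funext => t /=; apply/matrixP => i j; rewrite (ord1 i).
  have [k ->|->] := unliftP ord0 j; last by rewrite cons_rV0.
  by rewrite cons_rVS /= !mxE.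
apply: measurableT_comp; first exact: measurable_cons_rV.
apply: measurable_fun_pair; first exact: mg.
by apply: IH => i; under eq_fun do rewrite mxE; exact: mg.
Qed.

Lemma measurable_affine_rV n e (b : 'rV[R]_n) : measurable_fun setT (fun y : 'rV[R]_n => e *: y + b).
Proof.
apply: measurable_rVP => i; under eq_fun do rewrite !mxE.
by apply: measurable_funD => //; apply: measurable_funM => //; exact: measurable_coord_rV.
Qed.

Lemma ge0_integral_affine_rV n r (b : 'rV[R]_n) (f : 'rV[R]_n -> \bar R) : 0 < r ->
  measurable_fun setT f -> (forall x, (0 <= f x)%E) ->
  (\int[mu n]_x f x = (r ^+ n)%:E * \int[mu n]_x f (r *: x + b)%R)%E.
Proof.
move=> r0; elim: n b f => [|n IH] b f mf f0.
  by rewrite !integral_rV0 expr0 mul1e [(_ *: _ + _)%R]rV0_eq0.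
have mc (g : 'rV[R]_n.+1 -> \bar R) : measurable_fun setT g ->
    measurable_fun setT (fun z : measurableTypeR R * 'rV[R]_n => g (cons_rV z)).
  by move=> mg; apply: measurableT_comp mg _; exact: measurable_cons_rV.
rewrite ge0_integral_cons// (ge0_integral_cons (measurableT_comp mf (measurable_affine_rV r b)))//=.
pose b' : 'rV[R]_n := \row_i b 0 (lift ord0 i).
rewrite (@ge0_integral_affine _ r (b 0 ord0))//; last 2 first.
- exact: (measurable_fun_fubini_tonelli_F (fun z => f (cons_rV z))) (mc _ mf) _.
- by move=> a; exact: integral_ge0.
rewrite exprS EFinM -muleA; congr (_ * _)%E.
rewrite -ge0_integralZl//=; last 3 first.
- exact: (measurable_fun_fubini_tonelli_F (fun z => f (r *: cons_rV z + b)))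
    (mc _ (measurableT_comp mf (measurable_affine_rV r b))) (fun=> f0 _).
- by move=> a _; exact: integral_ge0.
- by rewrite lee_fin exprn_ge0// ltW.
apply: eq_integral => a _.
rewrite (IH b'); last 2 first.
- apply: (measurableT_comp (mc _ mf)).
  exact: pair1_measurable.
- by [].
congr (_ * _)%E; apply: eq_integral => v _; congr f.
apply/matrixP => i j; rewrite (ord1 i) [RHS]mxE [X in _ = X + _]mxE.
have [k ->|->] := unliftP ord0 j; last by rewrite !cons_rV0.
by rewrite !cons_rVS /= !mxE.
Qed.

End rV_integration.

(** * The one-dimensional Poisson kernel *)

Section poisson_line.
Context {R : realType}.
Local Notation leb := (@lebesgue_measure R).

(** Reflection preserves Lebesgue measure, so the integral equals its opposite. *)
Lemma Rintegral_odd (f : R -> R) : integ leb f -> (forall x, f (- x) = - f x) ->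
  \int[leb]_x f x = 0.
Proof.
move=> If odd.
have IN : integ leb (f \o -%R).
  rewrite (_ : f \o _ = (fun x => -1 * f x)); last by apply/funext => x /=; rewrite odd mulN1r.
  exact: integZ.
have E : \int[leb]_x f x = - \int[leb]_x f x.
  rewrite {1}/Rintegral.
  rewrite (@eq_measure_integral _ _ _ _ (pushforward leb (-%R : measurableTypeR R -> measurableTypeR R))); last first.
    by move=> A mA _; exact/esym/lebesgue_measureN.
  rewrite integral_pushforward//=; last first.
    by apply/measurable_EFinP; exact: (integ_measurable If).
  rewrite preimage_setT -/(Rintegral leb setT (f \o -%R)).
  rewrite -mulN1r -RintegralZl//; apply: eq_Rintegral => x _.
  by rewrite /= odd mulN1r.
by move/eqP: E; rewrite -subr_eq0 opprK -mulr2n mulrn_eq0/= => /eqP.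
Qed.

(** A primitive on the half-line of [exp (- e x) (1 + cos (t x))]; the
    summand 1 makes the integrand nonnegative, so that the fundamental theorem for
    nonnegative functions on an unbounded interval applies. *)
Definition poisson_primitive (e t x : R) := expR (- e * x) * (t * sin (t * x) - e * cos (t * x)) / (e ^+ 2 + t ^+ 2)
   - expR (- e * x) / e.

Lemma is_derive_poisson_primitive (e t x : R) : 0 < e ->
  is_derive x (1 : R) (poisson_primitive e t) (expR (- e * x) * (1 + cos (t * x))).
Proof.
move=> e0.
have D1 : is_derive x 1 (fun x => expR (- e * x)) (- e * expR (- e * x)).
  have : is_derive x 1 (fun x => - e * x) (- e) by apply: is_derive_eq; rewrite /GRing.scale/= mulr1.
  by move=> ?; apply: is_derive_eq; rewrite /GRing.scale/= mulrC.
have D0 : is_derive x 1 (fun x => t * x) t by apply: is_derive_eq; rewrite /GRing.scale/= mulr1.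
have D2 : is_derive x 1 (fun x => sin (t * x)) (t * cos (t * x)).
  by apply: is_derive_eq; rewrite /GRing.scale/= mulrC.
have D3 : is_derive x 1 (fun x => cos (t * x)) (- (t * sin (t * x))).
  by apply: is_derive_eq; rewrite /GRing.scale/= mulNr mulrC.
apply: is_derive_eq. rewrite /GRing.scale/=; field.
by rewrite lt0r_neq0// lt0r_neq0// ltr_pwDl ?sqr_ge0 ?exprn_gt0.
Qed.

Lemma cvg_poisson_primitive (e t : R) : 0 < e -> poisson_primitive e t x @[x --> +oo] --> 0.
Proof.
move=> e0.
have E0 : expR (- e * x) @[x --> +oo] --> 0.
  have : expR (- (e * x)) @[x --> +oo] --> 0.
    apply: (@cvg_comp _ _ _ ( *%R e) (fun x => expR (- x)) _ (pinfty_nbhs R)).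
      by apply: gt0_cvgMry => //; exact: cvg_id.
    exact: cvgr_expR.
  by under eq_fun do rewrite -mulNr.
have D0 : 0 < e ^+ 2 + t ^+ 2 by rewrite ltr_pwDl ?sqr_ge0 ?exprn_gt0.
pose C := (`|t| + e) / (e ^+ 2 + t ^+ 2) + e^-1.
have C0 : C * expR (- e * x) @[x --> +oo] --> 0 by rewrite -(mulr0 C); exact: cvgMr.
apply/cvgr0Pnorm_le => del d0.
apply: filterS ((cvgr0Pnorm_le _).1 C0 _ d0) => x hx.
suff h : `|poisson_primitive e t x| <= `|C * expR (- e * x)| by exact: le_trans h hx.
have C1 : 0 <= C * expR (- e * x).
  rewrite mulr_ge0 ?expR_ge0 // /C addr_ge0 ?invr_ge0 ?(ltW e0)//.
  by rewrite divr_ge0 ?(ltW D0) ?addr_ge0 ?(ltW e0).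
rewrite [leRHS]ger0_norm//.
rewrite /poisson_primitive.
rewrite (le_trans (ler_normB _ _))// /C mulrDl lerD//.
  rewrite -mulrA normrM ger0_norm ?expR_ge0// mulrC ler_wpM2r ?expR_ge0//.
  rewrite normrM [X in _ * X <= _]gtr0_norm ?invr_gt0// ler_wpM2r ?invr_ge0 ?(ltW D0)//.
  rewrite (le_trans (ler_normB _ _))// lerD// normrM.
    by rewrite ler_piMr// ler_norml sin_geN1 sin_le1.
  by rewrite gtr0_norm// ler_piMr ?(ltW e0)// ler_norml cos_geN1 cos_le1.
by rewrite mulrC normrM gtr0_norm ?invr_gt0// ger0_norm ?expR_ge0.
Qed.

Lemma measurable_poisson (e t : R) :
  measurable_fun setT (fun x : R => expR (- e * `|x|) * cos (t * x)).
Proof.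
apply: measurable_funM.
  apply: measurableT_comp; first exact: measurable_expR.
  apply: measurable_funM => //.
apply: (measurableT_comp (continuous_measurable_fun (@continuous_cos R))).
exact: mulrl_measurable.
Qed.

(** The integrand is even, so the integral is twice minus the value at 0
    of the primitive, which vanishes at infinity. *)
Lemma integral_poisson1 (e t : R) : 0 < e ->
  (\int[leb]_x (expR (- e * `|x|) * (1 + cos (t * x)))%:E =
   (2 / e + 2 * e / (e ^+ 2 + t ^+ 2))%:E)%E.
Proof.
move=> e0.
have ge0 (x : R) : 0 <= 1 + cos (t * x) by rewrite addrC -lerBlDr sub0r cos_geN1.
have ccos : continuous (fun x : R => 1 + cos (t * x)).
  move=> x; apply: cvgD; first exact: cvg_cst.
  apply: (@cvg_comp _ _ _ ( *%R t) cos); last exact: continuous_cos.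
  exact: mulrl_continuous.
rewrite ge0_symfun_integralT; last 3 first.
- by move=> x; rewrite mulr_ge0 ?expR_ge0.
- move=> x; apply: cvgM; last exact: ccos.
  apply: (@cvg_comp _ _ _ (fun x => - e * `|x|) expR); last exact: continuous_expR.
  apply: (@cvg_comp _ _ _ Num.norm ( *%R (- e))); last exact: mulrl_continuous.
  exact: norm_continuous.
- by move=> x /=; rewrite normrN mulrN cosN.
rewrite -set_itvcy.
have -> : (\int[leb]_(x in `[0%R, +oo[) (expR (- e * `|x|) * (1 + cos (t * x)))%:E
    = \int[leb]_(x in `[0%R, +oo[) (expR (- e * x) * (1 + cos (t * x)))%:E)%E.
  by apply: eq_integral => x; rewrite inE/= in_itv/= andbT => x0; rewrite ger0_norm.
rewrite (ge0_continuous_FTC2y _ _ (@cvg_poisson_primitive e t e0))/=.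
- rewrite -EFinB -EFinM; congr EFin; rewrite /poisson_primitive !mulr0 sin0 cos0 expR0 mulr0 sub0r.
  field.
  by rewrite (lt0r_neq0 e0) andbT lt0r_neq0// ltr_pwDl ?sqr_ge0 ?exprn_gt0.
- by move=> x _; rewrite mulr_ge0 ?expR_ge0.
- apply: continuous_subspaceT => x; apply: cvgM; last exact: ccos.
  apply: (@cvg_comp _ _ _ (fun x => - e * x) expR); last exact: continuous_expR.
  exact: mulrl_continuous.
- by move=> x x0; have [] := is_derive_poisson_primitive t x e0.
- apply: cvg_at_right_filter; apply/differentiable_continuous/derivable1_diffP.
  by have [] := is_derive_poisson_primitive t 0 e0.
- by move=> x _; rewrite derive1E; have [_ ->] := is_derive_poisson_primitive t x e0.
Qed.

Lemma integral_exp_norm (e : R) : 0 < e ->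
  (\int[leb]_x (expR (- e * `|x|))%:E = (2 / e)%:E)%E.
Proof.
move=> e0; have := @integral_poisson1 e 0 e0.
under eq_integral do rewrite mul0r cos0 EFinM.
have mE : measurable_fun setT (fun x : measurableTypeR R => (expR (- e * `|x|))%:E).
  have := @measurable_poisson e 0.
  by under eq_fun do rewrite mul0r cos0 mulr1; move/measurable_EFinP.
rewrite ge0_integralZr//=.
move=> /(congr1 (fun x => x * (2^-1)%:E)%E).
rewrite -muleA -!EFinM; have -> : (1 + 1) * 2^-1 = 1 :> R by field.
rewrite mule1 => ->; congr EFin; field; exact: lt0r_neq0.
Qed.

Lemma integ_exp_norm (e : R) : 0 < e -> integ leb (fun x => expR (- e * `|x|)).
Proof.
move=> e0; apply: ge0_integ; last by rewrite integral_exp_norm// ltry.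
  by have := @measurable_poisson e 0; under eq_fun do rewrite mul0r cos0 mulr1.
by move=> x; exact: expR_ge0.
Qed.

(** Subtract from [integral_poisson1] its value at [t = 0], halved. *)
Lemma Rintegral_poisson_cos (e t : R) : 0 < e ->
  \int[leb]_x (expR (- e * `|x|) * cos (t * x)) = 2 * e / (e ^+ 2 + t ^+ 2).
Proof.
move=> e0.
have I1 := integ_exp_norm e0.
have I2 : integ leb (fun x => expR (- e * `|x|) * cos (t * x)).
  apply: le_integ I1; first exact: measurable_poisson.
  by move=> x; rewrite normrM ger0_norm ?expR_ge0// ler_piMr ?expR_ge0// ler_norml cos_geN1 cos_le1.
have := integral_poisson1 t e0.
under eq_integral do rewrite mulrDr mulr1.
rewrite -EFin_Rintegral; last exact: integD.
rewrite RintegralD// => -[].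
by rewrite {1}/Rintegral integral_exp_norm//= => /addrI.
Qed.

Lemma Rintegral_poisson_sin (e t : R) : 0 < e ->
  \int[leb]_x (expR (- e * `|x|) * sin (t * x)) = 0.
Proof.
move=> e0; apply: Rintegral_odd.
  apply: le_integ (integ_exp_norm e0); last first.
    by move=> x; rewrite normrM ger0_norm ?expR_ge0// ler_piMr ?expR_ge0// ler_norml sin_geN1 sin_le1.
  apply: measurable_funM; first exact: (integ_measurable (integ_exp_norm e0)).
  apply: (measurableT_comp (continuous_measurable_fun (@continuous_sin R))).
  exact: mulrl_measurable.
by move=> x; rewrite normrN mulrN sinN mulrN.
Qed.

Lemma integral_cauchy : (\int[leb]_x (2 / (1 + x ^+ 2))%:E = (2 * pi)%:E)%E.
Proof.
have c0 (x : R) : 0 <= 2 / (1 + x ^+ 2) by rewrite divr_ge0 ?addr_ge0 ?sqr_ge0.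
rewrite ge0_symfun_integralT; last 3 first.
- exact: c0.
- by move=> x; apply: cvgM; [exact: cvg_cst|exact: continuous_oneDsqrV].
- by move=> x /=; rewrite sqrrN.
- rewrite -set_itvcy.
  under eq_integral do rewrite EFinM.
  rewrite ge0_integralZl//=; first last.
  + by move=> x _; rewrite lee_fin invr_ge0 addr_ge0 ?sqr_ge0.
  + apply/measurable_EFinP; apply: measurable_funTS; apply: continuous_measurable_fun.
    exact: continuous_oneDsqrV.
  rewrite integral0y_oneDsqr -!EFinM; congr EFin; by field.
Qed.

End poisson_line.

(** * Integrals of real functions of several variables *)

Section rV_real_integrals.
Context {R : realType}.
Local Notation leb := (@lebesgue_measure R).
Local Notation mu n := (@lebesgue_rV R n).

(** The nonnegative case is applied to the positive and negative parts. *)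
Lemma integral_affine_rV n r (b : 'rV[R]_n) (f : 'rV[R]_n -> R) : 0 < r ->
  integ (mu n) f ->
  integ (mu n) (fun x => f (r *: x + b)) /\
  \int[mu n]_x f x = r ^+ n * \int[mu n]_x f (r *: x + b).
Proof.
move=> r0 If.
have mf := integ_measurable If.
have mE h : measurable_fun setT h -> measurable_fun setT (EFin \o h : 'rV[R]_n -> \bar R).
  by move/measurable_EFinP.
have rn0 : 0 < r ^+ n by rewrite exprn_gt0.
have Ia : integ (mu n) (fun x => f (r *: x + b)).
  apply/integrableP; split; first exact: mE (measurableT_comp mf (measurable_affine_rV r b)).
  have := integ_lty (integ_norm If).
  rewrite (@ge0_integral_affine_rV _ _ _ b _ r0)//; last first.
    by apply: measurable_EFin; apply: measurableT_comp.
  have : (0 <= \int[mu n]_x (`|f (r *: x + b)|)%:E)%E by apply: integral_ge0 => x _; rewrite lee_fin.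
  by case: (integral _ _ _) => [x _ _| _|]//; rewrite ?ltry// gt0_muley// lte_fin.
split=> //; apply: EFin_inj.
rewrite EFinM !EFin_Rintegral// integralE.
rewrite (@ge0_integral_affine_rV _ _ _ b (funepos (EFin \o f)) r0)//; last first.
  by apply: measurable_funepos; exact: mE.
rewrite (@ge0_integral_affine_rV _ _ _ b (funeneg (EFin \o f)) r0)//; last first.
  by apply: measurable_funeneg; exact: mE.
have H (A B : \bar R) : B \is a fin_num ->
    ((r ^+ n)%:E * A - (r ^+ n)%:E * B = (r ^+ n)%:E * (A - B))%E.
  by move=> fB; rewrite muleBr// fin_num_adde_defl// fin_numN.
have En : (\int[mu n]_x (EFin \o f)^\- (r *: x + b)%R =
    \int[mu n]_x (EFin \o (fun x => f (r *: x + b)%R))^\- x)%E.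
  by apply: eq_integral => x _; rewrite !funenegE.
rewrite En H; last exact: (integrable_neg_fin_num measurableT Ia).
congr (_ * _)%E; rewrite [RHS]integralE; congr (_ - _)%E.
by apply: eq_integral => x _; rewrite !funeposE.
Qed.

Lemma integ_translate n (f : 'rV[R]_n -> R) (v : 'rV[R]_n) : integ (mu n) f ->
  integ (mu n) (fun x => f (x + v)) /\ \int[mu n]_x f (x + v) = \int[mu n]_x f x.
Proof.
move=> If; have := integral_affine_rV v (@ltr01 R) If.
rewrite expr1n mul1r => -[J ->].
have E x : 1 *: x + v = x + v by rewrite scale1r.
by split; [under eq_fun do rewrite -E|apply: eq_Rintegral => x _; rewrite E].
Qed.

Lemma Rintegral_cons n (f : 'rV[R]_n.+1 -> R) : integ (mu n.+1) f ->
  (forall a, integ (mu n) (fun v => f (cons_rV (a, v)))) ->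
  integ leb (fun a => \int[mu n]_v f (cons_rV (a, v))) /\
  \int[mu n.+1]_x f x = \int[leb]_a \int[mu n]_v f (cons_rV (a, v)).
Proof.
move=> If Is.
have mf := integ_measurable If.
have mc : measurable_fun setT (fun z : measurableTypeR R * 'rV[R]_n => f (cons_rV z)).
  by apply: measurableT_comp mf _; exact: measurable_cons_rV.
have IF : integ (leb \x mu n)%E (fun z => f (cons_rV z)).
  apply: integ_prod => //.
  have := integ_lty (integ_norm If).
  by rewrite ge0_integral_cons//; apply: measurable_EFin; exact: measurableT_comp.
have E a : (\int[mu n]_v f (cons_rV (a, v)))%:E = (\int[mu n]_v (f (cons_rV (a, v)))%:E)%E.
  exact: (EFin_Rintegral (Is a)).
split.
  rewrite /integ (_ : _ \o _ = fubini_F (mu n) (EFin \o (fun z => f (cons_rV z)))).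
    exact: integrable_fubini_F IF.
  by apply/funext => a /=; rewrite E.
rewrite /Rintegral; congr fine.
under [RHS]eq_integral do rewrite E.
rewrite (integral12_prod_meas1 IF).
unshelve epose (m0 := pushforward (leb \x mu n)%E
   ((@cons_rV R n) : (measurableTypeR R * 'rV[R]_n)%type -> 'rV[R]_n.+1)
   : {measure set 'rV[R]_n.+1 -> \bar R}).
  exact: measurable_cons_rV.
rewrite (@eq_measure_integral _ _ _ _ m0); last by [].
rewrite /m0 integral_pushforward//=.
- exact: measurable_cons_rV.
- exact/measurable_EFinP.
Qed.

Lemma ge0_integral_prod n (g : 'I_n -> R -> R) :
  (forall i, measurable_fun setT (g i : measurableTypeR R -> R)) ->
  (forall i x, 0 <= g i x) ->
  (\int[mu n]_v (\prod_(i < n) g i (v 0 i))%:E =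
   \prod_(i < n) \int[leb]_a (g i a)%:E)%E.
Proof.
elim: n g => [|n IH] g mg g0.
  by rewrite integral_rV0 !big_ord0.
have mp m (h : 'I_m -> R -> R) : (forall i, measurable_fun setT (h i : measurableTypeR R -> R)) ->
    measurable_fun setT (fun v : 'rV[R]_m => \prod_(i < m) h i (v 0 i)).
  move=> mh; apply: measurable_prod => i _.
  apply: (measurableT_comp (mh i)); exact: measurable_coord_rV.
rewrite ge0_integral_cons; last 2 first.
- by apply: measurable_EFin; exact: mp.
- by move=> x; rewrite lee_fin prodr_ge0.
rewrite big_ord_recl -IH; last 2 first.
- by move=> i; exact: mg.
- by move=> i x; exact: g0.
rewrite -ge0_integralZr//=; last 3 first.
- by apply: measurable_EFin; exact: mg.
- by move=> x _; rewrite lee_fin.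
- by apply: integral_ge0 => v _; rewrite lee_fin prodr_ge0.
apply: eq_integral => a _.
rewrite -ge0_integralZl//=; last 3 first.
- by apply: measurable_EFin; apply: (mp _ (fun i => g (lift ord0 i))) => i; exact: mg.
- by move=> v _; rewrite lee_fin prodr_ge0.
- by rewrite lee_fin.
apply: eq_integral => v _.
rewrite big_ord_recl cons_rV0 EFinM; congr (_ * _%:E)%E.
by apply: eq_bigr => i _; rewrite cons_rVS.
Qed.

End rV_real_integrals.

(** * The Poisson kernel in several variables *)

Lemma prod_EFin {R : realType} (I : Type) (s : seq I) (f : I -> R) :
  (\prod_(i <- s) (f i)%:E)%E = (\prod_(i <- s) f i)%:E.
Proof. by elim: s => [|i s IH]; rewrite ?big_nil// !big_cons IH. Qed.

Section poisson_rV.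
Context {R : realType}.
Local Notation leb := (@lebesgue_measure R).
Local Notation mu n := (@lebesgue_rV R n).

Definition dot n (x y : 'rV[R]_n) := \sum_(i < n) x 0 i * y 0 i.
(** A product over the coordinates, unlike the exponential of the Euclidean
    norm: everything about it reduces to dimension 1, where its transform and the
    total mass of that transform are elementary. *)
Definition weight n (e : R) (xi : 'rV[R]_n) := \prod_(i < n) expR (- e * `|xi 0 i|).
(** The Fourier transform of [weight e]. *)
Definition poisson n (e : R) (z : 'rV[R]_n) := \prod_(i < n) (2 * e / (e ^+ 2 + z 0 i ^+ 2)).

Lemma dotC n (x y : 'rV[R]_n) : dot x y = dot y x.
Proof. by apply: eq_bigr => i _; rewrite mulrC. Qed.

Lemma dotDl n (x y z : 'rV[R]_n) : dot (x + y) z = dot x z + dot y z.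
Proof. by rewrite /dot -big_split; apply: eq_bigr => i _; rewrite mxE mulrDl. Qed.

Lemma dotZl n a (x z : 'rV[R]_n) : dot (a *: x) z = a * dot x z.
Proof. by rewrite /dot mulr_sumr; apply: eq_bigr => i _; rewrite mxE mulrA. Qed.

Lemma dotDr n (x y z : 'rV[R]_n) : dot z (x + y) = dot z x + dot z y.
Proof. by rewrite ![dot z _]dotC dotDl. Qed.

Lemma dotZr n a (x z : 'rV[R]_n) : dot z (a *: x) = a * dot z x.
Proof. by rewrite ![dot z _]dotC dotZl. Qed.

Lemma weight_ge0 n e (xi : 'rV[R]_n) : 0 <= weight e xi.
Proof. by rewrite prodr_ge0// => i _; exact: expR_ge0. Qed.

Lemma weight_le1 n e (xi : 'rV[R]_n) : 0 <= e -> weight e xi <= 1.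
Proof.
move=> e0; have <- : \prod_(i < n) (1 : R) = 1 by rewrite big1.
apply: ler_prod => i _; rewrite expR_ge0/= -expR0 ler_expR mulNr oppr_le0.
by rewrite mulr_ge0.
Qed.

Lemma measurable_weight n e : measurable_fun setT (@weight n e).
Proof.
apply: measurable_prod => i _; apply: measurableT_comp; first exact: measurable_expR.
apply: measurable_funM => //; apply: measurableT_comp => //; exact: measurable_coord_rV.
Qed.

Lemma measurable_dot n (y : 'rV[R]_n) : measurable_fun setT (fun x => dot x y).
Proof.
apply: measurable_sum => i; apply: measurable_funM => //; exact: measurable_coord_rV.
Qed.

Lemma measurable_dotr n (y : 'rV[R]_n) : measurable_fun setT (fun x => dot y x).
Proof.
apply: measurable_sum => i; apply: measurable_funM => //; exact: measurable_coord_rV.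
Qed.

Lemma measurable_dot2 n : measurable_fun setT (fun z : 'rV[R]_n * 'rV[R]_n => dot z.1 z.2).
Proof.
apply: measurable_sum => i; apply: measurable_funM.
- by apply: (@measurable_fst_comp _ _ _ _ R (fun x : 'rV[R]_n => x 0 i)); exact: measurable_coord_rV.
- by apply: (@measurable_snd_comp _ _ _ _ R (fun x : 'rV[R]_n => x 0 i)); exact: measurable_coord_rV.
Qed.

Lemma measurable_cosR : measurable_fun setT (@cos R).
Proof. exact: continuous_measurable_fun (@continuous_cos R). Qed.

Lemma measurable_sinR : measurable_fun setT (@sin R).
Proof. exact: continuous_measurable_fun (@continuous_sin R). Qed.

Lemma normr_cos_le1 (x : R) : `|cos x| <= 1.
Proof. by rewrite ler_norml cos_geN1 cos_le1. Qed.

Lemma normr_sin_le1 (x : R) : `|sin x| <= 1.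
Proof. by rewrite ler_norml sin_geN1 sin_le1. Qed.

Lemma integ_weight n e : 0 < e -> integ (mu n) (weight e).
Proof.
move=> e0; apply: ge0_integ; [exact: measurable_weight|exact: weight_ge0|].
rewrite (@ge0_integral_prod _ _ (fun _ a => expR (- e * `|a|))).
- by under eq_bigr do rewrite integral_exp_norm//; rewrite prod_EFin ltry.
- by move=> _; exact: (integ_measurable (integ_exp_norm e0)).
- by move=> _ x; exact: expR_ge0.
Qed.

Lemma integ_weight_mul n e (g : 'rV[R]_n -> R) : 0 < e ->
  measurable_fun setT g -> (forall x, `|g x| <= 1) ->
  integ (mu n) (fun x => weight e x * g x).
Proof. by move=> e0 mg g1; apply: integ_mulb => //; exact: integ_weight. Qed.

Lemma weight_cons n e a (v : 'rV[R]_n) :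
  weight e (cons_rV (a, v)) = expR (- e * `|a|) * weight e v.
Proof.
rewrite /weight big_ord_recl cons_rV0; congr (_ * _).
by apply: eq_bigr => i _; rewrite cons_rVS.
Qed.

Lemma dot_cons n a (v : 'rV[R]_n) z :
  dot (cons_rV (a, v)) z = z 0 ord0 * a + dot v (\row_i z 0 (lift ord0 i)).
Proof.
rewrite /dot big_ord_recl cons_rV0 mulrC; congr (_ + _).
by apply: eq_bigr => i _; rewrite cons_rVS mxE.
Qed.

(** Induction on the dimension: the addition formula splits
    off the first coordinate, and the sine part drops by oddness. *)
Lemma Rintegral_weight_cos n e (z : 'rV[R]_n) : 0 < e ->
  \int[mu n]_xi (weight e xi * cos (dot xi z)) = poisson e z.
Proof.
move=> e0; elim: n z => [|n IH] z.
  by rewrite /Rintegral integral_rV0 /weight /poisson /dot !big_ord0 cos0 mulr1.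
have mcos m (y : 'rV[R]_m) : measurable_fun setT (fun x => cos (dot x y)).
  by apply: measurableT_comp (measurable_cosR) _; exact: measurable_dot.
have msin m (y : 'rV[R]_m) : measurable_fun setT (fun x => sin (dot x y)).
  by apply: measurableT_comp (measurable_sinR) _; exact: measurable_dot.
have Icos m (y : 'rV[R]_m) : integ (mu m) (fun x => weight e x * cos (dot x y)).
  by apply: integ_weight_mul => // x; exact: normr_cos_le1.
have Isin m (y : 'rV[R]_m) : integ (mu m) (fun x => weight e x * sin (dot x y)).
  by apply: integ_weight_mul => // x; exact: normr_sin_le1.
set z' : 'rV[R]_n := \row_i z 0 (lift ord0 i).
have E a v : weight e (cons_rV (a, v)) * cos (dot (cons_rV (a, v)) z) =
    expR (- e * `|a|) * cos (z 0 ord0 * a) * (weight e v * cos (dot v z')) -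
    expR (- e * `|a|) * sin (z 0 ord0 * a) * (weight e v * sin (dot v z')).
  by rewrite weight_cons dot_cons cosD; ring.
have [|_ ->] := Rintegral_cons (Icos _ z).
  by move=> a; under eq_fun do rewrite E; apply: integB; exact: integZ.
under eq_Rintegral => a _.
  under eq_Rintegral do rewrite E.
  rewrite RintegralB//; last 2 first.
    exact: integZ.
    exact: integZ.
  rewrite !RintegralZl//; [|exact: Isin|exact: Icos].
  over.
have me (g : R -> R) : measurable_fun setT g -> (forall x, `|g x| <= 1) ->
    integ leb (fun a => expR (- e * `|a|) * g (z 0 ord0 * a)).
  move=> mg g1; apply: integ_mulb => //; first exact: integ_exp_norm.
  by apply: measurableT_comp mg _; exact: mulrl_measurable.
have I1 := me _ measurable_cosR normr_cos_le1.
have I2 := me _ measurable_sinR normr_sin_le1.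
rewrite /= RintegralB//; last 2 first.
- by under eq_fun do rewrite mulrC; exact: integZ.
- by under eq_fun do rewrite mulrC; exact: integZ.
rewrite !RintegralZr// Rintegral_poisson_sin// mul0r subr0 Rintegral_poisson_cos// IH.
rewrite /poisson big_ord_recl; congr (_ * _).
by apply: eq_bigr => i _; rewrite mxE.
Qed.

Lemma poisson_ge0 n e (z : 'rV[R]_n) : 0 < e -> 0 <= poisson e z.
Proof.
move=> e0; rewrite prodr_ge0// => i _.
by rewrite divr_ge0 ?mulr_ge0 ?addr_ge0 ?sqr_ge0 ?ltW.
Qed.

(** Makes [poisson e] an approximate identity: it is [poisson 1] dilated
    by [e]. *)
Lemma poisson_scale n e (z : 'rV[R]_n) : 0 < e ->
  e ^+ n * poisson e (e *: z) = poisson 1 z.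
Proof.
move=> e0; rewrite -{1}(card_ord n) -prodr_const -big_split; apply: eq_bigr => i _ /=.
rewrite mxE exprMn; field.
have h : 0 < 1 + z 0 i ^+ 2 by rewrite ltr_pwDl ?sqr_ge0.
rewrite (lt0r_neq0 h)/= lt0r_neq0// ltr_pwDl ?exprn_gt0 ?sqr_ge0//.
Qed.

Lemma measurable_poisson_rV n e : 0 < e -> measurable_fun setT (@poisson n e).
Proof.
move=> e0; apply: measurable_prod => i _.
apply: (@measurableT_comp _ _ _ _ _ _ (fun t : R => 2 * e / (e ^+ 2 + t ^+ 2))).
  apply: continuous_measurable_fun => t.
  apply: cvgMr; apply: cvgV; first by rewrite lt0r_neq0// ltr_pwDl ?exprn_gt0 ?sqr_ge0.
  by apply: cvgD; [exact: cvg_cst|exact: exprn_continuous].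
exact: measurable_coord_rV.
Qed.

Lemma integral_poisson_rV n :
  (\int[mu n]_z (poisson 1 z)%:E = ((2 * pi) ^+ n)%:E)%E.
Proof.
rewrite (@ge0_integral_prod _ _ (fun _ a => 2 * 1 / (1 ^+ 2 + a ^+ 2))).
- under eq_bigr do (under eq_integral do rewrite expr1n mulr1).
  by under eq_bigr do rewrite integral_cauchy; rewrite prod_EFin prodr_const card_ord.
- move=> _; under eq_fun do rewrite expr1n; apply: measurable_funM => //.
  by apply: continuous_measurable_fun; exact: continuous_oneDsqrV.
- by move=> _ x; rewrite divr_ge0// ?mulr1// addr_ge0 ?sqr_ge0// expr1n.
Qed.

Lemma integ_poisson n : integ (mu n) (poisson 1).
Proof.
apply: ge0_integ; [exact: measurable_poisson_rV| |by rewrite integral_poisson_rV ltry].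
by move=> z; exact: poisson_ge0.
Qed.

Lemma Rintegral_poisson n : \int[mu n]_z poisson 1 z = (2 * pi) ^+ n.
Proof. by rewrite /Rintegral integral_poisson_rV. Qed.

End poisson_rV.

(** * Cosine and sine transforms *)

Section fourier.
Context {R : realType} {n : nat}.
Local Notation mu := (@lebesgue_rV R n).
Implicit Types (f g : 'rV[R]_n -> R) (x y z xi : 'rV[R]_n) (e : R).

(** The real and (up to sign) imaginary parts of the Fourier transform, without
    normalising factor. *)
Definition cosF f xi := \int[mu]_x (f x * cos (dot xi x)).
Definition sinF f xi := \int[mu]_x (f x * sin (dot xi x)).
(** The square modulus of the Fourier transform. *)
Definition powF f xi := cosF f xi ^+ 2 + sinF f xi ^+ 2.

Lemma measurable_cos_dot xi : measurable_fun setT (fun x => cos (dot xi x)).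
Proof.
apply: measurableT_comp (measurable_cosR) _.
exact: measurable_dotr.
Qed.

Lemma measurable_sin_dot xi : measurable_fun setT (fun x => sin (dot xi x)).
Proof.
apply: measurableT_comp (measurable_sinR) _.
exact: measurable_dotr.
Qed.

Lemma integ_cos f xi : integ mu f -> integ mu (fun x => f x * cos (dot xi x)).
Proof.
by move=> If; apply: integ_mulb => // [|x]; [exact: measurable_cos_dot|exact: normr_cos_le1].
Qed.

Lemma integ_sin f xi : integ mu f -> integ mu (fun x => f x * sin (dot xi x)).
Proof.
by move=> If; apply: integ_mulb => // [|x]; [exact: measurable_sin_dot|exact: normr_sin_le1].
Qed.

Lemma measurable_cos_dot2 :
  measurable_fun setT (fun z : 'rV[R]_n * 'rV[R]_n => cos (dot z.1 z.2)).
Proof. exact: measurableT_comp measurable_cosR (@measurable_dot2 R n). Qed.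

Lemma measurable_sin_dot2 :
  measurable_fun setT (fun z : 'rV[R]_n * 'rV[R]_n => sin (dot z.1 z.2)).
Proof. exact: measurableT_comp measurable_sinR (@measurable_dot2 R n). Qed.

(** The transform is not integrable a priori, so its measurability is
    read off from Fubini after multiplication by a positive integrable weight. *)
Lemma measurable_transform (h : 'rV[R]_n -> 'rV[R]_n -> R) f :
  measurable_fun setT (fun z : 'rV[R]_n * 'rV[R]_n => h z.1 z.2) ->
  (forall x y, `|h x y| <= 1) -> integ mu f ->
  measurable_fun setT (fun xi => \int[mu]_x (f x * h xi x)).
Proof.
move=> mh h1 If.
have [I1 _] := Rintegral_swap_kernel ler01 (@integ_weight R n 1 ltr01) If mh h1.
have [_ I2 _] := integ_kernel ler01 (@integ_weight R n 1 ltr01) If mh h1.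
rewrite (_ : (fun _ => _) = (fun xi => weight (-1) xi *
   \int[mu]_x (weight 1 xi * h xi x * f x))).
  by apply: measurable_funM; [exact: measurable_weight|exact: integ_measurable I1].
apply/funext => xi.
have w0 : weight 1 xi != 0.
  by apply/prodf_neq0 => i _; rewrite gt_eqF// expR_gt0.
have mhx : measurable_fun setT (h xi) by exact: (measurableT_comp mh (pair1_measurable xi)).
have Ih : integ mu (fun x => f x * h xi x) by exact: integ_mul_bounded If mhx (h1 xi).
have -> : \int[mu]_x (weight 1 xi * h xi x * f x) = weight 1 xi * \int[mu]_x (f x * h xi x).
  by rewrite -RintegralZl//; apply: eq_Rintegral => x _; rewrite -mulrA (mulrC (h _ _)).
rewrite mulrA [X in X * _](_ : _ = 1) ?mul1r//.
rewrite /weight -big_split big1// => i _.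
by rewrite /= -expRD opprK mul1r mulN1r subrr expR0.
Qed.

Lemma measurable_cosF f : integ mu f -> measurable_fun setT (cosF f).
Proof.
move=> If; apply: measurable_transform => // [|x y]; last exact: normr_cos_le1.
exact: measurable_cos_dot2.
Qed.

Lemma measurable_sinF f : integ mu f -> measurable_fun setT (sinF f).
Proof.
move=> If; apply: measurable_transform => // [|x y]; last exact: normr_sin_le1.
exact: measurable_sin_dot2.
Qed.

Lemma measurable_powF f : integ mu f -> measurable_fun setT (powF f).
Proof.
by move=> If; apply: measurable_funD; apply: measurable_funX;
  [exact: measurable_cosF|exact: measurable_sinF].
Qed.

Lemma powF_ge0 f xi : 0 <= powF f xi.
Proof. by rewrite addr_ge0 ?sqr_ge0. Qed.

Lemma cosF_le f xi : integ mu f -> `|cosF f xi| <= \int[mu]_x `|f x|.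
Proof.
move=> If; rewrite (le_trans (le_normr_Rintegral _ (integ_cos xi If)))//.
apply: le_Rintegral => //; [exact: integ_norm (integ_cos xi If)|exact: integ_norm|].
by move=> x _; rewrite normrM ler_piMr// normr_cos_le1.
Qed.

Lemma sinF_le f xi : integ mu f -> `|sinF f xi| <= \int[mu]_x `|f x|.
Proof.
move=> If; rewrite (le_trans (le_normr_Rintegral _ (integ_sin xi If)))//.
apply: le_Rintegral => //; [exact: integ_norm (integ_sin xi If)|exact: integ_norm|].
by move=> x _; rewrite normrM ler_piMr// normr_sin_le1.
Qed.

Lemma integ_weight_powF f e : 0 < e -> integ mu f -> integ mu (fun xi => weight e xi * powF f xi).
Proof.
move=> e0 If; set N := \int[mu]_x `|f x|.
have N0 : 0 <= N by rewrite Rintegral_ge0.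
apply: (@integ_mul_bounded _ _ _ _ _ _ (2 * N ^+ 2)); [exact: integ_weight|exact: measurable_powF|].
move=> xi; rewrite ger0_norm ?powF_ge0//.
have := cosF_le xi If; have := sinF_le xi If; rewrite -/N => h1 h2.
have e1 : cosF f xi ^+ 2 <= N ^+ 2 by rewrite -(real_normK (num_real (cosF f xi))) lerXn2r ?nnegrE.
have e2 : sinF f xi ^+ 2 <= N ^+ 2 by rewrite -(real_normK (num_real (sinF f xi))) lerXn2r ?nnegrE.
rewrite /powF; lra.
Qed.

Lemma poisson_bnd e z : 0 < e -> `|poisson e z| <= (2 / e) ^+ n.
Proof.
move=> e0; rewrite ger0_norm ?poisson_ge0//.
rewrite -[in leRHS](card_ord n) -prodr_const; apply: ler_prod => i _.
have h : 0 < e ^+ 2 + z 0 i ^+ 2 by rewrite ltr_pwDl ?exprn_gt0 ?sqr_ge0.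
rewrite divr_ge0 ?mulr_ge0 ?(ltW e0) ?(ltW h)//= ler_pdivrMr// -mulrA.
rewrite ler_wpM2l// mulrDr expr2 mulKf ?lt0r_neq0// lerDl mulr_ge0 ?invr_ge0 ?sqr_ge0 ?(ltW e0)//.
Qed.

Lemma measurable_comp_affine_rV (g : 'rV[R]_n -> R) e x : measurable_fun setT g ->
  measurable_fun setT (fun y => g (e *: y + x)).
Proof.
move=> mg; apply: (measurableT_comp mg).
exact: measurable_affine_rV.
Qed.

(** The square modulus of the transform, with one of its two factors
    opened: [powF f xi] is the integral over [x] of [f x] times this.  The factor
    [1 *:] puts the argument in the shape of the affine change of variables. *)
Lemma sqr_transform f xi x : integ mu f ->
  cos (dot xi x) * cosF f xi + sin (dot xi x) * sinF f xi =
  \int[mu]_y (f y * cos (dot xi (1 *: y - x))).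
Proof.
move=> If; rewrite -!RintegralZl//; [|exact: integ_sin|exact: integ_cos].
rewrite -RintegralD//; [|exact: integZ (integ_cos xi If)|exact: integZ (integ_sin xi If)].
apply: eq_Rintegral => y _.
by rewrite scale1r dotDr -[- x]scaleN1r dotZr mulN1r cosB; ring.
Qed.

(** Writing the square modulus as a double integral over [x] and [y] and
    integrating [xi] first turns the weight into the Poisson kernel at [y - x]. *)
Lemma fourier_weight f e : 0 < e -> integ mu f ->
  integ mu (fun x => f x * \int[mu]_y (f y * poisson e (1 *: y - x))) /\
  \int[mu]_xi (weight e xi * powF f xi) =
  \int[mu]_x (f x * \int[mu]_y (f y * poisson e (1 *: y - x))).
Proof.
move=> e0 If; set N := \int[mu]_x `|f x|.
have N0 : 0 <= N by rewrite Rintegral_ge0.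
have Iw := @integ_weight R n e e0.
pose h x xi := cos (dot xi x) * cosF f xi + sin (dot xi x) * sinF f xi.
have mh : measurable_fun setT (fun z : 'rV[R]_n * 'rV[R]_n => h z.1 z.2).
  have mct : measurable_fun setT (fun z : 'rV[R]_n * 'rV[R]_n => cosF f z.2).
    by apply: measurable_snd_comp; exact: measurable_cosF.
  have mst : measurable_fun setT (fun z : 'rV[R]_n * 'rV[R]_n => sinF f z.2).
    by apply: measurable_snd_comp; exact: measurable_sinF.
  rewrite /h; apply: measurable_funD; apply: measurable_funM => //.
    by under eq_fun do rewrite dotC; exact: measurable_cos_dot2.
  by under eq_fun do rewrite dotC; exact: measurable_sin_dot2.
have hN x xi : `|h x xi| <= N + N.
  rewrite (le_trans (ler_normD _ _))// lerD// normrM.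
    by rewrite (le_trans (ler_piMl _ (normr_cos_le1 _)))// cosF_le.
  by rewrite (le_trans (ler_piMl _ (normr_sin_le1 _)))// sinF_le.
have [I1 E1] := Rintegral_swap_kernel (addr_ge0 N0 N0) If Iw mh hN.
have key x : \int[mu]_xi (f x * h x xi * weight e xi) =
    f x * \int[mu]_y (f y * poisson e (1 *: y - x)).
  have mc : measurable_fun setT (fun z : 'rV[R]_n * 'rV[R]_n => cos (dot z.1 (1 *: z.2 - x))).
    apply: (measurableT_comp measurable_cosR).
    have := @measurable_dot2 R n => /(measurableT_comp (g := fun z : 'rV[R]_n * 'rV[R]_n => (z.1, 1 *: z.2 - x))).
    apply; apply: measurable_fun_pair; first exact: measurable_fst.
    exact: measurableT_comp (measurable_affine_rV 1 (- x)) measurable_snd.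
  have c1 (xi y : 'rV[R]_n) : `|cos (dot xi (1 *: y - x))| <= 1 by exact: normr_cos_le1.
  have [_ E2] := Rintegral_swap_kernel ler01 Iw If mc c1.
  have Ihw : integ mu (fun xi => h x xi * weight e xi).
    under eq_fun do rewrite mulrC; apply: (integ_mul_bounded Iw _ (hN x)).
    exact: (measurableT_comp mh (pair1_measurable x)).
  have -> : \int[mu]_xi (f x * h x xi * weight e xi) = f x * \int[mu]_xi (h x xi * weight e xi).
    rewrite -(@RintegralZl _ _ _ mu _ _ (f x) measurableT Ihw).
    by apply: eq_Rintegral => xi _; rewrite mulrA.
  suff -> : \int[mu]_xi (h x xi * weight e xi) = \int[mu]_y (f y * poisson e (1 *: y - x)) by [].
  transitivity (\int[mu]_xi \int[mu]_y (weight e xi * cos (dot xi (1 *: y - x)) * f y)).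
    apply: eq_Rintegral => xi _; rewrite /h (sqr_transform xi x If) [LHS]mulrC.
    have Ic : integ mu (fun y => f y * cos (dot xi (1 *: y - x))).
      by apply: (integ_mulb If (measurableT_comp mc (pair1_measurable xi))) => y; exact: c1.
    rewrite -(@RintegralZl _ _ _ mu _ _ (weight e xi) measurableT Ic).
    by apply: eq_Rintegral => y _; rewrite -mulrA (mulrC (f y)).
  rewrite E2; apply: eq_Rintegral => y _.
  have Iy : integ mu (fun xi => weight e xi * cos (dot xi (1 *: y - x))).
    by apply: (integ_mulb Iw (measurableT_comp mc (pair2_measurable y))) => xi; exact: c1.
  rewrite (@RintegralZr _ _ _ mu _ _ (f y) measurableT Iy).
  by rewrite (Rintegral_weight_cos _ e0); exact: mulrC.
split.
  by have := I1; rewrite (funext key).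
transitivity (\int[mu]_x \int[mu]_xi (f x * h x xi * weight e xi)); last first.
  by apply: eq_Rintegral => x _; exact: key.
rewrite E1; apply: eq_Rintegral => xi _.
have Ifh := integ_mul_bounded If (measurableT_comp mh (pair2_measurable xi)) (fun x => hN x xi).
rewrite (@RintegralZr _ _ _ mu _ _ (weight e xi) measurableT Ifh).
suff -> : \int[mu]_x (f x * h x xi) = powF f xi by rewrite [LHS]mulrC.
rewrite /powF !expr2.
have Ic := integ_cos xi If; have Is := integ_sin xi If.
rewrite {1}/cosF {1}/sinF.
rewrite -(@RintegralZr _ _ _ mu _ _ (cosF f xi) measurableT Ic).
rewrite -(@RintegralZr _ _ _ mu _ _ (sinF f xi) measurableT Is).
have Ic2 : integ mu (fun x => f x * cos (dot xi x) * cosF f xi).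
  by apply: (integ_mul_bounded Ic (measurable_cst (cosF f xi)) (M := `|cosF f xi|)).
have Is2 : integ mu (fun x => f x * sin (dot xi x) * sinF f xi).
  by apply: (integ_mul_bounded Is (measurable_cst (sinF f xi)) (M := `|sinF f xi|)).
rewrite -(@RintegralD _ _ _ mu _ _ _ measurableT Ic2 Is2).
by apply: eq_Rintegral => x _; rewrite /h; ring.
Qed.

(** After rescaling, the parameter [e] acts on the argument of [f] only,
    so the kernel is a fixed dominating function when [e] tends to 0. *)
Lemma fourier_weight_scaled f e : 0 < e -> integ mu f ->
  integ mu (fun x => f x * \int[mu]_z (f (e *: z + x) * poisson 1 z)) /\
  \int[mu]_xi (weight e xi * powF f xi) =
  \int[mu]_x (f x * \int[mu]_z (f (e *: z + x) * poisson 1 z)).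
Proof.
move=> e0 If.
have E x : \int[mu]_y (f y * poisson e (1 *: y - x)) = \int[mu]_z (f (e *: z + x) * poisson 1 z).
  have mp : measurable_fun setT (fun y => poisson e (1 *: y - x)).
    by apply: measurable_comp_affine_rV; exact: measurable_poisson_rV.
  have I : integ mu (fun y => f y * poisson e (1 *: y - x)).
    by apply: (integ_mul_bounded If mp) => y; exact: poisson_bnd.
  have [Ia ->] := integral_affine_rV x e0 I.
  rewrite -RintegralZl//; apply: eq_Rintegral => z _.
  by rewrite scale1r addrK mulrCA poisson_scale.
have [I1 E1] := fourier_weight e0 If.
split; last by rewrite E1; apply: eq_Rintegral => x _; rewrite E.
by under eq_fun do rewrite -E.
Qed.

End fourier.

(** * Bessel's inequality and Plancherel's identity *)

Lemma amgm_weighted {R : realFieldType} (a b p : R) : 0 <= p ->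
  a * (b * p) <= 2^-1 * a ^+ 2 * p + 2^-1 * (b ^+ 2 * p).
Proof. by move=> p0; have := sqr_ge0 (a - b); nra. Qed.

Section plancherel.
Context {R : realType} {n : nat}.
Local Notation mu := (@lebesgue_rV R n).
Implicit Types (f g : 'rV[R]_n -> R) (x y z xi : 'rV[R]_n) (e : R).

Lemma weightE e xi : weight e xi = expR (- e * \sum_(i < n) `|xi 0 i|).
Proof.
rewrite mulr_sumr /weight.
by rewrite (big_morph expR (@expRD R) (@expR0 R)).
Qed.

Lemma cvg_harmonic_mul (c : R) : (fun k => k.+1%:R^-1 * c) @ \oo --> (0 : R).
Proof.
have := @cvg_harmonic R => /(cvgMr_tmp (b := c)).
by rewrite mul0r; apply.
Qed.

Lemma cvg_weight xi : (fun k => weight (k.+1%:R^-1) xi) @ \oo --> (1 : R).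
Proof.
under eq_fun do rewrite weightE mulNr.
have H : (fun k => expR (- (k.+1%:R^-1 * \sum_(i < n) `|xi 0 i|))) @ \oo --> expR (- 0 : R).
  apply: continuous_cvg; first exact: continuous_expR.
  by apply: cvgN; exact: cvg_harmonic_mul.
by rewrite oppr0 expR0 in H.
Qed.

Lemma weight_nd xi (k m : nat) : (k <= m)%N -> weight (k.+1%:R^-1) xi <= weight (m.+1%:R^-1) xi.
Proof.
move=> km; rewrite !weightE ler_expR !mulNr lerN2 ler_wpM2r ?sumr_ge0//.
by rewrite lef_pV2 ?posrE// ler_nat.
Qed.

Lemma sqinteg_affine f e x : 0 < e -> sqinteg mu f ->
  integ mu (fun z => f (e *: z + x) ^+ 2).
Proof. by move=> e0 [_ f2]; have [] := integral_affine_rV x e0 f2. Qed.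

(** Apply [a b <= a^2/2 + b^2/2] to [f x] and [f (e z + x)], integrate
    against the Poisson kernel of total mass [(2 pi)^n], and use translation
    invariance in [x]. *)
Lemma fourier_weight_le f e : 0 < e -> integ mu f -> sqinteg mu f ->
  \int[mu]_xi (weight e xi * powF f xi) <= (2 * pi) ^+ n * \int[mu]_x (f x ^+ 2).
Proof.
move=> e0 If sf; have [mf f2] := sf.
set A := \int[mu]_x (f x ^+ 2).
pose P : 'rV[R]_n -> R := poisson 1.
have P0 z : 0 <= P z by exact: poisson_ge0.
have IP : integ mu P by exact: integ_poisson.
have mP := integ_measurable IP.
have [I1 ->] := fourier_weight_scaled e0 If.
have mF : measurable_fun setT (fun w : 'rV[R]_n * 'rV[R]_n => f (e *: w.2 + w.1)).
  apply: (measurableT_comp mf); apply: measurable_rVP => i.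
  under eq_fun do rewrite !mxE.
  apply: measurable_funD.
    apply: measurable_funM => //.
    exact: (measurableT_comp (measurable_coord_rV i) measurable_snd).
  exact: (measurableT_comp (measurable_coord_rV i) measurable_fst).
have Pb z : `|P z| <= (2 / 1) ^+ n by exact: poisson_bnd.
have Is x : integ mu (fun z => f (e *: z + x) ^+ 2 * P z).
  by apply: (integ_mul_bounded (sqinteg_affine x e0 sf) mP Pb).
have It z : \int[mu]_x (f (e *: z + x) ^+ 2) = A /\ integ mu (fun x => f (e *: z + x) ^+ 2).
  have [] := integral_affine_rV (e *: z) (@ltr01 R) f2.
  have E x : f (e *: z + x) = f (1 *: x + e *: z) by rewrite scale1r addrC.
  by move=> h; rewrite /A => ->; rewrite expr1n mul1r; split;
    [apply: eq_Rintegral => x _; rewrite E|under eq_fun do rewrite E].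
have It' z : integ mu (fun x => f (e *: z + x) ^+ 2 * P z).
  by under eq_fun do rewrite mulrC; apply: integZ; exact: (It z).2.
have IF : integ (mu \x mu)%E (fun w => f (e *: w.2 + w.1) ^+ 2 * P w.2).
  apply: integ_prod_swapped.
    by apply: measurable_funM; [exact: measurable_funX|exact: measurable_snd_comp].
  rewrite (_ : (fun _ => _) = (fun z => (A * P z)%:E)).
    by rewrite -EFin_Rintegral ?ltry//; exact: integZ.
  apply/funext => z /=.
  have -> : (\int[mu]_x `|f (e *: z + x) ^+ 2 * P z|%:E = \int[mu]_x (f (e *: z + x) ^+ 2 * P z)%:E)%E.
    by apply: eq_integral => x _; rewrite ger0_norm// mulr_ge0 ?sqr_ge0 ?P0.
  rewrite -EFin_Rintegral// RintegralZr//; last exact: (It z).2.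
  by rewrite (It z).1.
have [IB EB] := @Rintegral_swap _ _ _ _ _ mu mu (fun x z => f (e *: z + x) ^+ 2 * P z) IF Is It'.
have I2 := integZ 2^-1 (integZ ((2 * pi) ^+ n) f2).
have I3 := integZ 2^-1 IB.
have -> : (2 * pi) ^+ n * A = \int[mu]_x
    (2^-1 * ((2 * pi) ^+ n * f x ^+ 2) + 2^-1 * \int[mu]_z (f (e *: z + x) ^+ 2 * P z)).
  rewrite (@RintegralD _ _ _ mu _ _ _ measurableT I2 I3).
  rewrite (@RintegralZl _ _ _ mu _ _ 2^-1 measurableT (integZ ((2 * pi) ^+ n) f2)).
  rewrite (@RintegralZl _ _ _ mu _ _ ((2 * pi) ^+ n) measurableT f2).
  rewrite (@RintegralZl _ _ _ mu _ _ 2^-1 measurableT IB) -/A EB.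
  have -> : \int[mu]_z \int[mu]_x (f (e *: z + x) ^+ 2 * P z) = \int[mu]_z (A * P z).
    apply: eq_Rintegral => z _.
    by rewrite (@RintegralZr _ _ _ mu _ _ (P z) measurableT (It z).2) (It z).1.
  rewrite (@RintegralZl _ _ _ mu _ _ A measurableT IP) Rintegral_poisson; by field.
apply: (le_Rintegral measurableT I1 (integD I2 I3)) => x _.
have Ifz : integ mu (fun z => f (e *: z + x) * P z).
  apply: (integ_mul_bounded _ mP Pb); by have [] := integral_affine_rV x e0 If.
have -> : 2^-1 * ((2 * pi) ^+ n * f x ^+ 2) = \int[mu]_z (2^-1 * f x ^+ 2 * P z).
  rewrite (@RintegralZl _ _ _ mu _ _ (2^-1 * f x ^+ 2) measurableT IP) Rintegral_poisson; by ring.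
rewrite -(@RintegralZl _ _ _ mu _ _ (f x) measurableT Ifz).
rewrite -(@RintegralZl _ _ _ mu _ _ 2^-1 measurableT (Is x)).
have J1 := integZ (f x) Ifz; have J2 := integZ (2^-1 * f x ^+ 2) IP.
have J3 := integZ 2^-1 (Is x).
rewrite -(@RintegralD _ _ _ mu _ _ _ measurableT J2 J3).
apply: (le_Rintegral measurableT J1 (integD J2 J3)) => z _.
exact: amgm_weighted (P0 z).
Qed.

(** The weight increases to 1 as [e] decreases to 0: monotone convergence in
    [fourier_weight_le]. *)
Lemma bessel_fourier f : integ mu f -> sqinteg mu f ->
  integ mu (powF f) /\ \int[mu]_xi powF f xi <= (2 * pi) ^+ n * \int[mu]_x (f x ^+ 2).
Proof.
move=> If sf; have mpw := measurable_powF If.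
pose g k xi := (weight (k.+1%:R^-1) xi * powF f xi)%:E.
have k0 k : 0 < k.+1%:R^-1 :> R by rewrite invr_gt0.
have C : (fun k => \int[mu]_xi g k xi)%E @ \oo --> (\int[mu]_xi (powF f xi)%:E)%E.
  rewrite (_ : (\int[mu]_xi (powF f xi)%:E)%E = (\int[mu]_xi limn (g ^~ xi))%E).
    apply: cvg_monotone_convergence => //.
    - by move=> k; apply: measurable_EFin; apply: measurable_funM => //; exact: measurable_weight.
    - by move=> k xi _; rewrite lee_fin mulr_ge0 ?weight_ge0 ?powF_ge0.
    - by move=> xi _ k m km; rewrite lee_fin ler_wpM2r ?powF_ge0 ?weight_nd.
  apply: eq_integral => xi _; apply/esym/cvg_lim => //; apply: cvg_EFin; first exact: nearW.
  rewrite -[X in _ --> X]mul1r; apply: cvgM; [exact: cvg_weight|exact: cvg_cst].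
have le : (\int[mu]_xi (powF f xi)%:E <= ((2 * pi) ^+ n * \int[mu]_x (f x ^+ 2))%:E)%E.
  rewrite -(cvg_lim _ C)//; apply: lime_le; first by apply/cvg_ex; eexists; exact: C.
  apply: nearW => k; rewrite -EFin_Rintegral; last exact: integ_weight_powF.
  by rewrite lee_fin fourier_weight_le.
have Ip : integ mu (powF f).
  apply: ge0_integ => //; [exact: powF_ge0|exact: le_lt_trans le (ltry _)].
by split=> //; rewrite -lee_fin EFin_Rintegral.
Qed.

(** Continuity gives [f (e z + x) --> f x], and boundedness makes
    dominated convergence apply to both integrals of [fourier_weight_scaled]. *)
Lemma plancherel_continuous f (M : R) : continuous f -> (forall x, `|f x| <= M) ->
  integ mu f -> sqinteg mu f ->
  \int[mu]_xi powF f xi = (2 * pi) ^+ n * \int[mu]_x (f x ^+ 2).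
Proof.
move=> cf fM If sf; have [Ip _] := bessel_fourier If sf.
have [mf f2] := sf.
pose P : 'rV[R]_n -> R := poisson 1.
have P0 z : 0 <= P z by exact: poisson_ge0.
have IP : integ mu P by exact: integ_poisson.
have mP := integ_measurable IP.
pose e (k : nat) : R := k.+1%:R^-1.
have e0 k : 0 < e k by rewrite invr_gt0.
have C1 : (fun k => \int[mu]_xi (weight (e k) xi * powF f xi)) @ \oo --> \int[mu]_xi powF f xi.
  apply: (Rintegral_dominated_cvg _ _ _ Ip _).2.
  - move=> k; exact: integ_measurable (integ_weight_powF (e0 k) If).
  - exact: measurable_powF.
  - move=> xi; rewrite -[X in _ --> X]mul1r; apply: cvgM; [exact: cvg_weight|exact: cvg_cst].
  - move=> k xi; rewrite normrM !ger0_norm ?weight_ge0 ?powF_ge0//.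
    by rewrite ler_piMl ?powF_ge0// weight_le1// ltW.
have C2 x : (fun k => \int[mu]_z (f (e k *: z + x) * P z)) @ \oo --> \int[mu]_z (f x * P z).
  apply: (Rintegral_dominated_cvg _ _ _ (integZ M IP) _).2.
  - by move=> k; apply: measurable_funM => //; exact: (measurableT_comp mf (measurable_affine_rV _ _)).
  - by apply: measurable_funM.
  - move=> z; apply: cvgM; last exact: cvg_cst.
    apply: (@cvg_comp _ _ _ (fun k => e k *: z + x) f _ (nbhs x)); last exact: cf.
    have : (fun k => e k *: z + x) @ \oo --> 0 *: z + x.
      by apply: cvgD; [apply: cvgZr_tmp; exact: cvg_harmonic|exact: cvg_cst].
    by rewrite scale0r add0r.
  - by move=> k z; rewrite normrM [X in _ * X]ger0_norm// ler_wpM2r.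
have C3 : (fun k => \int[mu]_x (f x * \int[mu]_z (f (e k *: z + x) * P z))) @ \oo -->
    \int[mu]_x (f x * \int[mu]_z (f x * P z)).
  apply: (Rintegral_dominated_cvg _ _ _ (integZ (M * (2 * pi) ^+ n) (integ_norm If)) _).2.
  - move=> k; have [I _] := fourier_weight_scaled (e0 k) If; exact: integ_measurable I.
  - under eq_fun do rewrite RintegralZl//; apply: measurable_funM => //.
    by apply: measurable_funM.
  - by move=> x; apply: cvgM; [exact: cvg_cst|exact: C2].
  - move=> k x; rewrite normrM mulrC ler_wpM2r//.
    have Ifz : integ mu (fun z => f (e k *: z + x) * P z).
      apply: (integ_mul_bounded _ mP (@poisson_bnd R n 1^~ ltr01)).
      by have [] := integral_affine_rV x (e0 k) If.
    rewrite (le_trans (le_normr_Rintegral _ Ifz))// -Rintegral_poisson -RintegralZl//.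
    apply: le_Rintegral => //; [exact: integ_norm|exact: integZ|].
    by move=> z _; rewrite normrM [X in _ * X]ger0_norm// ler_wpM2r.
have E : \int[mu]_x (f x * \int[mu]_z (f x * P z)) = (2 * pi) ^+ n * \int[mu]_x (f x ^+ 2).
  rewrite -RintegralZl//; apply: eq_Rintegral => x _.
  by rewrite RintegralZl// Rintegral_poisson; ring.
rewrite -E -(cvg_lim (@Rhausdorff R) C1) -(cvg_lim (@Rhausdorff R) C3).
suff -> : (fun k => \int[mu]_xi (weight (e k) xi * powF f xi)) =
    (fun k => \int[mu]_x (f x * \int[mu]_z (f (e k *: z + x) * P z))) by [].
by apply/funext => k; have [_ ->] := fourier_weight_scaled (e0 k) If.
Qed.

End plancherel.

(** * Plancherel's identity for limits of continuous functions *)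

(** Replaces the triangle inequality of L^2, for squared norms: letting [d]
    tend to 0 loses nothing. *)
Lemma le_young {R : realFieldType} (a b d : R) : 0 < d ->
  (a + b) ^+ 2 <= (1 + d) * a ^+ 2 + (1 + d^-1) * b ^+ 2.
Proof.
move=> d0; rewrite -subr_ge0.
have -> : (1 + d) * a ^+ 2 + (1 + d^-1) * b ^+ 2 - (a + b) ^+ 2 = d^-1 * (d * a - b) ^+ 2.
  by field; rewrite gt_eqF.
by rewrite mulr_ge0 ?sqr_ge0 ?invr_ge0 ?ltW.
Qed.

Section approximation.
Context {R : realType} {n : nat}.
Local Notation mu := (@lebesgue_rV R n).
Implicit Types (f g : 'rV[R]_n -> R) (x y z xi : 'rV[R]_n) (e : R).

(** Functions in both L^1 and L^2: the transform is an absolutely convergent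
    integral and has a finite L^2 norm. *)
Definition L12 f := integ mu f /\ sqinteg mu f.

Definition bcont f := [/\ continuous f, exists M : R, forall x, `|f x| <= M & L12 f].

(** Being an L^2 limit of functions for which Plancherel's identity is
    already available.  Indicators of bounded open sets and elements of H^2_0 have
    this property by construction, so that density theorems are avoided. *)
Definition approximable f := exists fk : nat -> 'rV[R]_n -> R,
  (forall k, bcont (fk k)) /\
  (fun k => \int[mu]_x ((fk k x - f x) ^+ 2)) @ \oo --> (0 : R).

Lemma L12D f g : L12 f -> L12 g -> L12 (fun x => f x + g x).
Proof. by move=> [f1 f2] [g1 g2]; split; [exact: integD|exact: sqintegD]. Qed.

Lemma L12B f g : L12 f -> L12 g -> L12 (fun x => f x - g x).
Proof. by move=> [f1 f2] [g1 g2]; split; [exact: integB|exact: sqintegB]. Qed.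

Lemma L12Z a f : L12 f -> L12 (fun x => a * f x).
Proof. by move=> [f1 f2]; split; [exact: integZ|exact: sqintegZ]. Qed.

Lemma L12_sum (I : Type) (s : seq I) (h : I -> 'rV[R]_n -> R) :
  (forall i, L12 (h i)) -> L12 (fun x => \sum_(i <- s) h i x).
Proof.
by move=> H; split; [apply: integ_sum|apply: sqinteg_sum] => i; case: (H i).
Qed.

Lemma cosFD f g xi : integ mu f -> integ mu g ->
  cosF (fun x => f x + g x) xi = cosF f xi + cosF g xi.
Proof.
move=> If Ig; rewrite /cosF -(@RintegralD _ _ _ mu _ _ _ measurableT (integ_cos xi If) (integ_cos xi Ig)).
by apply: eq_Rintegral => x _; rewrite mulrDl.
Qed.

Lemma sinFD f g xi : integ mu f -> integ mu g ->
  sinF (fun x => f x + g x) xi = sinF f xi + sinF g xi.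
Proof.
move=> If Ig; rewrite /sinF -(@RintegralD _ _ _ mu _ _ _ measurableT (integ_sin xi If) (integ_sin xi Ig)).
by apply: eq_Rintegral => x _; rewrite mulrDl.
Qed.

Lemma cosFZ a f xi : integ mu f -> cosF (fun x => a * f x) xi = a * cosF f xi.
Proof.
move=> If; rewrite /cosF -(@RintegralZl _ _ _ mu _ _ a measurableT (integ_cos xi If)).
by apply: eq_Rintegral => x _; rewrite mulrA.
Qed.

Lemma sinFZ a f xi : integ mu f -> sinF (fun x => a * f x) xi = a * sinF f xi.
Proof.
move=> If; rewrite /sinF -(@RintegralZl _ _ _ mu _ _ a measurableT (integ_sin xi If)).
by apply: eq_Rintegral => x _; rewrite mulrA.
Qed.

Lemma cosF_sum (I : Type) (s : seq I) (h : I -> 'rV[R]_n -> R) xi :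
  (forall i, integ mu (h i)) ->
  cosF (fun x => \sum_(i <- s) h i x) xi = \sum_(i <- s) cosF (h i) xi.
Proof.
move=> H; rewrite /cosF.
under eq_Rintegral do rewrite mulr_suml.
by rewrite Rintegral_sum// => i; exact: integ_cos.
Qed.

Lemma sinF_sum (I : Type) (s : seq I) (h : I -> 'rV[R]_n -> R) xi :
  (forall i, integ mu (h i)) ->
  sinF (fun x => \sum_(i <- s) h i x) xi = \sum_(i <- s) sinF (h i) xi.
Proof.
move=> H; rewrite /sinF.
under eq_Rintegral do rewrite mulr_suml.
by rewrite Rintegral_sum// => i; exact: integ_sin.
Qed.

Lemma powF_young f g xi d : 0 < d -> integ mu f -> integ mu g ->
  powF (fun x => f x + g x) xi <= (1 + d) * powF f xi + (1 + d^-1) * powF g xi.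
Proof.
move=> d0 If Ig; rewrite /powF cosFD// sinFD//.
by rewrite mulrDr (mulrDr (1 + d^-1)) addrACA lerD// le_young.
Qed.

Lemma int_young f g d : 0 < d -> L12 f -> L12 g ->
  \int[mu]_x ((f x + g x) ^+ 2) <=
  (1 + d) * \int[mu]_x (f x ^+ 2) + (1 + d^-1) * \int[mu]_x (g x ^+ 2).
Proof.
move=> d0 Lf Lg; have [_ [_ fg2]] := L12D Lf Lg.
have [_ [_ f2]] := Lf; have [_ [_ g2]] := Lg.
rewrite -(@RintegralZl _ _ _ mu _ _ (1 + d) measurableT f2).
rewrite -(@RintegralZl _ _ _ mu _ _ (1 + d^-1) measurableT g2).
have J1 := integZ (1 + d) f2; have J2 := integZ (1 + d^-1) g2.
rewrite -(@RintegralD _ _ _ mu _ _ _ measurableT J1 J2).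
by apply: (le_Rintegral measurableT fg2 (integD J1 J2)) => x _; exact: le_young.
Qed.

Lemma plancherel_bcont f : bcont f ->
  \int[mu]_xi powF f xi = (2 * pi) ^+ n * \int[mu]_x (f x ^+ 2).
Proof. by move=> [cf [M fM] [I1 I2]]; exact: plancherel_continuous fM I1 I2. Qed.

(** One inequality is [bessel_fourier].  For the other, compare [f] with an
    approximant [g]: by [le_young], both the norm of [f] against that of [g] and
    the power of [g] against that of [f] cost a factor [1 + d] and a multiple of
    the norm of [g - f]. *)
Lemma plancherel f : L12 f -> approximable f ->
  \int[mu]_xi powF f xi = (2 * pi) ^+ n * \int[mu]_x (f x ^+ 2).
Proof.
move=> Lf [fk [Nk Ck]]; have [If sf] := Lf.
have [Ip Ble] := bessel_fourier If sf.
apply/eqP; rewrite eq_le Ble/=.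
set B := \int[mu]_xi powF f xi in Ble *; set A := \int[mu]_x _ in Ble *.
set c := (2 * pi) ^+ n in Ble *.
have c0 : 0 <= c by rewrite exprn_ge0// mulr_ge0// pi_ge0.
have B0 : 0 <= B by apply: Rintegral_ge0 => xi _; exact: powF_ge0.
suff H d : 0 < d -> c * A <= (1 + d) ^+ 2 * B.
  have C : (fun k => (1 + k.+1%:R^-1) ^+ 2 * B) @ \oo --> (1 + 0) ^+ 2 * B.
    apply: cvgM; last exact: cvg_cst.
    rewrite expr2; under eq_fun do rewrite expr2.
    have C1 : (fun k => 1 + k.+1%:R^-1) @ \oo --> (1 + 0 : R).
      by apply: cvgD; [exact: cvg_cst|exact: cvg_harmonic].
    exact: cvgM.
  rewrite addr0 expr1n mul1r in C; rewrite -(cvg_lim (@Rhausdorff R) C).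
  apply: limr_ge; first by apply/cvg_ex; eexists; exact: C.
  by apply: nearW => k; apply: H; rewrite invr_gt0.
move=> d0.
pose D k := \int[mu]_x ((fk k x - f x) ^+ 2).
have step k : c * A <= (1 + d) ^+ 2 * B + (c * ((1 + d) * (1 + d^-1)) + c * (1 + d^-1)) * D k.
  have [_ _ Lk] := Nk k; have [Ik sk] := Lk.
  have Ld : L12 (fun x => fk k x - f x) by exact: L12B.
  have Ld' : L12 (fun x => f x - fk k x) by exact: L12B.
  have [Id sd] := Ld; have [Ipd Pd] := bessel_fourier Id sd.
  have e1 : A <= (1 + d) * \int[mu]_x (fk k x ^+ 2) + (1 + d^-1) * D k.
    have := int_young d0 Lk Ld'.
    have -> : \int[mu]_x ((fk k x + (f x - fk k x)) ^+ 2) = A.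
      by apply: eq_Rintegral => x _; rewrite addrC subrK.
    have -> // : \int[mu]_x ((f x - fk k x) ^+ 2) = D k.
    by apply: eq_Rintegral => x _; rewrite -sqrrN opprB.
  have e2 : c * \int[mu]_x (fk k x ^+ 2) <= (1 + d) * B + (1 + d^-1) * \int[mu]_xi powF (fun x => fk k x - f x) xi.
    rewrite -plancherel_bcont//.
    rewrite -(@RintegralZl _ _ _ mu _ _ (1 + d) measurableT Ip).
    rewrite -(@RintegralZl _ _ _ mu _ _ (1 + d^-1) measurableT Ipd).
    have J1 := integZ (1 + d) Ip; have J2 := integZ (1 + d^-1) Ipd.
    rewrite -(@RintegralD _ _ _ mu _ _ _ measurableT J1 J2).
    have [Ipk _] := bessel_fourier Ik sk.
    apply: (le_Rintegral measurableT Ipk (integD J1 J2)) => xi _.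
    rewrite (_ : fk k = (fun x => f x + (fk k x - f x))); last first.
      by apply/funext => x; rewrite addrC subrK.
    rewrite (_ : (fun x => f x + (fk k x - f x) - f x) = (fun x => fk k x - f x)); last first.
      by apply/funext => x; rewrite [f x + _]addrC subrK.
    exact: powF_young.
  have d1 : 0 <= 1 + d^-1 by rewrite addr_ge0 ?invr_ge0 ?ltW.
  have d2 : 0 <= 1 + d by rewrite addr_ge0 ?ltW.
  apply: (le_trans (ler_wpM2l c0 e1)).
  have := ler_wpM2l d2 e2.
  have := ler_wpM2l (mulr_ge0 d2 d1) Pd; rewrite -/(D k) -/c.
  set P := \int[mu]_xi powF _ xi; set F2 := \int[mu]_x (fk k x ^+ 2).
  move=> h1 h2; rewrite mulrDr mulrCA; apply: (le_trans (lerD h2 (lexx _))).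
  rewrite -subr_ge0 in h1; rewrite -subr_ge0.
  move: h1; set X := _ - _; set Y := _ - _.
  suff -> : Y = X by [].
  by rewrite /X /Y; ring.
have C : (fun k => (1 + d) ^+ 2 * B + (c * ((1 + d) * (1 + d^-1)) + c * (1 + d^-1)) * D k) @ \oo
    --> (1 + d) ^+ 2 * B + (c * ((1 + d) * (1 + d^-1)) + c * (1 + d^-1)) * 0.
  by apply: cvgD; [exact: cvg_cst|apply: cvgM; [exact: cvg_cst|exact: Ck]].
rewrite mulr0 addr0 in C; rewrite -(cvg_lim (@Rhausdorff R) C).
apply: limr_ge; first by apply/cvg_ex; eexists; exact: C.
exact: nearW.
Qed.

Lemma bcontD f g : bcont f -> bcont g -> bcont (fun x => f x + g x).
Proof.
move=> [cf [M fM] Lf] [cg [N gN] Lg]; split; last exact: L12D.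
- by move=> x; exact: (cvgD (cf x) (cg x)).
- by exists (M + N) => x; rewrite (le_trans (ler_normD _ _))// lerD.
Qed.

Lemma bcontZ a f : bcont f -> bcont (fun x => a * f x).
Proof.
move=> [cf [M fM] Lf]; split; last exact: L12Z.
- by move=> x; exact: (cvgMl_tmp (a := a) (cf x)).
- by exists (`|a| * M) => x; rewrite normrM ler_wpM2l.
Qed.

Lemma approximableD f g : L12 f -> L12 g -> approximable f -> approximable g ->
  approximable (fun x => f x + g x).
Proof.
move=> Lf Lg [fk [Nf Cf]] [gk [Ng Cg]].
exists (fun k x => fk k x + gk k x); split; first by move=> k; exact: bcontD.
apply: (@squeeze_cvgr _ _ _ _ (fun=> 0) (fun k => (1 + 1) * \int[mu]_x ((fk k x - f x) ^+ 2)
   + (1 + 1^-1) * \int[mu]_x ((gk k x - g x) ^+ 2))).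
- apply: nearW => k; apply/andP; split; first by apply: Rintegral_ge0 => x _; exact: sqr_ge0.
  have [_ _ L1] := Nf k; have [_ _ L2] := Ng k.
  have := int_young ltr01 (L12B L1 Lf) (L12B L2 Lg).
  apply: le_trans; rewrite le_eqVlt; apply/orP; left; apply/eqP.
  by apply: eq_Rintegral => x _; congr (_ ^+ 2); ring.
- exact: cvg_cst.
- have := cvgD (cvgMl_tmp (a := 1 + 1) Cf) (cvgMl_tmp (a := 1 + 1^-1) Cg).
  by rewrite !mulr0 addr0; exact.
Qed.

Lemma approximableZ a f : L12 f -> approximable f -> approximable (fun x => a * f x).
Proof.
move=> Lf [fk [Nf Cf]]; exists (fun k x => a * fk k x); split; first by move=> k; exact: bcontZ.
rewrite (_ : (fun _ => _) = (fun k => a ^+ 2 * \int[mu]_x ((fk k x - f x) ^+ 2))).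
  by rewrite -(mulr0 (a ^+ 2)); apply: cvgM => //; exact: cvg_cst.
apply/funext => k; have [_ _ Lk] := Nf k; have [_ [_ d2]] := L12B Lk Lf.
rewrite -(@RintegralZl _ _ _ mu _ _ (a ^+ 2) measurableT d2).
by apply: eq_Rintegral => x _; rewrite -mulrBr exprMn.
Qed.

Lemma bcont0 : bcont (fun=> 0).
Proof.
split; [exact: cst_continuous|by exists 0 => x; rewrite normr0|].
by split; [exact: integ0|exact: sqinteg0].
Qed.

Lemma bcont_approximable f : bcont f -> approximable f.
Proof.
move=> Nf; exists (fun=> f); split => //.
under eq_fun do (under eq_Rintegral do rewrite subrr expr0n/=).
by rewrite Rintegral_cst// mul0r; exact: cvg_cst.
Qed.

Lemma approximable_sum (I : Type) (s : seq I) (h : I -> 'rV[R]_n -> R) :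
  (forall i, L12 (h i)) -> (forall i, approximable (h i)) ->
  approximable (fun x => \sum_(i <- s) h i x).
Proof.
move=> L A; elim: s => [|i s IH].
  by under eq_fun do rewrite big_nil; apply: bcont_approximable; exact: bcont0.
by under eq_fun do rewrite big_cons; apply: approximableD => //; exact: L12_sum.
Qed.

End approximation.

(** * Compactly supported functions and transforms of derivatives *)

Section cubes.
Context {R : realType} {n : nat}.
Local Notation mu := (@lebesgue_rV R n).
Implicit Types (f g : 'rV[R]_n -> R) (x y z xi : 'rV[R]_n).

Definition cube (a : R) : set 'rV[R]_n := box (fun=> `[- a, a]%classic).

Lemma measurable_cube a : measurable (cube a).
Proof. by apply: measurable_box => i; exact: measurable_itv. Qed.

Lemma cube_lty a : (mu (cube a) < +oo)%E.
Proof.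
rewrite /cube lebesgue_rV_box; last by move=> i; exact: measurable_itv.
under eq_bigr do rewrite lebesgue_measure_itv/=.
rewrite (_ : (if _ then _ else _) = (if - a < a then a - - a else 0)%:E).
  by rewrite prod_EFin ltry.
by rewrite lte_fin; case: ifPn.
Qed.

Lemma cubeP a x : cube a x <-> forall i, `|x 0 i| <= a.
Proof.
by split=> H i; have := H i; rewrite /= in_itv/= ler_norml.
Qed.

Lemma bounded_cube (A : set 'rV[R]_n) : bounded_set A -> exists2 a : R, 0 < a & A `<=` cube a.
Proof.
move=> [M [_ HM]]; exists (Num.max M 0 + 1).
  by rewrite ltr_pwDr// le_max lexx orbT.
move=> x Ax; apply/cubeP => i.
have := HM (Num.max M 0 + 1); rewrite /= ltr_pwDr// ?le_max ?lexx// => /(_ isT x Ax).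
apply: le_trans; rewrite /Num.norm /= mx_normrE.
exact: (le_bigmax _ (fun p => `|x p.1 p.2|) (0, i)).
Qed.

Lemma integ_indic (A : set 'rV[R]_n) : measurable A -> (mu A < +oo)%E ->
  integ mu (\1_A : 'rV[R]_n -> R).
Proof.
move=> mA Aoo; apply: ge0_integ => //.
by rewrite integral_indic// setIT.
Qed.

Lemma L12_bounded f (A : set 'rV[R]_n) (M : R) : measurable A -> (mu A < +oo)%E ->
  measurable_fun setT f -> (forall x, `|f x| <= M) -> (forall x, ~ A x -> f x = 0) ->
  L12 f.
Proof.
move=> mA Aoo mf fM f0.
have I1 := integ_indic mA Aoo.
have bnd x : `|f x| <= M * \1_A x.
  rewrite indicE; case: (boolP (x \in A)) => xA; first by rewrite mulr1.
  by rewrite f0 ?normr0 ?mulr0//; move/negP: xA; rewrite inE.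
split; first by apply: (le_integ mf bnd); exact: integZ.
split=> //; apply: (@le_integ _ _ _ _ _ (fun x => M ^+ 2 * \1_A x)).
- exact: measurable_funX.
- move=> x; rewrite normrX (_ : M ^+ 2 * _ = (M * \1_A x) ^+ 2).
    by rewrite lerXn2r ?nnegrE// (le_trans _ (bnd x)).
  by rewrite exprMn indicE; case: (x \in A); rewrite ?expr1n ?expr0n.
- exact: integZ.
Qed.

(** From [|f| <= f^2 + 1] on a set of finite measure. *)
Lemma L12_supp f (A : set 'rV[R]_n) : measurable A -> (mu A < +oo)%E ->
  sqinteg mu f -> (forall x, ~ A x -> f x = 0) -> L12 f.
Proof.
move=> mA Aoo [mf f2] f0; split=> //.
apply: (@le_integ _ _ _ _ _ (fun x => f x ^+ 2 + \1_A x)) => //.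
  move=> x; rewrite indicE; case: (boolP (x \in A)) => xA.
    rewrite (_ : true%:R = 1 :> R)// -(real_normK (num_real (f x))); have := normr_ge0 (f x); nra.
  by rewrite f0 ?normr0 ?expr0n ?addr0//; move/negP: xA; rewrite inE.
by apply: integD => //; exact: integ_indic.
Qed.

End cubes.

Section test_functions.
Context {R : realType} {n : nat}.
Local Notation mu := (@lebesgue_rV R n).
Implicit Types (f g phi : 'rV[R]_n -> R) (x y z xi : 'rV[R]_n).
Variable Omega : set 'rV[R]_n.
Local Notation ei i := (delta_mx 0 i : 'rV[R]_n).

Lemma continuous_measurable_rV f : continuous f -> measurable_fun setT f.
Proof.
move=> cf; apply: (measurability _ (RGenOpens.measurableE R)) => _ [_ [a [b ->]] <-].
rewrite setTI; apply: open_measurable_rV.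
by apply: open_comp; [move=> v _; exact: cf|exact: interval_open].
Qed.

Lemma test_function_continuous phi : test_function Omega phi -> continuous phi.
Proof. by move=> [/(_ [::]) []]. Qed.

Lemma test_function_out phi x : test_function Omega phi -> ~ Omega x -> phi x = 0.
Proof.
move=> [_ _ sub] nx; apply/eqP; apply: contrapT => /negP px; apply: nx; apply: sub.
exact: subset_closure.
Qed.

Lemma test_function_cube phi : test_function Omega phi ->
  exists2 a : R, 0 < a & forall x, ~ cube a x -> phi x = 0.
Proof.
move=> [_ /compact_bounded/bounded_cube[a a0 sub] _]; exists a => // x nx.
apply/eqP; apply: contrapT => /negP px; apply: nx; apply: sub; exact: subset_closure.
Qed.

Lemma test_function_bounded phi : test_function Omega phi -> exists M : R, forall x, `|phi x| <= M.
Proof.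
move=> Tphi; have cphi := test_function_continuous Tphi; have [_ cK _] := Tphi.
have /compact_bounded[M [_ HM]] := continuous_compact (continuous_subspaceT cphi) cK.
exists (Num.max M 0 + 1) => x.
have [px|px] := eqVneq (phi x) 0.
  by rewrite px normr0 addr_ge0// le_max lexx orbT.
apply: (HM (Num.max M 0 + 1)); first by rewrite ltr_pwDr// le_max lexx.
by exists x => //; exact: subset_closure.
Qed.

Lemma test_function_bcont phi : test_function Omega phi -> bcont phi.
Proof.
move=> Tphi; have cphi := test_function_continuous Tphi.
have [M phiM] := test_function_bounded Tphi; have [a a0 phia] := test_function_cube Tphi.
split=> //; first by exists M.
apply: (L12_bounded (measurable_cube a) (cube_lty a) _ phiM phia).
exact: continuous_measurable_rV.
Qed.

Lemma test_function_partial phi i : test_function Omega phi -> test_function Omega (partial i phi).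
Proof.
move=> [sphi cphi sub].
have sub2 : closure [set x | partial i phi x != 0] `<=` closure [set x | phi x != 0].
  have /closure_id E := @closed_closure _ [set x | phi x != 0].
  rewrite [X in _ `<=` X]E.
  apply: closure_subset => x /=; apply: contraNP => nx.
  apply/eqP; rewrite /partial.
  have nearx : \near x, phi x = 0.
    have : open (~` closure [set x | phi x != 0]) by apply: closed_openC; exact: closed_closure.
    rewrite openE => /(_ x nx); apply: filterS => y ny.
    apply/eqP; apply: contrapT => /negP py; apply: ny; exact: subset_closure.
  by rewrite (near_eq_derive _ nearx) derive_cst.
split.
- move=> s; have := sphi (rcons s i).
  by rewrite /partials -cats1 foldr_cat.
- by apply: (subclosed_compact _ cphi sub2); exact: closed_closure.
- exact: subset_trans sub2 sub.
Qed.

Lemma is_derive_line f x (v : 'rV[R]_n) (t : R) : derivable f (x + t *: v) v ->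
  is_derive t 1 (fun t => f (x + t *: v)) ('D_v f (x + t *: v)).
Proof.
move=> df.
have E : (fun h : R => h^-1 *: (((fun t => f (x + t *: v)) \o shift t) (h *: (1 : R)) - f (x + t *: v)))
   = (fun h : R => h^-1 *: ((f \o shift (x + t *: v)) (h *: v) - f (x + t *: v))).
  apply/funext => h /=; congr (_ *: (f _ - _)).
  by rewrite scalerDl addrCA; congr (_ *: _ + _); rewrite /GRing.scale/= mulr1.
apply: DeriveDef; first by rewrite /derivable E.
by rewrite /derive E.
Qed.

(** Mean value theorem along the coordinate line, the partial derivative
    being a test function and hence bounded.  This dominates difference quotients. *)
Lemma test_function_lip phi i : test_function Omega phi ->
  exists M : R, forall x (t : R), 0 < t -> `|phi (x + t *: ei i) - phi x| <= M * t.
Proof.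
move=> Tphi; have Ti := test_function_partial i Tphi.
have [M HM] := test_function_bounded Ti; exists M => x t t0.
have [sphi _ _] := Tphi.
have D (s : R) : is_derive s 1 (fun t => phi (x + t *: ei i)) (partial i phi (x + s *: ei i)).
  by apply: is_derive_line; have [_] := sphi [::]; exact.
have [|c _] := @MVT R (fun t => phi (x + t *: ei i)) (fun s => partial i phi (x + s *: ei i)) 0 t t0 (fun s _ => D s).
  apply: continuous_subspaceT => s; apply/differentiable_continuous/derivable1_diffP.
  by have [] := D s.
rewrite scale0r addr0 subr0 => ->.
by rewrite normrM (gtr0_norm t0) ler_wpM2r// ltW.
Qed.

Lemma dot_ei xi i : dot xi (ei i) = xi 0 i.
Proof.
rewrite /dot (bigD1 i)//= mxE !eqxx mulr1 big1 ?addr0// => j ji.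
by rewrite mxE eqxx (negbTE ji) mulr0.
Qed.

(** A translation rotates the pair of transforms by the angle [xi . v]. *)
Lemma translate_transform phi xi (v : 'rV[R]_n) : L12 phi ->
  L12 (fun x => phi (x + v)) /\
  cosF (fun x => phi (x + v)) xi = cos (dot xi v) * cosF phi xi + sin (dot xi v) * sinF phi xi /\
  sinF (fun x => phi (x + v)) xi = cos (dot xi v) * sinF phi xi - sin (dot xi v) * cosF phi xi.
Proof.
move=> [I1 [m2 I2]].
have aff (h : 'rV[R]_n -> R) : integ mu h ->
    integ mu (fun x => h (x + v)) /\ \int[mu]_x h x = \int[mu]_x h (x + v).
  by move=> Ih; have [J ->] := integ_translate v Ih.
have [J1 _] := aff _ I1; have [J2 _] := aff _ I2.
have LT : L12 (fun x => phi (x + v)) by split=> //; split=> //; exact: integ_measurable J1.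
have Ec := (aff _ (integ_cos xi I1)).2; have Es := (aff _ (integ_sin xi I1)).2.
have K1 := integ_cos xi J1; have K2 := integ_sin xi J1.
have E1 : cosF phi xi = cos (dot xi v) * cosF (fun x => phi (x + v)) xi -
      sin (dot xi v) * sinF (fun x => phi (x + v)) xi.
  rewrite {1}/cosF Ec.
  rewrite -(@RintegralZl _ _ _ mu _ _ (cos (dot xi v)) measurableT K1).
  rewrite -(@RintegralZl _ _ _ mu _ _ (sin (dot xi v)) measurableT K2).
  rewrite -(@RintegralB _ _ _ mu _ _ _ measurableT (integZ _ K1) (integZ _ K2)).
  by apply: eq_Rintegral => x _; rewrite dotDr cosD; ring.
have E2 : sinF phi xi = cos (dot xi v) * sinF (fun x => phi (x + v)) xi +
      sin (dot xi v) * cosF (fun x => phi (x + v)) xi.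
  rewrite {1}/sinF Es.
  rewrite -(@RintegralZl _ _ _ mu _ _ (cos (dot xi v)) measurableT K2).
  rewrite -(@RintegralZl _ _ _ mu _ _ (sin (dot xi v)) measurableT K1).
  rewrite -(@RintegralD _ _ _ mu _ _ _ measurableT (integZ _ K2) (integZ _ K1)).
  by apply: eq_Rintegral => x _; rewrite dotDr sinD; ring.
split=> //; rewrite E1 E2.
move: (cosF _ xi) (sinF _ xi) => c s; have := cos2Dsin2 (dot xi v).
move: (cos _) (sin _) => C S CS; split.
- rewrite -[LHS]mul1r -CS; ring.
- rewrite -[LHS]mul1r -CS; ring.
Qed.

Lemma is_derive_trig (a b s : R) :
  is_derive (0 : R) 1 (fun t : R => cos (a * t) * b + sin (a * t) * s) (a * s).
Proof.
have D0 : is_derive (0 : R) 1 (fun x : R => a * x) a by apply: is_derive_eq; rewrite /GRing.scale/= mulr1.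
have D2 : is_derive (0 : R) 1 (fun x : R => sin (a * x)) (a * cos (a * 0)).
  by apply: is_derive_eq; rewrite /GRing.scale/= mulrC.
have D3 : is_derive (0 : R) 1 (fun x : R => cos (a * x)) (- (a * sin (a * 0))).
  by apply: is_derive_eq; rewrite /GRing.scale/= mulNr mulrC.
by apply: is_derive_eq; rewrite /GRing.scale/= !mulr0 cos0 sin0; ring.
Qed.

Lemma cvg_diff_quotient (h : R -> R) (l : R) : is_derive (0 : R) 1 h l ->
  (fun k => k.+1%:R * (h (k.+1%:R^-1) - h 0)) @ \oo --> l.
Proof.
move=> [dh <-]; rewrite /derive.
have C : (fun r : R => r^-1 *: ((h \o shift 0) (r *: (1 : R)) - h 0)) @ 0^' --> 'D_1 h 0 by exact: dh.
have H : (fun k => k.+1%:R^-1 : R) @ \oo --> (0 : R)^'.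
  move=> A nA; have nA2 : \forall x \near (0 : R), x != 0 -> A x by exact: nA.
  have : \forall k \near \oo, (@harmonic R k != 0 -> A (@harmonic R k)) by exact: (@cvg_harmonic R _ nA2).
  by apply: filterS => k; apply; rewrite /harmonic /= invr_eq0.
have := cvg_comp _ _ H C; rewrite /=.
suff -> : (fun k => k.+1%:R * (h k.+1%:R^-1 - h 0)) =
  (fun r : R => r^-1 *: ((h \o shift 0) (r *: (1 : R)) - h 0)) \o (fun k => k.+1%:R^-1) by [].
by apply/funext => k /=; rewrite invrK addr0 /GRing.scale/= mulr1.
Qed.

(** Integration by parts without boundary terms, done as follows: the
    difference quotients of [phi] have transforms given by [translate_transform],
    and converge to the derivative boundedly on a fixed cube. *)
Lemma transform_partial phi i xi : test_function Omega phi ->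
  cosF (partial i phi) xi = xi 0 i * sinF phi xi /\
  sinF (partial i phi) xi = - (xi 0 i * cosF phi xi).
Proof.
move=> Tphi; have [_ _ Lphi] := test_function_bcont Tphi; have [Iphi _] := Lphi.
have Ti := test_function_partial i Tphi; have [_ _ [Ii _]] := test_function_bcont Ti.
have [M HM] := test_function_lip i Tphi; have [a a0 Ha] := test_function_cube Tphi.
pose t (k : nat) : R := k.+1%:R^-1.
have t0 k : 0 < t k by rewrite invr_gt0.
pose q k x := k.+1%:R * (phi (x + t k *: ei i) - phi x).
have Ltr k := translate_transform xi (t k *: ei i) Lphi.
have Lq k : L12 (q k) by apply: L12Z; apply: L12B => //; exact: (Ltr k).1.
have M0 : 0 <= M by have := HM 0 1 ltr01; rewrite mulr1; exact: le_trans.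
have qb k x : `|q k x| <= M * \1_(cube (a + 1) : set 'rV[R]_n) x.
  rewrite indicE; case: (boolP (x \in _)) => xA.
    rewrite mulr1 /q normrM ger0_norm// -ler_pdivlMl// mulrC; exact: HM.
  have xA' : ~ cube (a + 1) x by move/negP: xA; rewrite inE.
  rewrite /q !Ha ?subrr ?mulr0 ?normr0//.
    apply: contra_not xA' => /cubeP H; apply/cubeP => j; rewrite (le_trans (H j))// lerDl//.
  apply: contra_not xA' => /cubeP H; apply/cubeP => j.
  have := H j; rewrite !mxE => Hj.
  have -> : x 0 j = (x 0 j + t k * ((0 == 0 :> 'I_1) && (j == i))%:R) -
    t k * ((0 == 0 :> 'I_1) && (j == i))%:R by rewrite addrK.
  rewrite (le_trans (ler_normB _ _))// lerD// normrM ger0_norm ?(ltW (t0 k))//.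
  have t1 : t k <= 1 by rewrite invf_le1// ler1n.
  by case: (_ && _); rewrite ?normr1 ?mulr1 ?normr0 ?mulr0.
have qc x : (fun k => q k x) @ \oo --> partial i phi x.
  have [sphi _ _] := Tphi; have [_ dphi] := sphi [::].
  have D : is_derive (0 : R) 1 (fun s => phi (x + s *: ei i)) (partial i phi (x + 0 *: ei i)).
    by apply: is_derive_line; exact: dphi.
  by have := cvg_diff_quotient D; rewrite /= scale0r addr0.
have Ig : integ mu (fun x => M * \1_(cube (a + 1)) x).
  by apply: integZ; apply: integ_indic; [exact: measurable_cube|exact: cube_lty].
have Itk k : integ mu (fun x => phi (x + t k *: ei i)) by have [[]] := Ltr k.
have key (w : 'rV[R]_n -> R) : measurable_fun setT w -> (forall x, `|w x| <= 1) ->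
    (fun k => \int[mu]_x (q k x * w x)) @ \oo --> \int[mu]_x (partial i phi x * w x).
  move=> mw w1; apply: (Rintegral_dominated_cvg _ _ _ Ig _).2.
  - by move=> k; apply: measurable_funM => //; exact: integ_measurable (Lq k).1.
  - by apply: measurable_funM => //; exact: integ_measurable Ii.
  - by move=> x; exact: cvgMr_tmp.
  - by move=> k x; rewrite normrM (le_trans _ (qb k x))// ler_piMr.
have dt k : dot xi (t k *: ei i) = xi 0 i * t k by rewrite dotZr dot_ei mulrC.
have T1 : (fun k => cosF (q k) xi) @ \oo --> cosF (partial i phi) xi.
  by apply: key => [|x]; [exact: measurable_cos_dot|exact: normr_cos_le1].
have T2 : (fun k => sinF (q k) xi) @ \oo --> sinF (partial i phi) xi.
  by apply: key => [|x]; [exact: measurable_sin_dot|exact: normr_sin_le1].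
have q1 k : q k = (fun x => k.+1%:R * (phi (x + t k *: ei i) + -1 * phi x)).
  by apply/funext => x; rewrite /q mulN1r.
have Iq k : integ mu (fun x => phi (x + t k *: ei i) + -1 * phi x).
  by apply: integD => //; exact: integZ.
split.
- rewrite -(cvg_lim (@Rhausdorff R) T1).
  have C := cvg_diff_quotient (is_derive_trig (xi 0 i) (cosF phi xi) (sinF phi xi)).
  apply/cvg_lim => //.
  rewrite (_ : (fun _ => _) = (fun k => k.+1%:R * (cos (xi 0 i * k.+1%:R^-1) * cosF phi xi
   + sin (xi 0 i * k.+1%:R^-1) * sinF phi xi
   - (cos (xi 0 i * 0) * cosF phi xi + sin (xi 0 i * 0) * sinF phi xi)))) //.
  apply/funext => k; rewrite q1 cosFZ// cosFD//; last exact: integZ.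
  rewrite cosFZ// (Ltr k).2.1 dt mulr0 cos0 sin0 mul1r mul0r addr0 mulN1r; by [].
- rewrite -(cvg_lim (@Rhausdorff R) T2) -mulrN.
  have C := cvg_diff_quotient (is_derive_trig (xi 0 i) (sinF phi xi) (- cosF phi xi)).
  apply/cvg_lim => //.
  rewrite (_ : (fun _ => _) = (fun k => k.+1%:R * (cos (xi 0 i * k.+1%:R^-1) * sinF phi xi
   + sin (xi 0 i * k.+1%:R^-1) * - cosF phi xi
   - (cos (xi 0 i * 0) * sinF phi xi + sin (xi 0 i * 0) * - cosF phi xi)))) //.
  apply/funext => k; rewrite q1 sinFZ// sinFD//; last exact: integZ.
  rewrite sinFZ// (Ltr k).2.2 dt mulr0 cos0 sin0 mul1r mul0r addr0 mulN1r mulrN; by [].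
Qed.

End test_functions.

(** * Orthonormalisation by congruence of the Gram matrix *)

Section gram_schmidt.
Context {R : rcfType}.

Definition posdef k (G : 'M[R]_k) := forall v : 'rV[R]_k, v != 0 -> 0 < (v *m G *m v^T) 0 0.

(** The Schur complement of the first diagonal entry [a] is again
    positive definite; an orthonormalisation of it is bordered by [1 / sqrt a]. *)
Lemma posdef_orthonormalization_step k (G : 'M[R]_(1 + k, 1 + k)) :
  (forall S : 'M[R]_k, S^T = S -> posdef S -> exists M : 'M[R]_k, M *m S *m M^T = 1%:M) ->
  G^T = G -> posdef G -> exists M : 'M[R]_(1 + k, 1 + k), M *m G *m M^T = 1%:M.
Proof.
move=> IH sG pG.
pose a := ulsubmx G 0 0.
pose b := dlsubmx G.
pose D := drsubmx G.
have Eb : ursubmx G = b^T.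
  by rewrite /b -[in RHS]sG -trmx_ursub trmxK.
have ED : D^T = D by rewrite /D trmx_drsub sG.
have EG : G = block_mx a%:M b^T b D.
  by rewrite -Eb /a -mx11_scalar submxK.
have quad (x : 'rV_1) (y : 'rV_k) :
    row_mx x y *m G *m (row_mx x y)^T = x *m a%:M *m x^T + y *m b *m x^T + x *m b^T *m y^T + y *m D *m y^T.
  rewrite EG mul_row_block tr_row_mx mul_row_col !mulmxDl.
  by rewrite !addrA.
have a0 : 0 < a.
  have := pG (row_mx 1%:M 0 : 'rV_(1 + k)).
  rewrite quad !mul0mx trmx0 mulmx0 !addr0 mul1mx trmx1 mulmx1 mxE eqxx; apply.
  apply/eqP => /matrixP/(_ 0 (lshift _ 0)).
  by rewrite row_mxEl !mxE eqxx => /eqP; rewrite oner_eq0.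
have pS : posdef (D - a^-1 *: (b *m b^T)).
  move=> y y0; have := pG (row_mx (- a^-1 *: (y *m b)) y : 'rV_(1 + k)).
  rewrite quad.
  have -> : - a^-1 *: (y *m b) *m a%:M *m (- a^-1 *: (y *m b))^T + y *m b *m (- a^-1 *: (y *m b))^T +
    - a^-1 *: (y *m b) *m b^T *m y^T + y *m D *m y^T = y *m (D - a^-1 *: (b *m b^T)) *m y^T.
    rewrite mulmxBr mulmxBl addrC; congr (_ + _).
    rewrite linearZ /= -!scalemxAl -!scalemxAr -!scalemxAl trmx_mul.
    rewrite mul_mx_scalar -!scalemxAl !mulmxA.
    rewrite !scalerA; set Z := _ *m y^T.
    rewrite -scaleNr -!scalerDl; congr (_ *: _).
    by field; rewrite gt_eqF.
  apply; apply: contraNneq y0 => /matrixP E.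
  by apply/eqP/matrixP => i j; rewrite (ord1 i); have := E 0 (rshift 1 j); rewrite row_mxEr mxE => ->; rewrite mxE.
have sS : (D - a^-1 *: (b *m b^T))^T = D - a^-1 *: (b *m b^T).
  by rewrite linearB /= linearZ /= trmx_mul trmxK ED.
have [N EN] := IH _ sS pS.
pose s := Num.sqrt a.
have s0 : s != 0 by rewrite sqrtr_eq0 -ltNge.
have ss : s * s = a by rewrite -expr2 sqr_sqrtr// ltW.
(* one step of elimination, followed by the normalisation of the first vector *)
exists (block_mx (s^-1)%:M 0 (- a^-1 *: (N *m b)) N : 'M[R]_(1 + k, 1 + k)).
have an0 : a != 0 by rewrite gt_eqF.
have E3 : - a^-1 *: (N *m b) *m a%:M + N *m b = 0.
  by rewrite mul_mx_scalar scalerA mulrN divff// scaleN1r addNr.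
rewrite EG mulmx_block (tr_block_mx (s^-1)%:M) mulmx_block.
rewrite [RHS](@scalar_mx_block _ 1 k); congr block_mx.
- rewrite !mul0mx trmx0 mulmx0 !addr0 mul_scalar_mx tr_scalar_mx mul_mx_scalar scale_scalar_mx scale_scalar_mx.
  by congr (_%:M); rewrite -ss; field.
- rewrite !mul0mx !addr0 linearZ /= trmx_mul mul_scalar_mx scale_scalar_mx mul_scalar_mx scalerA.
  rewrite mul_scalar_mx -scalemxAl -scalerDl; suff -> : s^-1 * a * - a^-1 + s^-1 = 0 by rewrite scale0r.
  by field; rewrite an0 s0.
- by rewrite E3 mul0mx trmx0 mulmx0 addr0.
- rewrite E3 mul0mx add0r -EN; congr (_ *m _).
  by rewrite mulmxBr addrC -scalemxAl -scalemxAr mulmxA scaleNr.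
Qed.

(** Gram-Schmidt, as induction on the size through the Schur
    complement. *)
Lemma posdef_orthonormalization k (G : 'M[R]_k) : G^T = G -> posdef G ->
  exists M : 'M[R]_k, M *m G *m M^T = 1%:M.
Proof.
elim: k G => [|k IH] G sG pG.
  by exists 0; apply/matrixP => -[].
exact: (posdef_orthonormalization_step IH sG pG).
Qed.

(** Here [A] is [diag d * G] and [M^T M] is the inverse of [G], so the
    trace is cyclically that of [diag d].  With [A] the Gram matrix of the
    Laplacians, this makes the sum of the squared norms of the recombined Laplacians
    equal to the eigenvalue sum, whichever orthonormalisation [M] is used. *)
Lemma trace_orthonormalized k (G A M : 'M[R]_k) (d : 'I_k -> R) :
  M *m G *m M^T = 1%:M -> (forall i j, A i j = d i * G i j) ->
  \tr (M *m A *m M^T) = \sum_i d i.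
Proof.
move=> MGM AG.
have -> : A = diag_mx (\row_i d i) *m G.
  by apply/matrixP => i j; rewrite AG mul_diag_mx !mxE.
rewrite -(mulmxA M) mxtrace_mulC -!mulmxA.
have -> : G *m (M^T *m M) = 1%:M by rewrite mulmxA; apply: mulmx1C; rewrite mulmxA.
by rewrite mulmx1 mxtrace_diag; apply: eq_bigr => i _; rewrite mxE.
Qed.

End gram_schmidt.

(** * Transforms of functions of H^2_0 *)

Section plate_functions.
Context {R : realType} {n : nat}.
Local Notation mu := (@lebesgue_rV R n).
Implicit Types (f g u w phi : 'rV[R]_n -> R) (x y z xi : 'rV[R]_n).
Variable Omega : set 'rV[R]_n.
Hypotheses (mO : measurable Omega) (Ooo : (mu Omega < +oo)%E).

Lemma restrict_out f x : ~ Omega x -> (f \_ Omega) x = 0.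
Proof. by move=> nx; rewrite patchE memNset. Qed.

Lemma restrict_in f x : Omega x -> (f \_ Omega) x = f x.
Proof. by move=> Ox; rewrite patchE mem_set. Qed.

Lemma L12_restrict f : L2 Omega f -> L12 (f \_ Omega).
Proof.
move=> [mf f2]; apply: (L12_supp mO Ooo); last by move=> x; exact: restrict_out.
have mr : measurable_fun setT (f \_ Omega) by apply/(measurable_restrictT _ mO).
split=> //; apply: ge0_integ.
- exact: measurable_funX.
- by move=> x; exact: sqr_ge0.
rewrite (_ : (fun x => _) = (fun x => (f x ^+ 2)%:E) \_ Omega); last first.
  apply/funext => x; rewrite !patchE.
  by case: ifPn => _ //; rewrite expr0n.
by rewrite -integral_mkcond.
Qed.

Lemma Rintegral_restrict f g :
  \int[mu]_(x in Omega) (f x * g x) = \int[mu]_x ((f \_ Omega) x * g x).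
Proof.
rewrite Rintegral_mkcond; apply: eq_Rintegral => x _; rewrite !patchE.
by case: ifPn => _ //; rewrite mul0r.
Qed.

Lemma Rintegral_restrict2 f g :
  \int[mu]_(x in Omega) (f x * g x) = \int[mu]_x ((f \_ Omega) x * (g \_ Omega) x).
Proof.
rewrite Rintegral_mkcond; apply: eq_Rintegral => x _; rewrite !patchE.
by case: ifPn => _ //; rewrite mul0r.
Qed.

Lemma cvg_sqr0 (s : nat -> R) : (fun k => s k ^+ 2) @ \oo --> (0 : R) -> s @ \oo --> (0 : R).
Proof.
move=> C; apply/norm_cvg0P.
have H : (fun k => Num.sqrt (s k ^+ 2)) @ \oo --> Num.sqrt (0 : R).
  by apply: continuous_cvg => //; exact: sqrt_continuous.
by rewrite sqrtr0 in H; under eq_fun do rewrite -sqrtr_sqr.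
Qed.

(** Cauchy-Schwarz on [Omega], which has finite measure: L^2 convergence
    implies convergence of integrals against bounded functions. *)
Lemma cvg_transform (fk : nat -> 'rV[R]_n -> R) f (c : 'rV[R]_n -> R) :
  (forall k, L12 (fk k)) -> L12 f ->
  (forall k x, ~ Omega x -> fk k x = 0) -> (forall x, ~ Omega x -> f x = 0) ->
  (fun k => \int[mu]_x ((fk k x - f x) ^+ 2)) @ \oo --> (0 : R) ->
  measurable_fun setT c -> (forall x, `|c x| <= 1) ->
  (fun k => \int[mu]_x (fk k x * c x)) @ \oo --> \int[mu]_x (f x * c x).
Proof.
move=> Lk Lf k0 f0 C mc c1.
apply/subr_cvg0; apply: cvg_sqr0.
have I1 := integ_indic mO Ooo.
have L1 : sqinteg mu (\1_Omega : 'rV[R]_n -> R).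
  split=> //; rewrite (_ : (fun _ => _) = (\1_Omega : 'rV[R]_n -> R))//.
  by apply/funext => x; rewrite indicE; case: (x \in Omega); rewrite ?expr1n ?expr0n.
set K := \int[mu]_x ((\1_Omega x : R) ^+ 2).
apply: (@squeeze_cvgr _ _ _ _ (fun=> 0) (fun k => \int[mu]_x ((fk k x - f x) ^+ 2) * K)).
- apply: nearW => k; rewrite sqr_ge0/=.
  have Ld := L12B (Lk k) Lf; have [_ sd] := Ld.
  have sdc := sqinteg_mulb sd mc c1.
  have -> : \int[mu]_x (fk k x * c x) - \int[mu]_x (f x * c x) =
      \int[mu]_x ((fk k x - f x) * c x * \1_Omega x).
    have J1 := integ_mulb (Lk k).1 mc c1; have J2 := integ_mulb Lf.1 mc c1.
    rewrite -(@RintegralB _ _ _ mu _ _ _ measurableT J1 J2).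
    apply: eq_Rintegral => x _; rewrite -mulrBl indicE.
    case: (boolP (x \in Omega)) => [_|/negP xO]; first by rewrite mulr1.
    by rewrite mulr0 k0 ?f0 ?subrr ?mul0r// => Ox; apply: xO; rewrite inE.
  rewrite (le_trans (cauchy_schwarz sdc L1))// ler_wpM2r//.
    by apply: Rintegral_ge0 => x _; exact: sqr_ge0.
  apply: (le_Rintegral measurableT sdc.2 sd.2) => x _.
  rewrite exprMn ler_piMr ?sqr_ge0//.
  by rewrite -real_normK ?num_real// expr_le1.
- exact: cvg_cst.
- by rewrite -(mul0r K); exact: cvgMr_tmp.
Qed.

Lemma cvg_L2_restrict (phi : nat -> 'rV[R]_n -> R) g :
  (forall k, L12 (phi k)) -> (forall k x, ~ Omega x -> phi k x = 0) -> L2 Omega g ->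
  (\int[mu]_(x in Omega) ((phi k x - g x) ^+ 2)%:E)%E @[k --> \oo] --> 0%E ->
  (fun k => \int[mu]_x ((phi k x - (g \_ Omega) x) ^+ 2)) @ \oo --> (0 : R).
Proof.
move=> Lk k0 Lg C; apply: (@fine_cvg _ _ _ _ _ 0).
suff <- : (fun k => \int[mu]_(x in Omega) ((phi k x - g x) ^+ 2)%:E)%E =
    (fun k => \int[mu]_x ((phi k x - (g \_ Omega) x) ^+ 2)%:E)%E by exact: C.
apply/funext => k; rewrite integral_mkcond.
apply: eq_integral => x _; rewrite !patchE.
case: (boolP (x \in Omega)) => [_|/negP xO] //.
by rewrite k0 ?subrr ?expr0n// => Ox; apply: xO; rewrite inE.
Qed.

Lemma transform_partial2 phi i xi : test_function Omega phi ->
  cosF (partials [:: i; i] phi) xi = - xi 0 i ^+ 2 * cosF phi xi /\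
  sinF (partials [:: i; i] phi) xi = - xi 0 i ^+ 2 * sinF phi xi.
Proof.
move=> Tphi; have Ti := test_function_partial i Tphi.
rewrite (transform_partial i xi Ti).1 (transform_partial i xi Ti).2.
rewrite (transform_partial i xi Tphi).1 (transform_partial i xi Tphi).2.
by split; ring.
Qed.

Definition freq2 xi : R := \sum_(i < n) xi 0 i ^+ 2.

(** The weak Laplacian is the sum of the pure second weak derivatives.  The
    formula for its transform holds for the test functions that converge to [u] in
    H^2, and passes to the limit for each frequency.  This is where the boundary
    conditions enter: extended by zero, [u] has no singular part on the
    boundary. *)
Lemma H20_fourier u : H20 Omega u -> exists w,
  [/\ weak_laplacian Omega u w, L12 (u \_ Omega), approximable (u \_ Omega),
      L12 (w \_ Omega) &
      forall xi, cosF (w \_ Omega) xi = - freq2 xi * cosF (u \_ Omega) xi /\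
                 sinF (w \_ Omega) xi = - freq2 xi * sinF (u \_ Omega) xi].
Proof.
move=> [[Lu ex] [phi [Tphi Cphi]]].
have /choice[g Hg] : forall i, exists g, weak_partials Omega [:: i; i] u g by move=> i; exact: ex.
have Hu : weak_partials Omega [::] u u.
  by split=> // psi _; rewrite /= expr0 mul1r.
have Lui := L12_restrict Lu.
have Lgi i : L12 (g i \_ Omega) by apply: L12_restrict; have [] := Hg i.
have nphi k := test_function_bcont (Tphi k).
have Lphi k : L12 (phi k) by have [] := nphi k.
have phi0 k x : ~ Omega x -> phi k x = 0 by exact: test_function_out (Tphi k).
have Tii k i : test_function Omega (partials [:: i; i] (phi k)).
  by apply: test_function_partial; exact: test_function_partial.
have Lii k i : L12 (partials [:: i; i] (phi k)) by have [] := test_function_bcont (Tii k i).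
have C0 := cvg_L2_restrict Lphi phi0 Lu (Cphi [::] u isT Hu).
have Ci i := cvg_L2_restrict (fun k => Lii k i)
  (fun k x => @test_function_out _ _ _ _ x (Tii k i)) (Hg i).1 (Cphi [:: i; i] (g i) isT (Hg i)).
pose w x := \sum_(i < n) g i x.
have wE x : (w \_ Omega) x = \sum_(i < n) (g i \_ Omega) x.
  have [Ox|nOx] := pselect (Omega x).
    by rewrite restrict_in//; apply: eq_bigr => i _; rewrite restrict_in.
  by rewrite restrict_out// big1// => i _; rewrite restrict_out.
have L2w : L2 Omega w.
  split; first by apply: measurable_sum => i; have [[]] := Hg i.
  have Ls : L12 (fun x => \sum_(i < n) (g i \_ Omega) x) by exact: L12_sum.
  have [_ [_ /integ_lty]] := Ls; apply: le_lt_trans.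
  rewrite [leLHS]integral_mkcond le_eqVlt; apply/orP; left; apply/eqP.
  apply: eq_integral => x _; rewrite patchE -wE patchE.
  by case: ifPn => _ //; rewrite expr0n.
have EGi i xi : cosF (g i \_ Omega) xi = - xi 0 i ^+ 2 * cosF (u \_ Omega) xi /\
                sinF (g i \_ Omega) xi = - xi 0 i ^+ 2 * sinF (u \_ Omega) xi.
  have key (c : 'rV[R]_n -> R) : measurable_fun setT c -> (forall x, `|c x| <= 1) ->
      (forall k, \int[mu]_x (partials [:: i; i] (phi k) x * c x) = - xi 0 i ^+ 2 * \int[mu]_x (phi k x * c x)) ->
      \int[mu]_x ((g i \_ Omega) x * c x) = - xi 0 i ^+ 2 * \int[mu]_x ((u \_ Omega) x * c x).
    move=> mc c1 E.
    have D1 := cvg_transform (fun k => Lii k i) (Lgi i)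
      (fun k x => @test_function_out _ _ _ _ x (Tii k i)) (fun x => @restrict_out (g i) x) (Ci i) mc c1.
    have D2 := cvg_transform Lphi Lui phi0 (fun x => @restrict_out u x) C0 mc c1.
    have D3 : (fun k => - xi 0 i ^+ 2 * \int[mu]_x (phi k x * c x)) @ \oo -->
        - xi 0 i ^+ 2 * \int[mu]_x ((u \_ Omega) x * c x) by exact: cvgMl_tmp.
    rewrite -(cvg_lim (@Rhausdorff R) D1) -(cvg_lim (@Rhausdorff R) D3).
    by congr (lim (_ @ \oo)); apply/funext => k; exact: E.
  split; apply: key.
  - exact: measurable_cos_dot.
  - by move=> x; exact: normr_cos_le1.
  - by move=> k; exact: (transform_partial2 i xi (Tphi k)).1.
  - exact: measurable_sin_dot.
  - by move=> x; exact: normr_sin_le1.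
  - by move=> k; exact: (transform_partial2 i xi (Tphi k)).2.
exists w; split=> //.
- split=> // psi Tpsi.
  have Lpsi i : L12 (partials [:: i; i] psi).
    by have [] := test_function_bcont (test_function_partial i (test_function_partial i Tpsi)).
  have [_ _ Lp] := test_function_bcont Tpsi.
  rewrite !Rintegral_restrict /laplacian.
  under eq_Rintegral do rewrite mulr_sumr.
  rewrite Rintegral_sum; last by move=> i; apply: sqinteg_mul; [exact: Lui.2|exact: (Lpsi i).2].
  under [RHS]eq_Rintegral do rewrite wE mulr_suml.
  rewrite Rintegral_sum; last by move=> i; apply: sqinteg_mul; [exact: (Lgi i).2|exact: Lp.2].
  apply: eq_bigr => i _.
  have [_ /(_ psi Tpsi)] := Hg i.
  by rewrite !Rintegral_restrict sqrrN expr1n mul1r.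
- by exists phi.
- by rewrite (funext wE); exact: L12_sum.
- move=> xi; rewrite (funext wE) cosF_sum; last by move=> i; exact: (Lgi i).1.
  rewrite sinF_sum; last by move=> i; exact: (Lgi i).1.
  rewrite /freq2 !mulNr !mulr_suml -!sumrN; split; apply: eq_bigr => i _.
    by rewrite (EGi i xi).1 mulNr.
  by rewrite (EGi i xi).2 mulNr.
Qed.

End plate_functions.

(** * An orthonormal system of eigenfunctions *)

Section spectral_system.
Context {R : realType} {n : nat}.
Local Notation mu := (@lebesgue_rV R n).
Implicit Types (f g u w phi : 'rV[R]_n -> R) (x y z xi : 'rV[R]_n).
Variable Omega : set 'rV[R]_n.
Hypotheses (mO : measurable Omega) (Ooo : (mu Omega < +oo)%E).

(** The indices [i] with [Gamma i = lambda] inject into a basis of the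
    eigenspace, so each of them can be given its own basis element. *)
Lemma clamped_multiplicity_family (lambda : R) (d : nat) (S : set nat) :
  clamped_multiplicity Omega lambda d -> (S #= `I_d)%card ->
  exists E : nat -> 'rV[R]_n -> R,
    (forall i, S i -> clamped_solution Omega lambda (E i)) /\
    forall (K : nat) (P : pred 'I_K) (c : 'I_K -> R), (forall i, P i -> S i) ->
      {ae mu, forall x, Omega x -> \sum_(i < K | P i) c i * E i x = 0} ->
      forall i, P i -> c i = 0.
Proof.
move=> [e [sol indep _]]; rewrite card_eq_le => /andP[/pcard_leP[F] _].
case: d e sol indep F => [|d] e sol indep F.
  have nS i : ~ S i by move=> Si; have /(_ i Si) : set_fun S `I_0 F by exact: funS.
  by exists (fun=> 0); split=> [i /nS//|K P c PS _ i /PS/nS].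
have Flt i : S i -> (F i < d.+1)%N by move=> Si; have /(_ i Si) : set_fun S `I_d.+1 F by exact: funS.
exists (fun i => e (inord (F i))); split; first by move=> i _; exact: sol.
move=> K P c PS ae0 i0 Pi0.
pose c' (l : 'I_d.+1) := \sum_(i < K | P i && (inord (F i) == l)) c i.
have E x : \sum_(i < K | P i) c i * e (inord (F i)) x = \sum_(l < d.+1) c' l * e l x.
  rewrite (partition_big (fun i : 'I_K => inord (F i) : 'I_d.+1) xpredT)//=.
  apply: eq_bigr => l _; rewrite /c' mulr_suml.
  by apply: eq_bigr => i /andP[_ /eqP ->].
have /(_ (inord (F i0))) : forall l, c' l = 0.
  by apply: indep; apply: filterS ae0 => x H Ox; rewrite -E H.
rewrite /c' (bigD1 i0) ?Pi0 ?eqxx//= big1 ?addr0// => i /andP[/andP[Pi /eqP Fi] ii0].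
case/negP: ii0; apply/eqP/val_inj.
have FF : F i = F i0.
  have := congr1 (@nat_of_ord _) Fi; rewrite !inordK//; apply: Flt; exact: PS.
have injF : {in S &, injective F} by exact: inj.
by apply: injF FF; rewrite inE; apply: PS.
Qed.

Lemma spectrum_family (Gamma : nat -> R) : clamped_spectrum Omega Gamma ->
  exists E : nat -> 'rV[R]_n -> R,
    (forall i, clamped_solution Omega (Gamma i) (E i)) /\
    forall (K : nat) (lambda : R) (c : 'I_K -> R),
      {ae mu, forall x, Omega x -> \sum_(i < K | Gamma i == lambda) c i * E i x = 0} ->
      forall i : 'I_K, Gamma i = lambda -> c i = 0.
Proof.
move=> [_ _ spec].
have /choice[E HE] : forall lambda, exists E : nat -> 'rV[R]_n -> R,
    (forall i, Gamma i = lambda -> clamped_solution Omega lambda (E i)) /\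
    forall (K : nat) (P : pred 'I_K) (c : 'I_K -> R), (forall i, P i -> Gamma i = lambda) ->
      {ae mu, forall x, Omega x -> \sum_(i < K | P i) c i * E i x = 0} ->
      forall i, P i -> c i = 0.
  move=> lambda; have [d [mult card]] := spec lambda.
  have [E [H1 H2]] := clamped_multiplicity_family mult card.
  by exists E; split => // K P c PS; exact: H2.
exists (fun i => E (Gamma i) i); split; first by move=> i; exact: (HE (Gamma i)).1.
move=> K lambda c ae0 i Gi.
apply: ((HE lambda).2 K (fun i => Gamma i == lambda) c _ _ i _); last exact/eqP.
  by move=> j /eqP.
apply: filterS ae0 => x H Ox; rewrite -[RHS](H Ox).
by apply: eq_bigr => j /eqP <-.
Qed.

Lemma integral_sqr0_ae f : sqinteg mu f -> \int[mu]_x (f x ^+ 2) = 0 ->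
  {ae mu, forall x, f x = 0}.
Proof.
move=> [mf f2] f0.
have := EFin_Rintegral f2; rewrite f0 => /esym I0.
have mE : measurable_fun setT (fun x => (f x ^+ 2)%:E : \bar R).
  by apply: measurable_EFin; exact: measurable_funX.
have /(ae_eq_integral_abs mu measurableT mE) : (\int[mu]_x `|(f x ^+ 2)%:E| = 0)%E.
  by apply: etrans I0; apply: eq_integral => x _; rewrite gee0_abs// lee_fin sqr_ge0.
apply: filterS => x /(_ I) [] /eqP; rewrite sqrf_eq0 => /eqP; exact.
Qed.

(** Testing the weak equation of one eigenfunction with another shows that
    the Gram matrix [A] of the Laplacians is [Gamma_i G_ij], where [G] is the Gram
    matrix of the eigenfunctions.  Symmetry of both makes different eigenvalues
    orthogonal, so linear independence inside each eigenspace suffices for [G] to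
    be positive definite, and [trace_orthonormalized] applies. *)
Lemma spectral_system (Gamma : nat -> R) (k : nat) : clamped_spectrum Omega Gamma ->
  exists v w : 'I_k -> 'rV[R]_n -> R,
  [/\ forall i, L12 (v i) /\ approximable (v i) /\ (forall x, ~ Omega x -> v i x = 0),
      forall i, L12 (w i),
      forall i xi, cosF (w i) xi = - freq2 xi * cosF (v i) xi /\
                   sinF (w i) xi = - freq2 xi * sinF (v i) xi,
      forall i j, \int[mu]_x (v i x * v j x) = (i == j)%:R &
      \sum_i \int[mu]_x (w i x ^+ 2) = \sum_(i < k) Gamma i].
Proof.
move=> /spectrum_family[E [solE indE]].
have /choice[W HW] : forall i, exists w,
  [/\ weak_laplacian Omega (E i) w, L12 (E i \_ Omega), approximable (E i \_ Omega),
      L12 (w \_ Omega) &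
      forall xi, cosF (w \_ Omega) xi = - freq2 xi * cosF (E i \_ Omega) xi /\
                 sinF (w \_ Omega) xi = - freq2 xi * sinF (E i \_ Omega) xi].
  by move=> i; have [H20E _] := solE i; exact: H20_fourier.
pose u (i : 'I_k) := E i \_ Omega; pose z (i : 'I_k) := W i \_ Omega.
have Lu i : L12 (u i) by have [] := HW i.
have Lz i : L12 (z i) by have [] := HW i.
pose G : 'M[R]_k := \matrix_(i, j) \int[mu]_x (u i x * u j x).
pose A : 'M[R]_k := \matrix_(i, j) \int[mu]_x (z i x * z j x).
have AG i j : A i j = Gamma i * G i j.
  rewrite !mxE -!Rintegral_restrict2.
  have [wi _ _ _ _] := HW i; have [wj _ _ _ _] := HW j.
  by have [_ H] := solE i; apply: (H _ _ _ _ wi wj); have [] := solE j.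
have Gsym i j : G i j = G j i.
  by rewrite !mxE; apply: eq_Rintegral => x _; rewrite mulrC.
have Asym i j : A i j = A j i.
  by rewrite !mxE; apply: eq_Rintegral => x _; rewrite mulrC.
have Gorth (i j : 'I_k) : Gamma i != Gamma j -> G i j = 0.
  move=> ne; have := Asym i j; rewrite !AG (Gsym j i) => /eqP.
  by rewrite -subr_eq0 -mulrBl mulf_eq0 subr_eq0 (negbTE ne) => /eqP.
have bil (h : 'I_k -> 'rV[R]_n -> R) (a b : 'I_k -> R) : (forall i, L12 (h i)) ->
    \int[mu]_x ((\sum_i a i * h i x) * (\sum_j b j * h j x)) =
    \sum_i \sum_j a i * b j * \int[mu]_x (h i x * h j x).
  move=> Lh; have Iu i j : integ mu (fun x => h i x * h j x).
    by apply: sqinteg_mul; [exact: (Lh i).2|exact: (Lh j).2].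
  have sumE x : (\sum_i a i * h i x) * (\sum_j b j * h j x) =
      \sum_i \sum_j (a i * b j) * (h i x * h j x).
    rewrite mulr_suml; apply: eq_bigr => i _; rewrite mulr_sumr; apply: eq_bigr => j _; ring.
  under eq_Rintegral do rewrite sumE.
  rewrite Rintegral_sum; last by move=> i; apply: integ_sum => j; exact: integZ.
  apply: eq_bigr => i _; rewrite Rintegral_sum; last by move=> j; exact: integZ.
  by apply: eq_bigr => j _; rewrite (@RintegralZl _ _ _ mu _ _ _ measurableT (Iu i j)).
have bilG a b : \int[mu]_x ((\sum_i a i * u i x) * (\sum_j b j * u j x)) =
    \sum_i \sum_j a i * b j * G i j.
  by rewrite bil//; apply: eq_bigr => i _; apply: eq_bigr => j _; rewrite mxE.
have bilA a b : \int[mu]_x ((\sum_i a i * z i x) * (\sum_j b j * z j x)) =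
    \sum_i \sum_j a i * b j * A i j.
  by rewrite bil//; apply: eq_bigr => i _; apply: eq_bigr => j _; rewrite mxE.
have mulmxE (N H : 'M[R]_k) i j : (N *m H *m N^T) i j = \sum_l \sum_m N i l * N j m * H l m.
  rewrite !mxE exchange_big /=; apply: eq_bigr => m _; rewrite !mxE mulr_suml.
  by apply: eq_bigr => l _; ring.
have pG : posdef G.
  move=> v v0.
  have -> : (v *m G *m v^T) 0 0 = \int[mu]_x ((\sum_i v 0 i * u i x) ^+ 2).
    under eq_Rintegral do rewrite expr2.
    rewrite bilG !mxE exchange_big /=; apply: eq_bigr => m _; rewrite !mxE mulr_suml.
    by apply: eq_bigr => l _; ring.
  have Lf (a : 'I_k -> R) : L12 (fun x => \sum_i a i * u i x) by apply: L12_sum => i; exact: L12Z.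
  rewrite lt_neqAle; apply/andP; split; last by apply: Rintegral_ge0 => x _; exact: sqr_ge0.
  apply: contraNneq v0 => /esym f0; apply/eqP/matrixP => i0 i; rewrite (ord1 i0) mxE => {i0}.
  (* A null vector of G stays one after restriction to the eigenspace of Gamma i. *)
  pose c (j : 'I_k) := if Gamma j == Gamma i then v 0 j else 0.
  have E1 : \int[mu]_x ((\sum_j c j * u j x) ^+ 2) =
            \int[mu]_x ((\sum_j c j * u j x) * (\sum_j v 0 j * u j x)).
    under eq_Rintegral do rewrite expr2.
    rewrite !bilG; apply: eq_bigr => j _; apply: eq_bigr => l _; rewrite /c.
    case: (eqVneq (Gamma j) (Gamma i)) => [ji|]; last by rewrite !mul0r.
    case: (eqVneq (Gamma l) (Gamma i)) => // li.
    by rewrite Gorth ?mulr0// ji eq_sym.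
  have E2 : \int[mu]_x ((\sum_j c j * u j x) ^+ 2) = 0.
    have := cauchy_schwarz (Lf c).2 (Lf (fun j => v 0 j)).2.
    rewrite f0 mulr0 -E1 => h; apply/eqP; rewrite -sqrf_eq0 eq_le h sqr_ge0//.
  have := integral_sqr0_ae (Lf c).2 E2 => H.
  apply: (indE k (Gamma i) (fun j => v 0 j) _ i erefl).
  apply: filterS H => x H Ox; rewrite -[RHS]H big_mkcond /=; apply: eq_bigr => j _.
  by rewrite /c /u restrict_in//; case: ifPn => // _; rewrite mul0r.
have sG : G^T = G by apply/matrixP => i j; rewrite mxE.
have [M EM] := posdef_orthonormalization sG pG.
exists (fun i x => \sum_j M i j * u j x), (fun i x => \sum_j M i j * z j x); split.
- move=> i; split; first by apply: L12_sum => j; exact: L12Z.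
  split; last by move=> x nx; rewrite big1// => j _; rewrite /u restrict_out ?mulr0.
  by apply: approximable_sum => j; [exact: L12Z|apply: approximableZ => //; have [] := HW j].
- by move=> i; apply: L12_sum => j; exact: L12Z.
- move=> i xi.
  rewrite cosF_sum; last by move=> j; apply: integZ; exact: (Lz j).1.
  rewrite cosF_sum; last by move=> j; apply: integZ; exact: (Lu j).1.
  rewrite sinF_sum; last by move=> j; apply: integZ; exact: (Lz j).1.
  rewrite sinF_sum; last by move=> j; apply: integZ; exact: (Lu j).1.
  rewrite !mulr_sumr; split; apply: eq_bigr => j _; have [_ _ _ _ /(_ xi)[e1 e2]] := HW j.
    by rewrite !cosFZ ?(Lz j).1 ?(Lu j).1// e1; ring.
  by rewrite !sinFZ ?(Lz j).1 ?(Lu j).1// e2; ring.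
- by move=> i j; rewrite bilG -mulmxE EM mxE.
- rewrite -(trace_orthonormalized EM AG) /mxtrace; apply: eq_bigr => i _.
  under eq_Rintegral do rewrite expr2.
  by rewrite bilA -mulmxE.
Qed.

End spectral_system.

(** * High frequencies of an indicator function *)

(** From [cos t = 1 - 2 sin^2 (t/2)] and [|sin s| <= |s|]. *)
Lemma cos_ge_half {R : realType} (t : R) : `|t| <= 1 -> 2^-1 <= cos t.
Proof.
move=> t1.
have sinle (s : R) : 0 <= s -> sin s <= s.
  rewrite le_eqVlt => /predU1P[<-|s0]; first by rewrite sin0.
  have [|c _] := @MVT R sin cos 0 s s0 (fun x _ => is_derive_sin x).
    by apply: continuous_subspaceT => x; exact: continuous_sin.
  by rewrite sin0 !subr0 => ->; rewrite ler_piMl ?cos_le1// ltW.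
have abs (s : R) : sin s ^+ 2 <= s ^+ 2.
  wlog s0 : s / 0 <= s.
    move=> H; case: (leP 0 s) => [/H//|s0].
    by have := H (- s); rewrite sinN !sqrrN; apply; rewrite oppr_ge0 ltW.
  have h := sinle s s0.
  have h2 : - s <= sin s.
    case: (leP s pi) => [sp|sp]; first by rewrite (le_trans _ (sin_ge0_pi _))// ?oppr_le0// s0.
    by rewrite (le_trans _ (sin_geN1 s))// lerN2 (le_trans _ (ltW sp))// (le_trans _ (pi_ge2 R))// ler1n.
  by rewrite -(real_normK (num_real (sin s))) lerXn2r ?nnegrE// ler_norml h2.
have e : cos t = 1 - 2 * sin (t / 2) ^+ 2.
  rewrite {1}(_ : t = t / 2 + t / 2); last by field.
  by rewrite cosD -!expr2 cos2sin2; ring.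
have := abs (t / 2); rewrite exprMn.
have : t ^+ 2 <= 1 by rewrite -real_normK ?num_real// expr_le1.
rewrite e; lra.
Qed.

Section translates.
Context {R : realType} {n : nat}.
Local Notation mu := (@lebesgue_rV R n).
Implicit Types (f g u w phi : 'rV[R]_n -> R) (x y z xi v : 'rV[R]_n).

Lemma L12_translate f v : L12 f -> L12 (fun x => f (x + v)).
Proof.
move=> [I1 [m2 I2]]; have J1 := (integ_translate v I1).1.
split=> //; split; first exact: integ_measurable J1.
exact: (integ_translate v I2).1.
Qed.

Lemma bcont_translate f v : bcont f -> bcont (fun x => f (x + v)).
Proof.
move=> [cf [M fM] Lf]; split; last exact: L12_translate.
- move=> x; apply: (@cvg_comp _ _ _ (fun x => x + v) f _ (nbhs (x + v))); last exact: cf.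
  have : continuous (fun y : 'rV[R]_n => y + v); last exact.
  by move=> y; apply: continuousD; [move=> ?; exact|exact: cst_continuous].
- by exists M.
Qed.

Lemma approximable_translate f v : L12 f -> approximable f -> approximable (fun x => f (x + v)).
Proof.
move=> Lf [fk [Nk Ck]]; exists (fun k x => fk k (x + v)); split.
  by move=> k; exact: bcont_translate.
suff -> : (fun k => \int[mu]_x ((fk k (x + v) - f (x + v)) ^+ 2)) =
    (fun k => \int[mu]_x ((fk k x - f x) ^+ 2)) by [].
apply/funext => k; have [_ _ Lk] := Nk k; have [_ [_ d2]] := L12B Lk Lf.
exact: (integ_translate v d2).2.
Qed.

(** The multiplier [|e^{i xi.v} - 1|^2] is [2 (1 - cos (xi.v))]. *)
Lemma powF_difference f v xi : L12 f ->
  powF (fun x => f (x + v) - f x) xi = 2 * (1 - cos (dot xi v)) * powF f xi.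
Proof.
move=> Lf; have [Lt [e1 e2]] := translate_transform xi v Lf.
have E : (fun x => f (x + v) - f x) = (fun x => f (x + v) + -1 * f x).
  by apply/funext => x; rewrite mulN1r.
rewrite E /powF cosFD; [|exact: Lt.1|exact: integZ Lf.1].
rewrite sinFD; [|exact: Lt.1|exact: integZ Lf.1].
rewrite cosFZ; [|exact: Lf.1]; rewrite sinFZ; [|exact: Lf.1].
rewrite e1 e2; have := cos2Dsin2 (dot xi v).
move: (cos _) (sin _) (cosF _ _) (sinF _ _) => C S c s CS.
apply/eqP; rewrite -subr_eq0; apply/eqP.
transitivity ((C ^+ 2 + S ^+ 2 - 1) * (c ^+ 2 + s ^+ 2)); first by ring.
by rewrite CS subrr mul0r.
Qed.

Lemma open_mu_gt0 (A : set 'rV[R]_n) : open A -> A !=set0 -> (0 < mu A)%E.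
Proof.
move=> oA [x Ax].
have : nbhs x A by move: oA; rewrite openE => /(_ _ Ax).
rewrite -nbhs_ballE => -[e /= e0 xeA].
pose B := box (fun i : 'I_n => `]x 0 i - e, x 0 i + e[%classic).
have mB : measurable B by apply: measurable_box => i; exact: measurable_itv.
have BA : B `<=` A.
  move=> y By; apply: xeA; split=> // i j; rewrite (ord1 i).
  have := By j; rewrite /= in_itv /= => /andP[h1 h2].
  by rewrite /ball /= ltr_norml ltrBlDr ltrBrDr; apply/andP; split; lra.
apply: (@lt_le_trans _ _ (mu B)); last by apply: le_measure => //; rewrite inE//; exact: open_measurable_rV.
rewrite /B lebesgue_rV_box; last by move=> i; exact: measurable_itv.
have H i : lebesgue_measure `]x 0 i - e, x 0 i + e[%classic = (2 * e)%:E.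
  rewrite lebesgue_measure_itv/= lte_fin ifT; last by lra.
  by rewrite -EFinD; congr EFin; ring.
under eq_bigr do rewrite H.
by rewrite prod_EFin lte_fin prodr_gt0// => i _; rewrite mulr_gt0.
Qed.

End translates.

Section indicator_domain.
Context {R : realType} {n : nat}.
Local Notation mu := (@lebesgue_rV R n).
Implicit Types (f g u w phi : 'rV[R]_n -> R) (x y z xi v : 'rV[R]_n).
Variables (Omega : set 'rV[R]_n) (a : R) (i0 : 'I_n).
Hypotheses (oO : open Omega) (a0 : 0 < a) (Oa : Omega `<=` cube a).

Let mO : measurable Omega. Proof. exact: open_measurable_rV. Qed.

Lemma domain_lty : (mu Omega < +oo)%E.
Proof.
apply: le_lt_trans (cube_lty a); apply: le_measure => //; rewrite inE//.
exact: measurable_cube.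
Qed.

Definition ind : 'rV[R]_n -> R := \1_Omega.

Lemma ind01 x : 0 <= ind x <= 1.
Proof. by rewrite /ind indicE; case: (x \in Omega); rewrite ?ler01 ?lexx. Qed.

Lemma ind_sqr x : ind x ^+ 2 = ind x.
Proof. by rewrite /ind indicE; case: (x \in Omega); rewrite ?expr1n ?expr0n. Qed.

Lemma ind_cases x : ind x = 0 \/ ind x = 1.
Proof. by rewrite /ind indicE; case: (x \in Omega); [right|left]. Qed.

Lemma ind_out x : ~ Omega x -> ind x = 0.
Proof. by move=> nx; rewrite /ind indicE memNset. Qed.

Lemma ind_in x : Omega x -> ind x = 1.
Proof. by move=> nx; rewrite /ind indicE mem_set. Qed.

Lemma L12_ind : L12 ind.
Proof.
apply: (L12_bounded (M := 1) mO domain_lty); first exact: measurable_indic.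
  by move=> x; have /andP[h1 h2] := ind01 x; rewrite ger0_norm.
exact: ind_out.
Qed.

Lemma Rintegral_ind : \int[mu]_x ind x = fine (mu Omega).
Proof. by rewrite /Rintegral integral_indic// setIT. Qed.

Let outside : exists y, ~ Omega y.
Proof.
exists (const_mx (a + 1)) => /Oa/cubeP/(_ i0); rewrite mxE ger0_norm ?addr_ge0 ?(ltW a0)//.
by rewrite gerDl leNgt ltr01.
Qed.

(** The truncations of [k] times this distance are continuous and increase
    to the indicator of [Omega]. *)
Definition dist_out x : R := inf [set `|x - y| | y in ~` Omega].

Lemma dist_out_lb x : has_lbound [set `|x - y| | y in ~` Omega].
Proof. by exists 0 => _ [y _ <-]. Qed.

Lemma dist_out_ne x : [set `|x - y| | y in ~` Omega] !=set0.
Proof. by have [y ny] := outside; exists `|x - y|, y. Qed.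

Lemma dist_out_ge0 x : 0 <= dist_out x.
Proof. by apply: lb_le_inf; [exact: dist_out_ne|move=> _ [y _ <-]]. Qed.

Lemma dist_out_out x : ~ Omega x -> dist_out x = 0.
Proof.
move=> nx; apply/eqP; rewrite eq_le dist_out_ge0 andbT.
apply: ge_inf; first exact: dist_out_lb.
by exists x => //; rewrite subrr normr0.
Qed.

Lemma dist_out_gt0 x : Omega x -> 0 < dist_out x.
Proof.
move=> Ox.
have : nbhs x Omega by move: oO; rewrite openE => /(_ _ Ox).
rewrite -nbhs_ballE => -[e /= e0 xe].
apply: (lt_le_trans e0); apply: lb_le_inf; first exact: dist_out_ne.
move=> _ [y ny <-]; rewrite leNgt; apply/negP => xye; apply: ny; apply: xe.
by rewrite -ball_normE.
Qed.

Lemma dist_out_lip x y : dist_out x <= `|x - y| + dist_out y.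
Proof.
rewrite -lerBlDl; apply: lb_le_inf; first exact: dist_out_ne.
move=> _ [z nz <-]; rewrite lerBlDl.
apply: (@le_trans _ _ `|x - z|); first by apply: ge_inf; [exact: dist_out_lb|exists z].
by rewrite (_ : x - z = (x - y) + (y - z)) ?ler_normD// addrA subrK.
Qed.

Lemma dist_out_continuous : continuous dist_out.
Proof.
move=> x A /nbhs_ballP[e /= e0 eA]; apply/nbhs_ballP; exists e => //= y.
rewrite -ball_normE /= => xy; apply: eA; rewrite /ball /= ltr_norml; apply/andP; split.
  by have := dist_out_lip y x; rewrite distrC => ?; lra.
by have := dist_out_lip x y; lra.
Qed.

Lemma approximable_ind : approximable ind.
Proof.
pose fk (k : nat) x : R := Num.min 1 (k%:R * dist_out x).
have fk0 k x : ~ Omega x -> fk k x = 0 by move=> nx; rewrite /fk dist_out_out// mulr0 min_r.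
have fk1 k x : 0 <= fk k x <= 1.
  by rewrite /fk le_min ler01 mulr_ge0 ?dist_out_ge0//= ge_min lexx.
have cfk k : continuous (fk k).
  move=> x; apply: (@continuous_min R _ (fun=> 1) (fun x => k%:R * dist_out x)); first exact: cst_continuous.
  by apply: cvgMl_tmp; [exact: (@nbhs_filter _ x)|exact: (@dist_out_continuous x)].
have Nk k : bcont (fk k).
  split=> //.
    by exists 1 => x; have /andP[h1 h2] := fk1 k x; rewrite ger0_norm.
  apply: (L12_bounded (M := 1) mO domain_lty); last exact: fk0.
    by apply: continuous_measurable_rV.
  by move=> x; have /andP[h1 h2] := fk1 k x; rewrite ger0_norm.
exists fk; split=> //.
have -> : (0 : R) = \int[mu]_x (fun=> 0 : R) x by rewrite Rintegral_cst// mul0r.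
apply: (Rintegral_dominated_cvg _ _ _ L12_ind.1 _).2.
- by move=> k; have [_ _ L] := Nk k; have [_ [_ d2]] := L12B L L12_ind; exact: (integ_measurable d2).
- exact: measurable_cst.
- move=> x; have [Ox|nOx] := pselect (Omega x); last first.
    by under eq_fun do rewrite fk0// ind_out// subrr expr0n/=; exact: cvg_cst.
  apply: cvg_near_cst; near=> k.
  have : (dist_out x)^-1 <= k%:R by near: k; exact: nbhs_infty_ger.
  rewrite -[X in X <= _]mul1r ler_pdivrMr ?dist_out_gt0// => h.
  by rewrite /fk min_l// ind_in// subrr expr0n.
- move=> k x; have [Ox|nOx] := pselect (Omega x); last first.
    by rewrite fk0// ind_out// subrr expr0n normr0.
  rewrite ind_in// ger0_norm ?sqr_ge0//; have /andP[h1 h2] := fk1 k x; nra.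
Unshelve. all: by end_near. Qed.

Local Notation ei := (delta_mx 0 i0 : 'rV[R]_n).
Local Notation V := (fine (mu Omega)).

(** The squared L^2 modulus of continuity of the indicator in the direction of
    coordinate [i0]. *)
Definition jump (h : R) : R := \int[mu]_x ((ind (x + h *: ei) - ind x) ^+ 2).

Lemma jump_integ h : integ mu (fun x => (ind (x + h *: ei) - ind x) ^+ 2).
Proof. by have [_ []] := L12B (L12_translate (h *: ei) L12_ind) L12_ind. Qed.

Lemma plancherel_jump h :
  \int[mu]_xi (2 * (1 - cos (h * xi 0 i0)) * powF ind xi) = (2 * pi) ^+ n * jump h.
Proof.
have L1 := L12_translate (h *: ei) L12_ind.
have E : (fun x => ind (x + h *: ei) - ind x) = (fun x => ind (x + h *: ei) + -1 * ind x).
  by apply/funext => x; rewrite mulN1r.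
rewrite /jump -plancherel; [|exact: L12B L1 L12_ind|].
  by apply: eq_Rintegral => xi _; rewrite powF_difference ?dotZr ?dot_ei//; exact: L12_ind.
rewrite E; apply: approximableD => //; first by apply: L12Z; exact: L12_ind.
  by apply: approximable_translate; [exact: L12_ind|exact: approximable_ind].
by apply: approximableZ; [exact: L12_ind|exact: approximable_ind].
Qed.

Lemma jump_ge0 h : 0 <= jump h.
Proof. by apply: Rintegral_ge0 => x _; exact: sqr_ge0. Qed.

(** Subadditive, unlike the square of a general L^2 modulus of continuity,
    because [ind] takes only the values 0 and 1: squares of differences are then
    their absolute values. *)
Lemma jumpD h1 h2 : jump (h1 + h2) <= jump h1 + jump h2.
Proof.
have [J1 EJ] := integ_translate (h2 *: ei) (jump_integ h1).
rewrite -[jump h1]EJ /jump.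
rewrite -(@RintegralD _ _ _ mu _ _ _ measurableT J1 (jump_integ h2)).
apply: (le_Rintegral measurableT (jump_integ _) (integD J1 (jump_integ h2))) => x _.
rewrite -addrA -scalerDl (addrC h2).
case: (ind_cases (x + (h1 + h2) *: ei)) (ind_cases (x + h2 *: ei)) (ind_cases x)
  => -> [] -> [] ->; lra.
Qed.

Lemma jump_muln h (M : nat) : jump (M%:R * h) <= M%:R * jump h.
Proof.
elim: M => [|M IH].
  rewrite !mul0r /jump; under eq_Rintegral do rewrite scale0r addr0 subrr expr0n/=.
  by rewrite Rintegral_cst// mul0r.
rewrite -natr1 !mulrDl !mul1r (le_trans (jumpD _ _))// lerD2r; exact: IH.
Qed.

(** Beyond the width [2 a], the domain and its translate are disjoint. *)
Lemma jump_far h : 2 * a < h -> jump h = 2 * V.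
Proof.
move=> h2a.
have E x : (ind (x + h *: ei) - ind x) ^+ 2 = ind (x + h *: ei) + ind x.
  have [Ox|nOx] := pselect (Omega x); last by rewrite (ind_out nOx) subr0 addr0 ind_sqr.
  rewrite (@ind_out (x + h *: ei)) ?sub0r ?add0r ?sqrrN ?ind_sqr//.
  move=> /Oa/cubeP/(_ i0); have /cubeP/(_ i0) := Oa Ox.
  rewrite !mxE !eqxx mulr1 !ler_norml => /andP[h1 h3] /andP[h4 h5]; lra.
rewrite /jump; under eq_Rintegral do rewrite E.
have [J1 J2] := integ_translate (h *: ei) L12_ind.1.
rewrite (@RintegralD _ _ _ mu _ _ _ measurableT J1 L12_ind.1) J2 Rintegral_ind; ring.
Qed.

(** About [2 a / h] steps of size [h] carry [Omega] off itself, so by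
    subadditivity each of them accounts for a proportional share of [2 V]. *)
Lemma jump_ge h : 0 < h -> 2 * V * h / (2 * a + h) <= jump h.
Proof.
move=> h0.
pose M := (Num.truncn (2 * a / h)).+1.
have M1 : 2 * a / h < M%:R by exact: truncnS_gt.
have M2 : M%:R <= 2 * a / h + 1.
  rewrite /M -natr1 lerD2r; have := truncn_le (2 * a / h).
  by move=> ->; rewrite divr_ge0 ?mulr_ge0 ?(ltW a0) ?(ltW h0).
have V0 : 0 <= V by rewrite fine_ge0.
have j1 : jump (M%:R * h) = 2 * V by apply: jump_far; rewrite -ltr_pdivrMr.
have := jump_muln h M; rewrite j1 => H.
have D0 : 0 < 2 * a + h by rewrite addr_gt0// mulr_gt0.
rewrite ler_pdivrMr//.
apply: (@le_trans _ _ (M%:R * jump h * h)); first by rewrite ler_wpM2r// ltW.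
rewrite mulrAC mulrC ler_wpM2l ?jump_ge0//.
by rewrite -ler_pdivlMr// mulrDl divff ?gt_eqF.
Qed.

Definition high (r : R) xi : R := if r <= `|xi 0 i0| then 1 else 0.

Lemma measurable_high r : measurable_fun setT (high r).
Proof.
apply: measurable_fun_ifT => //; apply: measurable_fun_ler => //.
apply: measurableT_comp => //; exact: measurable_coord_rV.
Qed.

Lemma high01 r xi : 0 <= high r xi <= 1.
Proof. by rewrite /high; case: ifP => _; rewrite ?lexx ?ler01. Qed.

Lemma integ_high_powF r f : L12 f -> integ mu (fun xi => powF f xi * high r xi).
Proof.
move=> Lf; apply: (integ_mulb (bessel_fourier Lf.1 Lf.2).1 (measurable_high r)).
by move=> xi; have /andP[h1 h2] := high01 r xi; rewrite ger0_norm.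
Qed.

(** With [C] the cosine of [h xi_1], Plancherel turns the three terms of
    [3 * 2 (1 - C) <= 2 (1 - C2) + 12 * 1_{high}], where [C2 = 2 C^2 - 1] is the
    cosine of the doubled angle, into [3 jump h], [jump (2 h) <= 2 jump h] and the
    power at high frequencies.  Where [|h xi_1| < 1] one has [C >= 1/2],
    and the inequality holds without the last term; elsewhere the last term is at least the left-hand side. *)
Lemma high_frequency_tail h : 0 < h ->
  (2 * pi) ^+ n * jump h / 12 <= \int[mu]_xi (powF ind xi * high h^-1 xi).
Proof.
move=> h0.
have [Ip _] := bessel_fourier L12_ind.1 L12_ind.2.
have Ih := integ_high_powF h^-1 L12_ind.
have Ic (t : R) : integ mu (fun xi => 2 * (1 - cos (t * xi 0 i0)) * powF ind xi).
  under eq_fun do rewrite mulrC.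
  apply: (integ_mul_bounded Ip (M := 4)).
    apply: measurable_funM => //; apply: measurable_funB => //.
    apply: (measurableT_comp measurable_cosR); apply: measurable_funM => //.
    exact: measurable_coord_rV.
  move=> xi; have := cos_geN1 (t * xi 0 i0); have := cos_le1 (t * xi 0 i0) => h1 h2.
  rewrite ger0_norm; lra.
have c0 : 0 <= (2 * pi : R) ^+ n by rewrite exprn_ge0// mulr_ge0// pi_ge0.
have H : 3 * \int[mu]_xi (2 * (1 - cos (h * xi 0 i0)) * powF ind xi) <=
   \int[mu]_xi (2 * (1 - cos ((2 * h) * xi 0 i0)) * powF ind xi) +
   12 * \int[mu]_xi (powF ind xi * high h^-1 xi).
  rewrite -(@RintegralZl _ _ _ mu _ _ 3 measurableT (Ic h)).
  rewrite -(@RintegralZl _ _ _ mu _ _ 12 measurableT Ih).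
  have J1 := integZ 3 (Ic h); have J2 := integZ 12 Ih.
  rewrite -(@RintegralD _ _ _ mu _ _ _ measurableT (Ic (2 * h)) J2).
  apply: (le_Rintegral measurableT J1 (integD (Ic (2 * h)) J2)) => xi _.
  have -> : cos (2 * h * xi 0 i0) = 2 * cos (h * xi 0 i0) ^+ 2 - 1.
    by rewrite -mulrA [2 * _]mulr_natl cos_mulr2n mulr_natl.
  have := powF_ge0 ind xi; have := cos_geN1 (h * xi 0 i0); have := cos_le1 (h * xi 0 i0).
  have : `|h * xi 0 i0| < 1 -> 2^-1 <= cos (h * xi 0 i0).
    by move=> /ltW; exact: cos_ge_half.
  rewrite normrM gtr0_norm// -ltr_pdivlMl// mulr1 /high.
  move: (cos _) (powF _ _) => C p; case: (leP h^-1 _) => [_ _|_ /(_ isT) hC] C1 C2 p0; rewrite -subr_ge0.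
    rewrite (_ : _ - _ = p * ((1 + C) * (10 - 4 * C))); last by ring.
    by rewrite !mulr_ge0//; lra.
  rewrite (_ : _ - _ = p * ((1 - C) * (4 * C - 2))); last by ring.
  by rewrite !mulr_ge0//; lra.
rewrite !plancherel_jump in H.
have H2 : jump (2 * h) <= 2 * jump h by have := jump_muln h 2.
have H3 := ler_wpM2l c0 H2.
(* 3 j <= 2 j + 12 T, up to the factor (2 pi)^n *)
rewrite ler_pdivrMr//; move: H H3.
move: (\int[mu]_xi (powF ind xi * high h^-1 xi)) (jump h) (jump (2 * h)) ((2 * pi) ^+ n) => T j j2 c.
lra.
Qed.

End indicator_domain.

(** * Volume and fourth moment of balls *)

Lemma cvg_rsum {R : realType} (T : Type) (F : set_system T) (FF : Filter F)
  (I : Type) (s : seq I) (f : I -> T -> R) (l : I -> R) :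
  (forall i, f i x @[x --> F] --> l i) ->
  (\sum_(i <- s) f i x) @[x --> F] --> \sum_(i <- s) l i.
Proof.
move=> H; elim: s => [|i s IH].
  by rewrite big_nil; under eq_fun do rewrite big_nil; exact: cvg_cst.
by rewrite big_cons; under eq_fun do rewrite big_cons; exact: cvgD.
Qed.

Section ball_volume.
Context {R : realType} {n : nat}.
Local Notation mu := (@lebesgue_rV R n).
Implicit Types (x y z xi : 'rV[R]_n) (r : R).

Definition low r xi : R := if freq2 xi < r ^+ 2 then 1 else 0.

Definition ball_volume : R := fine (mu (@unit_ball R n)).

Lemma freq2_ge0 xi : 0 <= freq2 xi.
Proof. by apply: sumr_ge0 => i _; exact: sqr_ge0. Qed.

Lemma freq2_coord xi i : xi 0 i ^+ 2 <= freq2 xi.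
Proof.
by rewrite /freq2 (bigD1 i)//= lerDl sumr_ge0// => j _; exact: sqr_ge0.
Qed.

Lemma measurable_freq2 : measurable_fun setT (@freq2 R n).
Proof.
by apply: measurable_sum => i; apply: measurable_funX; exact: measurable_coord_rV.
Qed.

Lemma measurable_low r : measurable_fun setT (low r).
Proof.
by apply: measurable_fun_ifT => //; apply: measurable_fun_ltr => //; exact: measurable_freq2.
Qed.

Lemma low01 r xi : 0 <= low r xi <= 1.
Proof. by rewrite /low; case: ifP => _; rewrite ?lexx ?ler01. Qed.

Lemma normr_low r xi : `|low r xi| <= 1.
Proof. by have /andP[h1 h2] := low01 r xi; rewrite ger0_norm. Qed.

Lemma low_cube r xi : 0 <= r -> ~ cube r xi -> low r xi = 0.
Proof.
move=> r0 nc; rewrite /low ifN// -leNgt; apply/negPn/negP; rewrite -ltNge => h.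
apply: nc; apply/cubeP => i; have := le_lt_trans (freq2_coord xi i) h.
rewrite -(real_normK (num_real (xi 0 i))) => h2; rewrite leNgt; apply/negP => hr.
by move: h2; rewrite ltNge lerXn2r ?nnegrE// ltW.
Qed.

Lemma L12_low r : 0 <= r -> L12 (low r).
Proof.
move=> r0; apply: (L12_bounded (measurable_cube r) (cube_lty r) (measurable_low r) (normr_low r)).
by move=> xi; exact: low_cube.
Qed.

Lemma lowE xi : low 1 xi = \1_(@unit_ball R n) xi.
Proof.
rewrite /low indicE expr1n; case: ifPn => h; first by rewrite mem_set.
by rewrite memNset//; apply/negP.
Qed.

Lemma open_unit_ball : open (@unit_ball R n).
Proof.
have -> : @unit_ball R n = @freq2 R n @^-1` [set t | t < 1] by [].
apply: open_comp; last exact: open_lt.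
move=> x _; apply: (@cvg_rsum R _ _ (nbhs_filter x)) => i; rewrite expr2.
under eq_fun do rewrite expr2.
by apply: cvgM; exact: coord_continuous.
Qed.

Lemma Rintegral_low1 : \int[mu]_xi low 1 xi = ball_volume.
Proof.
under eq_Rintegral do rewrite lowE.
by rewrite /Rintegral integral_indic ?setIT//; exact: open_measurable_rV open_unit_ball.
Qed.

Lemma ball_volume_gt0 : 0 < ball_volume.
Proof.
rewrite /ball_volume fine_gt0//; apply/andP; split.
  apply: open_mu_gt0; first exact: open_unit_ball.
  by exists 0; rewrite /unit_ball /= big1// => i _; rewrite mxE expr0n.
apply: le_lt_trans (cube_lty 1); apply: le_measure; rewrite ?inE.
- exact: open_measurable_rV open_unit_ball.
- exact: measurable_cube.
move=> x xB; apply: contrapT => nc; have := low_cube ler01 nc.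
by rewrite lowE indicE mem_set// => /eqP; rewrite oner_eq0.
Qed.

Lemma low_scale r xi : 0 < r -> low r (r *: xi + 0) = low 1 xi.
Proof.
move=> r0; rewrite /low addr0 expr1n.
have -> : freq2 (r *: xi) = r ^+ 2 * freq2 xi.
  by rewrite /freq2 mulr_sumr; apply: eq_bigr => i _; rewrite mxE exprMn.
by rewrite -[X in _ < X]mulr1 ltr_pM2l ?exprn_gt0.
Qed.

Lemma freq2_scale r xi : freq2 (r *: xi + 0) = r ^+ 2 * freq2 xi.
Proof.
by rewrite addr0 /freq2 mulr_sumr; apply: eq_bigr => i _; rewrite mxE exprMn.
Qed.

Lemma Rintegral_low r : 0 < r -> \int[mu]_xi low r xi = r ^+ n * ball_volume.
Proof.
move=> r0; have [_ ->] := integral_affine_rV 0 r0 (L12_low (ltW r0)).1.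
by congr (_ * _); rewrite -Rintegral_low1; apply: eq_Rintegral => xi _; rewrite low_scale.
Qed.

Lemma integ_freq_low r : 0 <= r -> integ mu (fun xi => low r xi * freq2 xi ^+ 2).
Proof.
move=> r0; apply: (@le_integ _ _ _ _ _ (fun xi => (r ^+ 2) ^+ 2 * low r xi)).
- by apply: measurable_funM; [exact: measurable_low|apply: measurable_funX; exact: measurable_freq2].
- move=> xi; rewrite /low; case: ifPn => [h|_]; last by rewrite mul0r mulr0 normr0.
  by rewrite mul1r mulr1 ger0_norm ?sqr_ge0// lerXn2r ?nnegrE ?sqr_ge0 ?freq2_ge0// ltW.
- by apply: integZ; exact: (L12_low r0).1.
Qed.

Definition ball_moment : R := \int[mu]_xi (low 1 xi * freq2 xi ^+ 2).

Lemma Rintegral_freq_low r : 0 < r ->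
  \int[mu]_xi (low r xi * freq2 xi ^+ 2) = r ^+ (n + 4) * ball_moment.
Proof.
move=> r0; have [_ ->] := integral_affine_rV 0 r0 (integ_freq_low (ltW r0)).
rewrite exprD -mulrA; congr (_ * _).
rewrite -(@RintegralZl _ _ _ mu _ _ (r ^+ 4) measurableT (integ_freq_low ler01)).
by apply: eq_Rintegral => xi _; rewrite low_scale// freq2_scale; ring.
Qed.

Lemma low_le r xi : 0 <= r <= 1 -> low r xi <= low 1 xi.
Proof.
move=> /andP[r0 r1]; rewrite /low; case: ifPn => [h|_].
  by rewrite ifT// (lt_le_trans h)// expr1n expr_le1.
by case: ifP.
Qed.

(** On the shell [r <= |xi| < 1] the factor [|xi|^4] lies between [r^4] and
    1.  By homogeneity the mass and the moment of the shell are [1 - r^n] and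
    [1 - r^(n + 4)] times those of the ball, and [1 - r] is cancelled. *)
Lemma shell_bounds r : 0 < r < 1 ->
  r ^+ 4 * (\sum_(i < n) r ^+ i) * ball_volume <= (\sum_(i < n + 4) r ^+ i) * ball_moment
  <= (\sum_(i < n) r ^+ i) * ball_volume.
Proof.
move=> /andP[r0 r1].
have I1 := (L12_low (@ler01 R)).1; have Ir := (L12_low (ltW r0)).1.
have J1 := integ_freq_low (@ler01 R); have Jr := integ_freq_low (ltW r0).
have e1 : \int[mu]_xi (low 1 xi - low r xi) = (1 - r ^+ n) * ball_volume.
  rewrite (@RintegralB _ _ _ mu _ _ _ measurableT I1 Ir) Rintegral_low1 Rintegral_low//; ring.
have e2 : \int[mu]_xi (low 1 xi * freq2 xi ^+ 2 - low r xi * freq2 xi ^+ 2) = (1 - r ^+ (n + 4)) * ball_moment.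
  rewrite (@RintegralB _ _ _ mu _ _ _ measurableT J1 Jr) (Rintegral_freq_low r0) -/ball_moment; ring.
have K1 := integB I1 Ir; have K2 := integB J1 Jr.
have h1 : r ^+ 4 * ((1 - r ^+ n) * ball_volume) <= (1 - r ^+ (n + 4)) * ball_moment.
  rewrite -e1 -e2 -(@RintegralZl _ _ _ mu _ _ (r ^+ 4) measurableT K1).
  apply: (le_Rintegral measurableT (integZ (r ^+ 4) K1) K2) => xi _.
  rewrite -mulrBl mulrC.
  have := @low_le r xi; rewrite (ltW r0) (ltW r1) => /(_ isT) h.
  case: (ltP (freq2 xi) (r ^+ 2)) => fr.
    have l1 : low r xi = 1 by rewrite /low fr.
    have /andP[_ l2] := low01 1 xi.
    have -> : low 1 xi - low r xi = 0 by apply/eqP; rewrite subr_eq0 eq_le h l1 l2.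
    by rewrite !mul0r.
  rewrite ler_wpM2l ?subr_ge0// (_ : r ^+ 4 = (r ^+ 2) ^+ 2); last by rewrite -exprM.
  by rewrite lerXn2r ?nnegrE ?sqr_ge0 ?freq2_ge0.
have h2 : (1 - r ^+ (n + 4)) * ball_moment <= (1 - r ^+ n) * ball_volume.
  rewrite -e1 -e2; apply: (le_Rintegral measurableT K2 K1) => xi _.
  have := @low_le r xi; rewrite (ltW r0) (ltW r1) => /(_ isT) h.
  rewrite -mulrBl; case: (ltP (freq2 xi) 1) => fr.
    by rewrite ler_piMr ?subr_ge0// expr_le1// ?freq2_ge0// ltW.
  have l1 : low 1 xi = 0 by rewrite /low expr1n ltNge fr.
  have l2 : low r xi = 0 by apply/eqP; rewrite eq_le -{1}l1 h; have /andP[] := low01 r xi.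
  by rewrite l1 l2 subrr mul0r.
have geo m : 1 - r ^+ m = (1 - r) * \sum_(i < m) r ^+ i by rewrite -opprB subrX1 -mulNr opprB.
rewrite !geo in h1 h2.
have r1' : 0 < 1 - r by rewrite subr_gt0.
apply/andP; split.
  rewrite -(ler_pM2l r1') [leRHS]mulrA; apply: le_trans h1.
  by rewrite le_eqVlt; apply/orP; left; apply/eqP; ring.
by rewrite -(ler_pM2l r1') !mulrA.
Qed.

(** Let [r] tend to 1 in [shell_bounds]: the geometric sums tend to [n] and
    [n + 4].  This computes the moment without polar coordinates. *)
Lemma ball_momentE : (n%:R + 4) * ball_moment = n%:R * ball_volume.
Proof.
pose r (k : nat) : R := 1 - k.+2%:R^-1.
have r01 k : 0 < r k < 1.
  rewrite /r subr_gt0 invf_lt1// ltr1n/= gtrBl invr_gt0//.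
have Cr : r @ \oo --> (1 : R).
  have H : (fun k => k.+2%:R^-1 : R) @ \oo --> (0 : R).
    by have := @cvg_harmonic R; rewrite -cvg_shiftS.
  rewrite -[X in _ --> X]subr0; apply: cvgB; [exact: cvg_cst|exact: H].
have Cp m : (fun k => r k ^+ m) @ \oo --> (1 : R).
  rewrite -(expr1n _ m); apply: (@cvg_comp _ _ _ r (fun t => t ^+ m) _ (nbhs (1 : R)) _ Cr).
  exact: exprn_continuous.
have Cs m : (fun k => \sum_(i < m) r k ^+ i) @ \oo --> (m%:R : R).
  rewrite (_ : m%:R = \sum_(i < m) (1 : R)); last by rewrite sumr_const card_ord.
  by apply: cvg_rsum => i; exact: Cp.
have A1 : (fun k => r k ^+ 4 * (\sum_(i < n) r k ^+ i) * ball_volume) @ \oo --> 1 * n%:R * ball_volume.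
  by apply: cvgM; [apply: cvgM; [exact: Cp|exact: Cs]|exact: cvg_cst].
have A2 : (fun k => (\sum_(i < n + 4) r k ^+ i) * ball_moment) @ \oo --> (n + 4)%:R * ball_moment.
  by apply: cvgM; [exact: Cs|exact: cvg_cst].
have A3 : (fun k => (\sum_(i < n) r k ^+ i) * ball_volume) @ \oo --> n%:R * ball_volume.
  by apply: cvgM; [exact: Cs|exact: cvg_cst].
rewrite mul1r in A1; rewrite -[X in n%:R + X]/(4%:R) -natrD.
apply/eqP; rewrite eq_le; apply/andP; split.
- apply: (ler_cvg_to A2 A3); apply: nearW => k.
  by have /andP[] := shell_bounds (r01 k).
- apply: (ler_cvg_to A1 A2); apply: nearW => k.
  by have /andP[] := shell_bounds (r01 k).
Qed.

End ball_volume.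

(** * The spectral density and its defect *)

Section orthonormal_systems.
Context {R : realType} {n : nat}.
Local Notation mu := (@lebesgue_rV R n).
Implicit Types (f g p : 'rV[R]_n -> R) (x y z xi eta : 'rV[R]_n).
Variables (k : nat) (v : 'I_k -> 'rV[R]_n -> R).
Hypotheses (Lv : forall i, L12 (v i))
  (ov : forall i j, \int[mu]_x (v i x * v j x) = (i == j)%:R).

Definition comb (a : 'I_k -> R) x := \sum_i a i * v i x.

Lemma L12_comb a : L12 (comb a).
Proof. by apply: L12_sum => i; exact: L12Z. Qed.

Lemma Rintegral_comb p a : L12 p ->
  \int[mu]_x (p x * comb a x) = \sum_i a i * \int[mu]_x (p x * v i x).
Proof.
move=> Lp; have I i : integ mu (fun x => p x * v i x) by exact: sqinteg_mul Lp.2 (Lv i).2.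
have E x : p x * comb a x = \sum_i a i * (p x * v i x).
  by rewrite mulr_sumr; apply: eq_bigr => i _; rewrite mulrCA.
under eq_Rintegral do rewrite E.
rewrite Rintegral_sum; last by move=> i; exact: integZ.
by apply: eq_bigr => i _; rewrite (@RintegralZl _ _ _ mu _ _ (a i) measurableT (I i)).
Qed.

Lemma norm_comb a : \int[mu]_x (comb a x ^+ 2) = \sum_i a i ^+ 2.
Proof.
under eq_Rintegral do rewrite expr2.
rewrite Rintegral_comb; last exact: L12_comb.
apply: eq_bigr => i _; rewrite expr2; congr (_ * _).
under eq_Rintegral do rewrite mulrC.
rewrite Rintegral_comb// (bigD1 i)//= ov eqxx mulr1 big1 ?addr0// => j ji.
by rewrite ov eq_sym (negbTE ji) mulr0.
Qed.

(** Pythagoras: [comb a] is the orthogonal projection of [p]. *)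
Lemma bessel_identity p (a : 'I_k -> R) : L12 p ->
  (forall i, \int[mu]_x (p x * v i x) = a i) ->
  \int[mu]_x ((p x - comb a x) ^+ 2) = \int[mu]_x (p x ^+ 2) - \sum_i a i ^+ 2.
Proof.
move=> Lp pa; have La := L12_comb a.
have E x : (p x - comb a x) ^+ 2 = p x ^+ 2 + comb a x ^+ 2 + -2 * (p x * comb a x) by ring.
under eq_Rintegral do rewrite E.
have J1 := Lp.2.2; have J2 := La.2.2; have J3 := integZ (-2) (sqinteg_mul Lp.2 La.2).
rewrite (@RintegralD _ _ _ mu _ _ _ measurableT (integD J1 J2) J3).
rewrite (@RintegralD _ _ _ mu _ _ _ measurableT J1 J2) norm_comb.
rewrite (@RintegralZl _ _ _ mu _ _ (-2) measurableT (sqinteg_mul Lp.2 La.2)).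
rewrite Rintegral_comb// [X in _ * X](_ : _ = \sum_i a i ^+ 2); last first.
  by apply: eq_bigr => i _; rewrite expr2 pa.
by ring.
Qed.

(** At frequency [xi] this is also the squared norm of the projection, onto the
    span of the [v i], of the plane wave cut off by [Omega]. *)
Definition density xi := \sum_i powF (v i) xi.

Lemma density_ge0 xi : 0 <= density xi.
Proof. by apply: sumr_ge0 => i _; exact: powF_ge0. Qed.

Lemma integ_density : integ mu density.
Proof. by apply: integ_sum => i; exact: (bessel_fourier (Lv i).1 (Lv i).2).1. Qed.

Variables (Omega : set 'rV[R]_n) (a : R) (i0 : 'I_n).
Hypotheses (oO : open Omega) (a0 : 0 < a) (Oa : Omega `<=` cube a)
  (v0 : forall i x, ~ Omega x -> v i x = 0).

Local Notation V := (fine (mu Omega)).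
Let Lind : L12 (ind Omega). Proof. exact: L12_ind oO Oa. Qed.

Definition wave_cos xi x := ind Omega x * cos (dot xi x).
Definition wave_sin xi x := ind Omega x * sin (dot xi x).

Lemma L12_wave_cos xi : L12 (wave_cos xi).
Proof.
split; first exact: integ_cos Lind.1.
by apply: (sqinteg_mulb Lind.2 (measurable_cos_dot xi)) => x; exact: normr_cos_le1.
Qed.

Lemma L12_wave_sin xi : L12 (wave_sin xi).
Proof.
split; first exact: integ_sin Lind.1.
by apply: (sqinteg_mulb Lind.2 (measurable_sin_dot xi)) => x; exact: normr_sin_le1.
Qed.

Lemma wave_cos_coef xi i : \int[mu]_x (wave_cos xi x * v i x) = cosF (v i) xi.
Proof.
apply: eq_Rintegral => x _; have [Ox|nOx] := pselect (Omega x).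
  by rewrite /wave_cos ind_in// mul1r mulrC.
by rewrite v0// mulr0 mul0r.
Qed.

Lemma wave_sin_coef xi i : \int[mu]_x (wave_sin xi x * v i x) = sinF (v i) xi.
Proof.
apply: eq_Rintegral => x _; have [Ox|nOx] := pselect (Omega x).
  by rewrite /wave_sin ind_in// mul1r mulrC.
by rewrite v0// mulr0 mul0r.
Qed.

(** The component orthogonal to the span. *)
Definition rest_cos xi x := wave_cos xi x - comb (fun i => cosF (v i) xi) x.
Definition rest_sin xi x := wave_sin xi x - comb (fun i => sinF (v i) xi) x.

(** The two waves together have squared norm [V], since
    [cos^2 + sin^2 = 1], and [bessel_identity] subtracts the projections. *)
Lemma density_defect xi :
  \int[mu]_x (rest_cos xi x ^+ 2) + \int[mu]_x (rest_sin xi x ^+ 2) = V - density xi.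
Proof.
have Lc := L12_wave_cos xi; have Ls := L12_wave_sin xi.
rewrite (bessel_identity Lc (wave_cos_coef xi)) (bessel_identity Ls (wave_sin_coef xi)).
rewrite addrACA -opprD /density /powF big_split; congr (_ - _).
rewrite -(@RintegralD _ _ _ mu _ _ _ measurableT Lc.2.2 Ls.2.2) -Rintegral_ind; last exact: oO.
apply: eq_Rintegral => x _.
by rewrite /wave_cos /wave_sin !exprMn -mulrDr cos2Dsin2 mulr1 ind_sqr.
Qed.

Lemma density_le xi : density xi <= V.
Proof.
rewrite -subr_ge0 -density_defect addr_ge0//.
  by apply: Rintegral_ge0 => x _; exact: sqr_ge0.
by apply: Rintegral_ge0 => x _; exact: sqr_ge0.
Qed.

(** Modulation shifts frequencies: the real waves carry half of the power of
    the indicator at each of the shifts [xi] and [- xi]. *)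
Lemma powF_wave xi eta : powF (wave_cos xi) eta + powF (wave_sin xi) eta =
  2^-1 * (powF (ind Omega) (eta + xi) + powF (ind Omega) (eta - xi)).
Proof.
have Lc := L12_wave_cos xi; have Ls := L12_wave_sin xi.
have I1 := integ_cos eta Lc.1; have I2 := integ_sin eta Lc.1.
have I3 := integ_cos eta Ls.1; have I4 := integ_sin eta Ls.1.
have dN x : dot (- xi) x = - dot xi x by rewrite -scaleN1r dotZl mulN1r.
have e1 : cosF (ind Omega) (eta + xi) = cosF (wave_cos xi) eta - sinF (wave_sin xi) eta.
  rewrite {2}/cosF {1}/sinF -(@RintegralB _ _ _ mu _ _ _ measurableT I1 I4).
  by apply: eq_Rintegral => x _; rewrite dotDl cosD /wave_cos /wave_sin; ring.
have e2 : cosF (ind Omega) (eta - xi) = cosF (wave_cos xi) eta + sinF (wave_sin xi) eta.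
  rewrite {2}/cosF {1}/sinF -(@RintegralD _ _ _ mu _ _ _ measurableT I1 I4).
  by apply: eq_Rintegral => x _; rewrite dotDl dN cosB /wave_cos /wave_sin; ring.
have e3 : sinF (ind Omega) (eta + xi) = sinF (wave_cos xi) eta + cosF (wave_sin xi) eta.
  rewrite {2}/sinF {1}/cosF -(@RintegralD _ _ _ mu _ _ _ measurableT I2 I3).
  by apply: eq_Rintegral => x _; rewrite dotDl sinD /wave_cos /wave_sin; ring.
have e4 : sinF (ind Omega) (eta - xi) = sinF (wave_cos xi) eta - cosF (wave_sin xi) eta.
  rewrite {2}/sinF {1}/cosF -(@RintegralB _ _ _ mu _ _ _ measurableT I2 I3).
  by apply: eq_Rintegral => x _; rewrite dotDl dN sinB /wave_cos /wave_sin; ring.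
by rewrite /powF e1 e2 e3 e4; field.
Qed.

Definition high_power (r : R) : R := \int[mu]_xi (powF (ind Omega) xi * high i0 r xi).

(** A shift by at most [r / 2] sends [5 r / 2 <= |eta_1|] into
    [2 r <= |eta_1|]. *)
Lemma high_power_translate (r : R) xi : 0 < r -> `|xi 0 i0| <= r / 2 ->
  integ mu (fun eta => powF (ind Omega) (eta + xi) * high i0 (2 * r) eta) /\
  high_power (5 / 2 * r) <= \int[mu]_eta (powF (ind Omega) (eta + xi) * high i0 (2 * r) eta).
Proof.
move=> r0 xir.
have Ip := (bessel_fourier Lind.1 Lind.2).1.
have I1 : integ mu (fun eta => powF (ind Omega) eta * high i0 (2 * r) (eta - xi)).
  apply: (integ_mulb Ip).
    have := @measurable_affine_rV R n 1 (- xi) => /(measurableT_comp (measurable_high i0 (2 * r))).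
    by under eq_fun do rewrite /= scale1r.
  by move=> x; have /andP[h1 h2] := high01 i0 (2 * r) (x - xi); rewrite ger0_norm.
have [J1 E1] := integ_translate xi I1.
have EJ : (fun eta => powF (ind Omega) (eta + xi) * high i0 (2 * r) (eta + xi - xi)) =
    (fun eta => powF (ind Omega) (eta + xi) * high i0 (2 * r) eta).
  by apply/funext => eta; rewrite addrK.
rewrite EJ in J1 E1; rewrite E1; split; first exact: J1.
apply: (le_Rintegral measurableT (integ_high_powF i0 _ Lind) I1) => eta _.
rewrite ler_wpM2l ?powF_ge0// /high; case: ifPn => h; last by case: ifP.
rewrite ifT// !mxE; have := ler_normD (eta 0 i0 - xi 0 i0) (xi 0 i0).
rewrite subrK => h2; lra.
Qed.

(** The power at [eta] of the projected plane wave of frequency [xi]. *)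
Definition projpow xi eta : R := powF (comb (fun i => cosF (v i) xi)) eta + powF (comb (fun i => sinF (v i) xi)) eta.

Lemma projpow_ge0 xi eta : 0 <= projpow xi eta.
Proof. by rewrite addr_ge0 ?powF_ge0. Qed.

Lemma cosF_comb c eta : cosF (comb c) eta = \sum_i c i * cosF (v i) eta.
Proof.
rewrite /comb cosF_sum; last by move=> i; exact: integZ (Lv i).1.
by apply: eq_bigr => i _; rewrite cosFZ//; exact: (Lv i).1.
Qed.

Lemma sinF_comb c eta : sinF (comb c) eta = \sum_i c i * sinF (v i) eta.
Proof.
rewrite /comb sinF_sum; last by move=> i; exact: integZ (Lv i).1.
by apply: eq_bigr => i _; rewrite sinFZ//; exact: (Lv i).1.
Qed.

Lemma projpowE xi eta : projpow xi eta =
  (\sum_i cosF (v i) xi * cosF (v i) eta) ^+ 2 + (\sum_i cosF (v i) xi * sinF (v i) eta) ^+ 2 +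
  ((\sum_i sinF (v i) xi * cosF (v i) eta) ^+ 2 + (\sum_i sinF (v i) xi * sinF (v i) eta) ^+ 2).
Proof. by rewrite /projpow /powF !cosF_comb !sinF_comb. Qed.

(** Both arguments enter through transforms of the same [v i].  This
    symmetry is what allows the projected low waves to be charged to the density
    at high frequencies. *)
Lemma projpow_sym xi eta : projpow xi eta = projpow eta xi.
Proof.
rewrite !projpowE addrACA.
by congr (_ + _ + (_ + _)); congr (_ ^+ 2); apply: eq_bigr => i _; rewrite mulrC.
Qed.

(** Bessel's inequality in [eta]; the projected wave has squared norm
    [density xi]. *)
Lemma projpow_integ xi : integ mu (projpow xi) /\ \int[mu]_eta projpow xi eta <= (2 * pi) ^+ n * density xi.
Proof.
have L1 := L12_comb (fun i => cosF (v i) xi); have L2 := L12_comb (fun i => sinF (v i) xi).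
have [I1 B1] := bessel_fourier L1.1 L1.2; have [I2 B2] := bessel_fourier L2.1 L2.2.
split; first exact: (integD I1 I2).
rewrite /projpow (@RintegralD _ _ _ mu _ _ _ measurableT I1 I2) (le_trans (lerD B1 B2))//.
by rewrite !norm_comb -mulrDr /density /powF big_split.
Qed.

Lemma measurable_projpow : measurable_fun setT (fun z : 'rV[R]_n * 'rV[R]_n => projpow z.1 z.2).
Proof.
have mc i : measurable_fun setT (cosF (v i)) by apply: measurable_cosF; exact: (Lv i).1.
have ms i : measurable_fun setT (sinF (v i)) by apply: measurable_sinF; exact: (Lv i).1.
under eq_fun do rewrite projpowE.
have H (f g : 'I_k -> 'rV[R]_n -> R) : (forall i, measurable_fun setT (f i)) ->
    (forall i, measurable_fun setT (g i)) ->
    measurable_fun setT (fun z : 'rV[R]_n * 'rV[R]_n => (\sum_i f i z.1 * g i z.2) ^+ 2).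
  move=> mf mg; apply: measurable_funX; apply: measurable_sum => i.
  by apply: measurable_funM; [exact: measurable_fst_comp|exact: measurable_snd_comp].
by apply: measurable_funD; apply: measurable_funD;
  [exact: (H _ _ mc mc)|exact: (H _ _ mc ms)|exact: (H _ _ ms mc)|exact: (H _ _ ms ms)].
Qed.

(** Integrate over the low [xi] first: by symmetry and
    [projpow_integ] this leaves at most [(2 pi)^n] times the density at the high [eta]. *)
Lemma projpow_low_high (r : R) : 0 < r ->
  integ mu (fun xi => low (r / 2) xi * \int[mu]_eta (high i0 (2 * r) eta * projpow xi eta)) /\
  \int[mu]_xi (low (r / 2) xi * \int[mu]_eta (high i0 (2 * r) eta * projpow xi eta)) <=
  (2 * pi) ^+ n * \int[mu]_eta (high i0 (2 * r) eta * density eta).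
Proof.
move=> r0.
have mh := measurable_high i0 (2 * r); have ml := @measurable_low R n (r / 2).
have h01 eta : `|high i0 (2 * r) eta| <= 1 by have /andP[h1 h2] := high01 i0 (2 * r) eta; rewrite ger0_norm.
have hg0 eta : 0 <= high i0 (2 * r) eta by have /andP[] := high01 i0 (2 * r) eta.
have lg0 xi : 0 <= low (r / 2) xi by have /andP[] := low01 (r / 2) xi.
have lg1 xi : low (r / 2) xi <= 1 by have /andP[] := low01 (r / 2) xi.
have IhK xi : integ mu (fun eta => high i0 (2 * r) eta * projpow xi eta).
  by under eq_fun do rewrite mulrC; exact: integ_mulb (projpow_integ xi).1 mh h01.
have Ihd : integ mu (fun eta => high i0 (2 * r) eta * density eta).
  by under eq_fun do rewrite mulrC; exact: integ_mulb integ_density mh h01.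
pose F xi eta := low (r / 2) xi * (high i0 (2 * r) eta * projpow xi eta).
have F0 xi eta : 0 <= F xi eta by rewrite !mulr_ge0 ?projpow_ge0.
have I2 xi : integ mu (F xi) by exact: integZ.
have I1 eta : integ mu (F ^~ eta).
  rewrite /F; under eq_fun do rewrite mulrCA projpow_sym.
  apply: integZ; under eq_fun do rewrite mulrC.
  exact: integ_mulb (projpow_integ eta).1 ml (@normr_low R n _).
have bnd eta : \int[mu]_xi F xi eta <= high i0 (2 * r) eta * ((2 * pi) ^+ n * density eta).
  have [J1 J2] := projpow_integ eta.
  apply: (@le_trans _ _ (high i0 (2 * r) eta * \int[mu]_xi projpow eta xi)); last by rewrite ler_wpM2l.
  rewrite -(@RintegralZl _ _ _ mu _ _ (high i0 (2 * r) eta) measurableT J1).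
  apply: (le_Rintegral measurableT (I1 eta) (integZ _ J1)) => xi _.
  by rewrite /F mulrCA ler_wpM2l// projpow_sym ler_piMl ?projpow_ge0.
have mF : measurable_fun setT (fun z : 'rV[R]_n * 'rV[R]_n => F z.1 z.2).
  apply: measurable_funM; first exact: measurable_fst_comp.
  by apply: measurable_funM; [exact: measurable_snd_comp|exact: measurable_projpow].
have IF : integ (mu \x mu)%E (fun w : 'rV[R]_n * 'rV[R]_n => F w.1 w.2).
  apply: integ_prod_swapped => //.
  apply: (@le_lt_trans _ _ (\int[mu]_eta ((2 * pi) ^+ n * (high i0 (2 * r) eta * density eta))%:E)%E).
    apply: ge0_le_integral => //.
    - by move=> eta _; apply: integral_ge0 => xi _; rewrite lee_fin.
    - apply: (measurable_fun_fubini_tonelli_G (fun w : 'rV[R]_n * 'rV[R]_n => `|F w.1 w.2|%:E)) => //.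
      by apply: measurable_EFin; exact: measurableT_comp.
    - by apply: measurable_EFin; exact: integ_measurable (integZ _ Ihd).
    - move=> eta _ /=; under eq_integral do rewrite ger0_norm//.
      by rewrite -EFin_Rintegral// lee_fin mulrCA.
  by rewrite -EFin_Rintegral ?ltry//; exact: integZ.
have [J1 J2] := Rintegral_swap IF I2 I1.
have EF xi : \int[mu]_eta F xi eta = low (r / 2) xi * \int[mu]_eta (high i0 (2 * r) eta * projpow xi eta).
  by rewrite -(@RintegralZl _ _ _ mu _ _ (low (r / 2) xi) measurableT (IhK xi)).
have EFf := funext EF; rewrite EFf in J1; rewrite EFf in J2; split; first exact: J1.
rewrite J2.
rewrite -(@RintegralZl _ _ _ mu _ _ ((2 * pi) ^+ n) measurableT Ihd).
have J3 := integZ ((2 * pi) ^+ n) Ihd.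
have J4 : integ mu (fun eta => \int[mu]_xi F xi eta).
  apply: (le_integ _ _ J3); last first.
    move=> eta; rewrite ger0_norm; first by rewrite mulrCA.
    by apply: Rintegral_ge0 => xi _.
  apply/measurable_EFinP.
  rewrite (_ : EFin \o _ = fubini_G mu (fun w : 'rV[R]_n * 'rV[R]_n => (F w.1 w.2)%:E)).
    apply: measurable_fun_fubini_tonelli_G => //; first exact: measurable_EFin.
    by move=> w; rewrite lee_fin.
  by apply/funext => eta /=; rewrite EFin_Rintegral.
by apply: (le_Rintegral measurableT J4 J3) => eta _; rewrite mulrCA.
Qed.

(** The wave of frequency [xi] is its projection plus a rest.  At high
    frequencies the wave carries at least [high_power (5 r / 2)] by [powF_wave], the
    projection carries [projpow], and the rest at most
    [(2 pi)^n (V - density xi)]; the power of a sum costs a factor 2. *)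
Lemma high_power_le (r : R) xi : 0 < r -> low (r / 2) xi = 1 ->
  high_power (5 / 2 * r) <= 2 * \int[mu]_eta (high i0 (2 * r) eta * projpow xi eta) +
    2 * (2 * pi) ^+ n * (V - density xi).
Proof.
move=> r0 lxi.
have close (t A B b q1 q2 D : R) : 2^-1 * (A + B) <= 2 * b + 2 * (q1 + q2) ->
  q1 + q2 <= D -> t <= A -> t <= B -> t <= 2 * b + 2 * D by move=> *; lra.
have xir (s : R) : s = 1 \/ s = -1 -> `|(s *: xi) 0 i0| <= r / 2.
  move=> s1; have : ~ ~ cube (r / 2) xi.
    by move=> nc; move: lxi; rewrite low_cube// ?divr_ge0 ?(ltW r0)// => /eqP; rewrite eq_sym oner_eq0.
  by move/contrapT/cubeP/(_ i0); rewrite mxE normrM; case: s1 => ->; rewrite ?normrN normr1 mul1r.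
have [Ia Ta] : integ mu (fun eta => powF (ind Omega) (eta + xi) * high i0 (2 * r) eta) /\
  high_power (5 / 2 * r) <= \int[mu]_eta (powF (ind Omega) (eta + xi) * high i0 (2 * r) eta).
  by apply: high_power_translate => //; rewrite -[xi]scale1r; apply: xir; left.
have [Ib Tb] : integ mu (fun eta => powF (ind Omega) (eta - xi) * high i0 (2 * r) eta) /\
  high_power (5 / 2 * r) <= \int[mu]_eta (powF (ind Omega) (eta - xi) * high i0 (2 * r) eta).
  by apply: high_power_translate => //; rewrite -scaleN1r; apply: xir; right.
have Lc := L12_wave_cos xi; have Ls := L12_wave_sin xi.
pose cc := comb (fun i => cosF (v i) xi); pose cs := comb (fun i => sinF (v i) xi).
have Lcc : L12 cc := L12_comb _; have Lcs : L12 cs := L12_comb _.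
have Lrc : L12 (rest_cos xi) := L12B Lc Lcc; have Lrs : L12 (rest_sin xi) := L12B Ls Lcs.
have [Irc Brc] := bessel_fourier Lrc.1 Lrc.2; have [Irs Brs] := bessel_fourier Lrs.1 Lrs.2.
have mh := measurable_high i0 (2 * r).
have h01 eta : `|high i0 (2 * r) eta| <= 1 by have /andP[h1 h2] := high01 i0 (2 * r) eta; rewrite ger0_norm.
have hg0 eta : 0 <= high i0 (2 * r) eta by have /andP[] := high01 i0 (2 * r) eta.
have hl1 eta : high i0 (2 * r) eta <= 1 by have /andP[] := high01 i0 (2 * r) eta.
have IhK : integ mu (fun eta => high i0 (2 * r) eta * projpow xi eta).
  by under eq_fun do rewrite mulrC; exact: integ_mulb (projpow_integ xi).1 mh h01.
have step : \int[mu]_eta (2^-1 * (powF (ind Omega) (eta + xi) * high i0 (2 * r) eta +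
     powF (ind Omega) (eta - xi) * high i0 (2 * r) eta)) <=
   \int[mu]_eta (2 * (high i0 (2 * r) eta * projpow xi eta) + 2 * (powF (rest_cos xi) eta + powF (rest_sin xi) eta)).
  have JL := integZ 2^-1 (integD Ia Ib).
  have JR := integD (integZ 2 IhK) (integZ 2 (integD Irc Irs)).
  apply: (le_Rintegral measurableT JL JR) => eta _.
  rewrite -mulrDl mulrA -powF_wave.
  have e1 : wave_cos xi = (fun x => cc x + rest_cos xi x) by apply/funext => x; rewrite /rest_cos addrC subrK.
  have e2 : wave_sin xi = (fun x => cs x + rest_sin xi x) by apply/funext => x; rewrite /rest_sin addrC subrK.
  have y1 := powF_young eta ltr01 Lcc.1 Lrc.1; have y2 := powF_young eta ltr01 Lcs.1 Lrs.1.
  rewrite -e1 invr1 in y1; rewrite -e2 invr1 in y2.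
  have := hg0 eta; have := hl1 eta; have := projpow_ge0 xi eta.
  have := powF_ge0 (rest_cos xi) eta; have := powF_ge0 (rest_sin xi) eta.
  rewrite /projpow -/cc -/cs.
  have := powF_ge0 (wave_cos xi) eta; have := powF_ge0 (wave_sin xi) eta.
  move: (high _ _ _) (powF cc _) (powF cs _) (powF (rest_cos _) _) (powF (rest_sin _) _)
    (powF (wave_cos _) _) (powF (wave_sin _) _) y1 y2.
  clear => h p1 p2 q1 q2 w1 w2 y1 y2 w20 w10 q20 q10 k0 h1 h0.
  have : (w1 + w2) * h <= (2 * (p1 + p2) + 2 * (q1 + q2)) * h by rewrite ler_wpM2r//; lra.
  have : (2 * (q1 + q2)) * h <= 2 * (q1 + q2) by rewrite ler_piMr// mulr_ge0// addr_ge0.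
  lra.
rewrite (@RintegralZl _ _ _ mu _ _ 2^-1 measurableT (integD Ia Ib)) in step.
rewrite (@RintegralD _ _ _ mu _ _ _ measurableT Ia Ib) in step.
rewrite (@RintegralD _ _ _ mu _ _ _ measurableT (integZ 2 IhK) (integZ 2 (integD Irc Irs))) in step.
rewrite (@RintegralZl _ _ _ mu _ _ 2 measurableT IhK) in step.
rewrite (@RintegralZl _ _ _ mu _ _ 2 measurableT (integD Irc Irs)) in step.
rewrite (@RintegralD _ _ _ mu _ _ _ measurableT Irc Irs) in step.
have BB := lerD Brc Brs; rewrite -mulrDr density_defect in BB.
by rewrite -[X in _ + X]mulrA; exact: close step BB Ta Tb.
Qed.

(** Average [high_power_le] over the ball of radius [r / 2]. *)
Lemma spectral_defect (r : R) : 0 < r ->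
  (r / 2) ^+ n * @ball_volume R n * high_power (5 / 2 * r) <=
  2 * (2 * pi) ^+ n * (\int[mu]_eta (high i0 (2 * r) eta * density eta) +
                       \int[mu]_xi (low (r / 2) xi * (V - density xi))).
Proof.
move=> r0; have r20 : 0 < r / 2 by rewrite divr_gt0.
have [J1 J2] := projpow_low_high r0.
have Il := (@L12_low R n _ (ltW r20)).1.
have Id : integ mu (fun xi => low (r / 2) xi * (V - density xi)).
  have E xi : low (r / 2) xi * (V - density xi) = V * low (r / 2) xi - density xi * low (r / 2) xi by ring.
  under eq_fun do rewrite E.
  apply: integB; first exact: integZ.
  exact: integ_mulb integ_density (@measurable_low R n _) (@normr_low R n _).
have JR := integD (integZ 2 J1) (integZ (2 * (2 * pi) ^+ n) Id).
have JL := integZ (high_power (5 / 2 * r)) Il.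
have H : \int[mu]_xi (high_power (5 / 2 * r) * low (r / 2) xi) <=
   \int[mu]_xi (2 * (low (r / 2) xi * \int[mu]_eta (high i0 (2 * r) eta * projpow xi eta)) +
     2 * (2 * pi) ^+ n * (low (r / 2) xi * (V - density xi))).
  apply: (le_Rintegral measurableT JL JR) => xi _.
  case: (boolP (freq2 xi < (r / 2) ^+ 2)) => h.
    have l1 : low (r / 2) xi = 1 by rewrite /low h.
    by rewrite l1 mulr1 !mul1r; exact: high_power_le.
  by rewrite /low (negbTE h) !mul0r !mulr0 addr0.
rewrite (@RintegralZl _ _ _ mu _ _ (high_power (5 / 2 * r)) measurableT Il) (Rintegral_low r20) in H.
rewrite (@RintegralD _ _ _ mu _ _ _ measurableT (integZ 2 J1) (integZ (2 * (2 * pi) ^+ n) Id)) in H.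
rewrite (@RintegralZl _ _ _ mu _ _ 2 measurableT J1) in H.
rewrite (@RintegralZl _ _ _ mu _ _ (2 * (2 * pi) ^+ n) measurableT Id) in H.
rewrite mulrC; apply: (le_trans H).
move: J2; move: (\int[mu]_xi (low _ xi * \int[mu]_eta _))
  (\int[mu]_eta (high _ _ _ * density _)) (\int[mu]_xi (low _ _ * (V - _))).
move: ((2 * pi) ^+ n) => c; clear => A B D h.
by have -> : 2 * c * (B + D) = 2 * (c * B) + 2 * c * D; [ring|rewrite lerD2r ler_wpM2l].
Qed.

End orthonormal_systems.

(** * The bathtub principle and the eigenvalue bound *)

(** With [q] the square of the radius, [s = |xi|^2], [S] the density and [c]
    its upper bound: at a high frequency [s^2 >= 16 q^2], so a unit of mass there
    costs more than [15/16] of [q^2] above the price [q^2] paid on the sphere. *)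
Lemma bathtub_arith_high (R : realFieldType) (S s c q : R) :
  0 <= S -> 0 <= s -> 0 < q -> 4 * q <= s ->
  q ^+ 2 * S + c * ((if s < q then 1 else 0) * s ^+ 2) - q ^+ 2 * c * (if s < q then 1 else 0) +
  15 / 16 * q ^+ 2 * (1 * S + (if s < q / 4 then 1 else 0) * (c - S)) <= s ^+ 2 * S.
Proof.
move=> S0 s0 q0 hs; rewrite !ifN -?leNgt; [|lra|lra].
have : (4 * q) ^+ 2 <= s ^+ 2 by rewrite lerXn2r// nnegrE; lra.
move/(ler_wpM2r S0); have : 0 <= q ^+ 2 * S by rewrite mulr_ge0// sqr_ge0.
rewrite exprMn; move: (s ^+ 2) (q ^+ 2) => X Y; nra.
Qed.

(** Inside the ball [(s^2 - q^2) (S - c) >= 0], outside it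
    [(s^2 - q^2) S >= 0]: this is the bathtub principle.  In the inner half
    one has [s^2 <= q^2 / 16], so each unit of missing mass costs at least [15/16]
    of [q^2]. *)
Lemma bathtub_arith_low (R : realFieldType) (S s c q : R) :
  0 <= S -> S <= c -> 0 <= s -> 0 < q ->
  q ^+ 2 * S + c * ((if s < q then 1 else 0) * s ^+ 2) - q ^+ 2 * c * (if s < q then 1 else 0) +
  15 / 16 * q ^+ 2 * (0 * S + (if s < q / 4 then 1 else 0) * (c - S)) <= s ^+ 2 * S.
Proof.
move=> S0 SV s0 q0; have SV' : 0 <= c - S by rewrite subr_ge0.
case: ltP => h1; case: ltP => h2.
- have : s ^+ 2 <= (q / 4) ^+ 2 by rewrite lerXn2r ?nnegrE//; lra.
  by move/(ler_wpM2r SV'); lra.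
- have : s ^+ 2 <= q ^+ 2 by rewrite lerXn2r ?nnegrE//; lra.
  by move/(ler_wpM2r SV'); lra.
- exfalso; lra.
- have : q ^+ 2 <= s ^+ 2 by rewrite lerXn2r ?nnegrE//; lra.
  by move/(ler_wpM2r S0); lra.
Qed.

Section bathtub.
Context {R : realType} {n : nat}.
Local Notation mu := (@lebesgue_rV R n).
Implicit Types (x y z xi eta : 'rV[R]_n).
Variables (k : nat) (v w : 'I_k -> 'rV[R]_n -> R).
Hypotheses (Lv : forall i, L12 (v i)) (Av : forall i, approximable (v i))
  (ov : forall i j, \int[mu]_x (v i x * v j x) = (i == j)%:R)
  (Lw : forall i, L12 (w i))
  (cosF_w : forall i xi, cosF (w i) xi = - freq2 xi * cosF (v i) xi)
  (sinF_w : forall i xi, sinF (w i) xi = - freq2 xi * sinF (v i) xi).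

Lemma Rintegral_density : \int[mu]_xi density v xi = (2 * pi) ^+ n * k%:R.
Proof.
have I i : integ mu (powF (v i)) := (bessel_fourier (Lv i).1 (Lv i).2).1.
rewrite /density (Rintegral_sum _ I).
under eq_bigr => i _.
  rewrite (plancherel (Lv i) (Av i)).
  under eq_Rintegral do rewrite expr2.
  rewrite ov eqxx mulr1.
  over.
by rewrite sumr_const card_ord mulr_natr.
Qed.

Lemma density_moment : integ mu (fun xi => freq2 xi ^+ 2 * density v xi) /\
  \int[mu]_xi (freq2 xi ^+ 2 * density v xi) <=
  (2 * pi) ^+ n * \sum_i \int[mu]_x (w i x ^+ 2).
Proof.
have I i : integ mu (powF (w i)) := (bessel_fourier (Lw i).1 (Lw i).2).1.
have E : (fun xi => freq2 xi ^+ 2 * density v xi) = (fun xi => \sum_i powF (w i) xi).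
  apply/funext => xi; rewrite /density mulr_sumr; apply: eq_bigr => i _.
  by rewrite /powF cosF_w sinF_w; ring.
rewrite E; split; first by apply: integ_sum => i; exact: I.
rewrite (Rintegral_sum _ I) mulr_sumr; apply: ler_sum => i _.
exact: (bessel_fourier (Lw i).1 (Lw i).2).2.
Qed.

Variables (Omega : set 'rV[R]_n) (a : R) (i0 : 'I_n).
Hypotheses (oO : open Omega) (a0 : 0 < a) (Oa : Omega `<=` cube a)
  (v0 : forall i x, ~ Omega x -> v i x = 0).

Local Notation V := (fine (mu Omega)).

Lemma bathtub_pointwise (r : R) xi : 0 < r ->
  r ^+ 4 * density v xi + V * (low r xi * freq2 xi ^+ 2) - r ^+ 4 * V * low r xi +
    15 / 16 * r ^+ 4 * (high i0 (2 * r) xi * density v xi + low (r / 2) xi * (V - density v xi))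
  <= freq2 xi ^+ 2 * density v xi.
Proof.
move=> r0.
have S0 := density_ge0 v xi; have SV := density_le Lv ov oO Oa v0 xi.
have s0 := freq2_ge0 xi; have hs := freq2_coord xi i0.
have -> : r ^+ 4 = (r ^+ 2) ^+ 2 by rewrite -exprM.
have q0 : 0 < r ^+ 2 by rewrite exprn_gt0.
have q4 : (r / 2) ^+ 2 = r ^+ 2 / 4 by field.
rewrite /low q4.
have [hh|lh] : (high i0 (2 * r) xi = 1 /\ 4 * r ^+ 2 <= freq2 xi) \/ high i0 (2 * r) xi = 0.
  rewrite /high; case: ifPn => h; [left; split=> //|by right].
  apply: le_trans hs; rewrite -(real_normK (num_real (xi 0 i0))).
  have -> : 4 * r ^+ 2 = (2 * r) ^+ 2 by ring.
  by rewrite lerXn2r// nnegrE// mulr_ge0// ltW.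
- case: hh => -> hh. exact: (bathtub_arith_high V S0 s0 q0 hh).
by rewrite lh; exact: bathtub_arith_low.
Qed.

(** The last term is the price of the mass of the density that is missing in
    the half ball or lies in the high region. *)
Lemma improved_bathtub (r : R) : 0 < r ->
  r ^+ 4 * ((2 * pi) ^+ n * k%:R) + V * (r ^+ (n + 4) * @ball_moment R n) -
    r ^+ 4 * V * (r ^+ n * @ball_volume R n) +
    15 / 16 * r ^+ 4 * (\int[mu]_eta (high i0 (2 * r) eta * density v eta) +
                       \int[mu]_xi (low (r / 2) xi * (V - density v xi)))
  <= (2 * pi) ^+ n * \sum_i \int[mu]_x (w i x ^+ 2).
Proof.
move=> r0; have r20 : 0 < r / 2 by rewrite divr_gt0.
have [IR BR] := density_moment; apply: le_trans BR.
have I1 : integ mu (density v) := integ_density Lv.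
have I2 := @integ_freq_low R n r (ltW r0).
have I3 := (@L12_low R n r (ltW r0)).1.
have I4 : integ mu (fun eta => high i0 (2 * r) eta * density v eta).
  under eq_fun do rewrite mulrC; apply: integ_mulb I1 (measurable_high i0 _) _ => eta.
  by have /andP[h1 h2] := high01 i0 (2 * r) eta; rewrite ger0_norm.
have I5 : integ mu (fun xi => low (r / 2) xi * (V - density v xi)).
  have E xi : low (r / 2) xi * (V - density v xi) = V * low (r / 2) xi - density v xi * low (r / 2) xi by ring.
  under eq_fun do rewrite E.
  apply: integB; first exact: integZ (@L12_low R n _ (ltW r20)).1.
  exact: integ_mulb I1 (@measurable_low R n _) (@normr_low R n _).
have Z1 := integZ (r ^+ 4) I1; have Z2 := integZ V I2; have Z3 := integZ (r ^+ 4 * V) I3.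
have Z5 := integZ (15 / 16 * r ^+ 4) (integD I4 I5).
have D12 := integD Z1 Z2; have D123 := integB D12 Z3; have D := integD D123 Z5.
have := le_Rintegral measurableT D IR (fun xi _ => bathtub_pointwise xi r0).
rewrite (@RintegralD _ _ _ mu _ _ _ measurableT D123 Z5).
rewrite (@RintegralB _ _ _ mu _ _ _ measurableT D12 Z3).
rewrite (@RintegralD _ _ _ mu _ _ _ measurableT Z1 Z2).
rewrite (@RintegralZl _ _ _ mu _ _ (r ^+ 4) measurableT I1).
rewrite (@RintegralZl _ _ _ mu _ _ V measurableT I2).
rewrite (@RintegralZl _ _ _ mu _ _ (r ^+ 4 * V) measurableT I3).
rewrite (@RintegralZl _ _ _ mu _ _ (15 / 16 * r ^+ 4) measurableT (integD I4 I5)).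
rewrite (@RintegralD _ _ _ mu _ _ _ measurableT I4 I5).
by rewrite (Rintegral_freq_low r0) (Rintegral_low r0) Rintegral_density.
Qed.

End bathtub.

Section eigenvalue_sums.
Context {R : realType} {n : nat}.
Local Notation mu := (@lebesgue_rV R n).
Variables (Omega : set 'rV[R]_n) (a : R) (i0 : 'I_n).
Hypotheses (oO : open Omega) (a0 : 0 < a) (Oa : Omega `<=` cube a).

Local Notation V := (fine (mu Omega)).
Local Notation omega := (@ball_volume R n).

Lemma high_power_ge (r : R) : 0 < r ->
  (2 * pi) ^+ n * V / (6 * (1 + 5 * a * r)) <= high_power Omega i0 (5 / 2 * r).
Proof.
move=> r0; have h0 : 0 < (5 / 2 * r)^-1 by rewrite invr_gt0 mulr_gt0.
have := high_frequency_tail i0 oO a0 Oa h0; rewrite invrK; apply: le_trans.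
have P0 : 0 <= (2 * pi) ^+ n / 12 :> R by rewrite divr_ge0// exprn_ge0// mulr_ge0 ?pi_ge0.
have := ler_wpM2l P0 (jump_ge i0 oO a0 Oa h0).
rewrite [X in _ <= X]mulrAC; apply: le_trans; rewrite le_eqVlt; apply/orP; left; apply/eqP.
have d0 : 1 + 5 * a * r != 0 by rewrite gt_eqF// addr_gt0// !mulr_gt0.
have r1 : r != 0 by rewrite gt_eqF.
have d1 : 2 * a + (5 / 2 * r)^-1 != 0 by rewrite gt_eqF// addr_gt0// mulr_gt0.
have -> : 2 * a + (5 / 2 * r)^-1 = (1 + 5 * a * r) / (5 / 2 * r) by field.
by field; rewrite r1 d0.
Qed.

(** With [r] chosen so that the ball of radius [r] filled up to the level
    [V] has the mass of the density, the terms of [improved_bathtub] that are linear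
    in this mass cancel.  The second term comes from [spectral_defect] and
    [high_power_ge]. *)
Lemma eigenvalue_sum_ge (Gamma : nat -> R) (k : nat) (r : R) :
  clamped_spectrum Omega Gamma -> 0 < r -> V * (r ^+ n * omega) = (2 * pi) ^+ n * k%:R ->
  n%:R / (n%:R + 4) * k%:R * r ^+ 4 + 5 / (64 * 2 ^+ n) * k%:R * r ^+ 4 / (1 + 5 * a * r)
  <= \sum_(i < k) Gamma i.
Proof.
move=> HG r0 rk.
have mO : measurable Omega := open_measurable_rV oO.
have [v [w [Hv Lw Tw ov <-]]] := spectral_system mO (domain_lty oO Oa) k HG.
have Lv i : L12 (v i) := (Hv i).1.
have Av i : approximable (v i) := (Hv i).2.1.
have v0 i x : ~ Omega x -> v i x = 0 := (Hv i).2.2 x.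
have cw i xi := (Tw i xi).1; have sw i xi := (Tw i xi).2.
have B := improved_bathtub Lv Av ov Lw cw sw i0 oO Oa v0 r0.
have D := spectral_defect Lv ov i0 oO Oa v0 r0.
have T := high_power_ge r0.
have M := @ball_momentE R n; have W := @ball_volume_gt0 R n.
have P0 : 0 < (2 * pi) ^+ n :> R by rewrite exprn_gt0// mulr_gt0 ?pi_gt0.
move: B D T M W P0 rk.
move: (\int[mu]_eta (high i0 (2 * r) eta * density v eta) +
                       \int[mu]_xi (low (r / 2) xi * (V - density v xi))).
move: (\sum_i \int[mu]_x (w i x ^+ 2)) (high_power Omega i0 (5 / 2 * r)) V omega ball_moment ((2 * pi) ^+ n).
move: (k%:R : R).
clear - r0 a0 => K S t c om M P D B Dt T HM W P0 rk.
have n4 : n%:R + 4 != 0 :> R by rewrite gt_eqF// ltr_wpDl.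
have {HM}EM : M = n%:R / (n%:R + 4) * om by rewrite mulrAC -HM; field.
have E1 : c * (r ^+ (n + 4) * M) = n%:R / (n%:R + 4) * K * r ^+ 4 * P.
  transitivity (n%:R / (n%:R + 4) * r ^+ 4 * (c * (r ^+ n * om))); last by rewrite rk; ring.
  by rewrite EM exprD; ring.
have E2 : r ^+ 4 * c * (r ^+ n * om) = r ^+ 4 * (P * K) by rewrite -mulrA rk.
rewrite E1 E2 in B.
have d0 : 0 < 1 + 5 * a * r by rewrite addr_gt0// !mulr_gt0//.
have t2 : 0 < 2 ^+ n :> R by rewrite exprn_gt0.
have D1 : P * K / (12 * 2 ^+ n * (1 + 5 * a * r)) <= D.
  have : (r / 2) ^+ n * om * (P * c / (6 * (1 + 5 * a * r))) <= 2 * P * D.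
    by apply: le_trans Dt; rewrite ler_wpM2l// mulr_ge0 ?exprn_ge0 ?divr_ge0 ?(ltW r0) ?(ltW W).
  rewrite [X in X <= _ -> _](_ : _ = 2 * P * (P * K / (12 * 2 ^+ n * (1 + 5 * a * r)))).
    by rewrite ler_pM2l// mulr_gt0.
  rewrite -rk expr_div_n; field.
  by rewrite !gt_eqF.
rewrite -(ler_pM2l P0); apply: le_trans B.
have c0 : 0 <= 15 / 16 * r ^+ 4 by rewrite mulr_ge0 ?exprn_ge0 ?(ltW r0).
have := ler_wpM2l c0 D1.
have -> : 15 / 16 * r ^+ 4 * (P * K / (12 * 2 ^+ n * (1 + 5 * a * r))) =
  P * (5 / (64 * 2 ^+ n) * K * r ^+ 4 / (1 + 5 * a * r)).
  by field; rewrite !gt_eqF.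
move: (5 / _ * _ * _ / _) (_ * D) => X Y XY.
have -> : P * (n%:R / (n%:R + 4) * K * r ^+ 4 + X) = n%:R / (n%:R + 4) * K * r ^+ 4 * P + P * X by ring.
have -> : r ^+ 4 * (P * K) + n%:R / (n%:R + 4) * K * r ^+ 4 * P - r ^+ 4 * (P * K) + Y =
  n%:R / (n%:R + 4) * K * r ^+ 4 * P + Y by ring.
by rewrite lerD2l.
Qed.

End eigenvalue_sums.

Lemma powR_exprn (R : realType) (x y : R) (m : nat) : (x `^ y) ^+ m = x `^ (y * m%:R).
Proof. by rewrite -powR_mulrn ?powR_ge0// -powRrM. Qed.

Theorem theorem4p1 (R : realType) (n : nat) (n_ge1 : (1 <= n)%N)
    (Omega : set 'rV[R]_n) (Omega_domain : domain Omega)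
    (Omega_bounded : bounded_set Omega) :
  let alpha : R := fine (lebesgue_rV Omega) / (2 * pi) ^+ n in
  let omega : R := fine (lebesgue_rV (@unit_ball R n)) in
  exists2 A1 : R, 0 < A1 &
  forall m : nat, (1 <= m <= n)%N ->
  exists2 C : R, 0 <= C &
  forall Gamma : nat -> R, clamped_spectrum Omega Gamma ->
  forall k : nat, (1 <= k)%N ->
    n%:R / (n%:R + 4) * omega `^ (- (4 / n%:R)) * alpha `^ (- (4 / n%:R))
        * k%:R `^ (1 + 4 / n%:R)
      + A1 * k%:R `^ (1 + 3 / n%:R)
      - C * k%:R `^ ((n%:R - m%:R + 4) / n%:R)
    <= \sum_(i < k) Gamma i.
Proof.
move=> alpha omega; case: Omega_domain => oO _ O0.
have [a a0 Oa] := bounded_cube Omega_bounded.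
have V0 : 0 < fine (lebesgue_rV Omega).
  by rewrite fine_gt0// open_mu_gt0//; exact: domain_lty oO Oa.
have P0 : 0 < (2 * pi) ^+ n :> R by rewrite exprn_gt0// mulr_gt0 ?pi_gt0.
have om0 : 0 < omega := @ball_volume_gt0 R n.
have al0 : 0 < alpha by rewrite divr_gt0.
have n0 : n%:R != 0 :> R by rewrite pnatr_eq0 -lt0n.
(* The radius for k eigenvalues is beta * k^(1/n). *)
pose beta := omega `^ (- n%:R^-1) * alpha `^ (- n%:R^-1).
have b0 : 0 < beta by rewrite mulr_gt0 ?powR_gt0.
have b4 : beta ^+ 4 = omega `^ (- (4 / n%:R)) * alpha `^ (- (4 / n%:R)).
  by rewrite exprMn !powR_exprn !mulNr ![_^-1 * _]mulrC.
have bn : beta ^+ n * omega * alpha = 1.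
  rewrite exprMn !powR_exprn !mulNr mulVf// !powR_inv1 ?(ltW om0) ?(ltW al0)//.
  by field; rewrite !gt_eqF.
clearbody beta.
pose A1 := 5 / (64 * 2 ^+ n) * beta ^+ 4 / (1 + 5 * a * beta).
have d0 : 0 < 1 + 5 * a * beta by rewrite addr_gt0// mulr_gt0// mulr_gt0.
have c0 : 0 < 5 / (64 * 2 ^+ n) :> R by rewrite divr_gt0// mulr_gt0// exprn_gt0.
exists A1; first by rewrite divr_gt0// mulr_gt0// exprn_gt0.
move=> m _; exists 0 => // Gamma HG k k1; rewrite mul0r subr0.
pose x : R := k%:R `^ n%:R^-1.
have k0 : 0 < k%:R :> R by rewrite ltr0n.
(* This bounds 1 + 5 a beta x by (1 + 5 a beta) x, the source of the power 3/n. *)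
have x1 : 1 <= x by rewrite -(powRr0 (k%:R : R)) ler_powR ?ler1n// invr_ge0.
have x0 : 0 < x := lt_le_trans ltr01 x1.
have xn : x ^+ n = k%:R by rewrite powR_exprn mulVf// powRr1// ltW.
have xp j : k%:R `^ (1 + j%:R / n%:R) = k%:R * x ^+ j :> R.
  by rewrite powR_exprn mulrC powRD ?powRr1 ?(ltW k0) ?(gt_eqF k0) ?implybT// mulrC [_^-1 * _]mulrC.
have rk : fine (lebesgue_rV Omega) * ((beta * x) ^+ n * @ball_volume R n) = (2 * pi) ^+ n * k%:R.
  have -> : @ball_volume R n = omega by [].
  transitivity (beta ^+ n * omega * alpha * ((2 * pi) ^+ n * k%:R)); last by rewrite bn mul1r.
  by rewrite exprMn xn /alpha; field; rewrite gt_eqF.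
have := eigenvalue_sum_ge (Ordinal n_ge1) oO a0 Oa HG (mulr_gt0 b0 x0) rk.
apply: le_trans; rewrite (xp 4%N) (xp 3%N) -[_ * _ `^ _ * _ `^ _]mulrA -b4.
apply: lerD; first by rewrite exprMn le_eqVlt; apply/orP; left; apply/eqP; ring.
rewrite /A1.
have e0 : 0 < 1 + 5 * a * (beta * x) by rewrite addr_gt0// mulr_gt0// mulr_gt0.
have -> : 5 / (64 * 2 ^+ n) * beta ^+ 4 / (1 + 5 * a * beta) * (k%:R * x ^+ 3) =
    5 / (64 * 2 ^+ n) * beta ^+ 4 * k%:R * x ^+ 3 * (1 + 5 * a * beta)^-1 by ring.
have -> : 5 / (64 * 2 ^+ n) * k%:R * (beta * x) ^+ 4 / (1 + 5 * a * (beta * x)) =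
    5 / (64 * 2 ^+ n) * beta ^+ 4 * k%:R * x ^+ 3 * (x / (1 + 5 * a * (beta * x))) by ring.
apply: ler_wpM2l; first by rewrite !mulr_ge0 ?exprn_ge0 ?(ltW c0) ?(ltW b0) ?(ltW x0).
rewrite -[leLHS]mul1r ler_pdivlMr// mulrAC ler_pdivrMr// mul1r.
by rewrite [leRHS]mulrDr mulr1 [x * _]mulrC -[_ * beta * x]mulrA lerD2r.
Qed.
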